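(* Fix $p\ge1$ and let $N=pd_N$ with $d_N\to\infty$. Let $\mathbb{C}^N$ be decomposed orthogonally into $p$ subspaces of dimension $d_N$ with chosen orthonormal bases, so that each $M\in\mathcal{M}_N(\mathbb{C})$ is a $p\times p$ block matrix with blocks $M(i,j)\in\mathcal{M}_{d_N}(\mathbb{C})$. Let $U_{d_N}$ be a Haar distributed random unitary $d_N\times d_N$ matrix leaving the first vector $\varepsilon_1$ of the canonical basis of $\mathbb{C}^{d_N}$ invariant. Let $\mathbf{A}_N=\{A_N^k:k\in K\}$ and $\mathbf{B}_N=\{B_N^k:k\in K\}$ be families of deterministic $N\times N$ matrices bounded in operator norm uniformly in $N$. Then, as $N\to\infty$, $\mathbf{A}_N$ and $U_{d_N}\mathbf{B}_NU_{d_N}^\star$ are almost surely asymptotically conditionally free over $\mathcal{M}_p(\mathbb{C})$: for any $P\in\mathcal{M}_p(\mathbb{C})\langle X_k,Y_k:k\in K\rangle$, almost surely, $$\psi_{\mathbf{A}_N,U_{d_N}\mathbf{B}_NU_{d_N}^\star}(P)=(\psi_{\mathbf{A}_N}*\psi_{\mathbf{B}_N})(P)+o(1),$$ $$\varphi_{\mathbf{A}_N,U_{d_N}\mathbf{B}_NU_{d_N}^\star}(P)=\big(\varphi_{\mathbf{A}_N}\,{}_{\psi_{\mathbf{A}_N}}\!*_{\psi_{\mathbf{B}_N}}\,\varphi_{\mathbf{B}_N}\big)(P)+o(1).$$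
   Context: For $U\in\mathcal{M}_{d_N}(\mathbb{C})$, $UMU^\star$ denotes the matrix with blocks $UM(i,j)U^\star$ (conjugation by the block diagonal matrix with all diagonal blocks equal to $U$), and $U\mathbf{B}U^\star=\{UB^kU^\star\}$. $\mathcal{M}_p(\mathbb{C})$ acts on $\mathcal{M}_N(\mathbb{C})$ on the left and right by multiplication by $m\otimes I_{d_N}$ (the block matrix with blocks $m_{ij}I_{d_N}$). For $M\in\mathcal{M}_N(\mathbb{C})$: $\psi(M)=\big(\frac1{d_N}\mathrm{Tr}(M(i,j))\big)_{1\le i,j\le p}\in\mathcal{M}_p(\mathbb{C})$ and $\varphi(M)=\big(\mathrm{Tr}(\varepsilon_1\varepsilon_1^\star M(i,j))\big)_{1\le i,j\le p}\in\mathcal{M}_p(\mathbb{C})$. $\mathcal{M}_p(\mathbb{C})\langle X_k,Y_k\rangle$ is the algebra of polynomials in noncommuting indeterminates with coefficients in $\mathcal{M}_p(\mathbb{C})$ (not commuting with the indeterminates); on evaluation a coefficient $m$ becomes $m\otimes I_{d_N}$. $\psi_{\mathbf{A}_N}(P)=\psi(P(\mathbf{A}_N))$, $\varphi_{\mathbf{A}_N}(P)=\varphi(P(\mathbf{A}_N))$, similarly for $\mathbf{B}_N$ on $\mathcal{M}_p(\mathbb{C})\langle Y_k\rangle$ and for pairs of families ($X_k$ evaluated on the first, $Y_k$ on the second). Operator-valued conditionally free product: for unital $\mathcal{B}$-bimodule maps $\psi_1,\varphi_1$ on $\mathcal{B}\langle X_k\rangle$ and $\psi_2,\varphi_2$ on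 $\mathcal{B}\langle Y_k\rangle$ with values in $\mathcal{B}=\mathcal{M}_p(\mathbb{C})$, $\psi_1*\psi_2$ is the unique $\mathcal{B}$-bimodule map on $\mathcal{B}\langle X_k,Y_k\rangle$ extending $\psi_1,\psi_2$ and vanishing on products $P_1\cdots P_n$ whose factors alternate between $\mathcal{B}\langle X_k\rangle$ and $\mathcal{B}\langle Y_k\rangle$ and are each centered (mapped to $0$ by $\psi_1$ or $\psi_2$); $\varphi_1\,{}_{\psi_1}\!*_{\psi_2}\,\varphi_2$ is the unique $\mathcal{B}$-bimodule map $\varphi$ extending $\varphi_1,\varphi_2$ with $\varphi(P_1\cdots P_n)=\varphi(P_1)\cdots\varphi(P_n)$ for all such alternating centered products. *)

(* Defs.v *)
From HB Require Import structures.
From mathcomp Require Import all_boot all_order all_algebra.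
From mathcomp Require Import complex.
From mathcomp Require Import all_classical all_reals all_analysis.
From mathcomp Require Import generic_quotient.

Set Implicit Arguments.
Unset Strict Implicit.
Unset Printing Implicit Defensive.

Import Order.TTheory GRing.Theory Num.Theory.
Import numFieldNormedType.Exports.

Local Open Scope classical_set_scope.
Local Open Scope quotient_scope.
Local Open Scope sesquilinear_scope.
Local Open Scope ring_scope.

(* [complex R] carries no topology of its own; packaged as a numClosedFieldType
   it inherits the one given by the modulus. *)
Definition Cplx (R : realType) : numClosedFieldType := R[i].

(******************************************************************************)
(* Noncommutative polynomials over I with coefficients in B = 'M[F]_p: the    *)
(* F-algebra freely generated by B and I, presented as formal expressions     *)
(* modulo the congruence generated by the ring axioms, the operations of B    *)
(* and the centrality of the scalars a%:M. No other element of B is made to   *)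
(* commute with the indeterminates.                                           *)
(******************************************************************************)

Section NCPoly.
Variables (F : comNzRingType) (p : nat) (I : Type).
Local Notation B := 'M[F]_p.

Inductive ncterm : Type :=
  | TCoef of B
  | TVar of I
  | TAdd of ncterm & ncterm
  | TMul of ncterm & ncterm.

Inductive ncequiv : ncterm -> ncterm -> Prop :=
  | nce_refl x : ncequiv x x
  | nce_sym x y : ncequiv x y -> ncequiv y x
  | nce_trans y x z : ncequiv x y -> ncequiv y z -> ncequiv x z
  | nce_add x x' y y' :
      ncequiv x x' -> ncequiv y y' -> ncequiv (TAdd x y) (TAdd x' y')
  | nce_mul x x' y y' :
      ncequiv x x' -> ncequiv y y' -> ncequiv (TMul x y) (TMul x' y')
  | nce_addA x y z : ncequiv (TAdd x (TAdd y z)) (TAdd (TAdd x y) z)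
  | nce_addC x y : ncequiv (TAdd x y) (TAdd y x)
  | nce_add0 x : ncequiv (TAdd (TCoef 0) x) x
  | nce_mulA x y z : ncequiv (TMul x (TMul y z)) (TMul (TMul x y) z)
  | nce_mul1l x : ncequiv (TMul (TCoef 1) x) x
  | nce_mul1r x : ncequiv (TMul x (TCoef 1)) x
  | nce_mul0l x : ncequiv (TMul (TCoef 0) x) (TCoef 0)
  | nce_mulDl x y z :
      ncequiv (TMul (TAdd x y) z) (TAdd (TMul x z) (TMul y z))
  | nce_mulDr x y z :
      ncequiv (TMul x (TAdd y z)) (TAdd (TMul x y) (TMul x z))
  | nce_coefD a b : ncequiv (TCoef (a + b)) (TAdd (TCoef a) (TCoef b))
  | nce_coefM a b : ncequiv (TCoef (a * b)) (TMul (TCoef a) (TCoef b))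
  | nce_scalar (a : F) i :
      ncequiv (TMul (TCoef a%:M) (TVar i)) (TMul (TVar i) (TCoef a%:M)).

HB.instance Definition _ := gen_eqMixin ncterm.
HB.instance Definition _ := gen_choiceMixin ncterm.

Definition ncequivb (x y : ncterm) : bool := `[< ncequiv x y >].

Lemma ncequivb_refl : reflexive ncequivb.
Proof. by move=> x; apply/asboolP; exact: nce_refl. Qed.

Lemma ncequivb_sym : symmetric ncequivb.
Proof. by move=> x y; apply/idP/idP => /asboolP h; apply/asboolP/nce_sym. Qed.

Lemma ncequivb_trans : transitive ncequivb.
Proof.
move=> y x z /asboolP xy /asboolP yz; apply/asboolP.
exact: nce_trans xy yz.
Qed.

Canonical ncequivb_rel :=
  EquivRel ncequivb ncequivb_refl ncequivb_sym ncequivb_trans.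

Definition ncpoly : Type := {eq_quot ncequivb}.

HB.instance Definition _ := Choice.on ncpoly.
HB.instance Definition _ := EqQuotient.on ncpoly.

Lemma ncpolyP x y : \pi_ncpoly x = \pi_ncpoly y <-> ncequiv x y.
Proof.
split=> [/eqmodP /asboolP //|h].
by apply/eqmodP/asboolP.
Qed.

Definition nccoef (b : B) : ncpoly := \pi_ncpoly (TCoef b).
Definition ncvar (i : I) : ncpoly := \pi_ncpoly (TVar i).
Definition ncadd (x y : ncpoly) : ncpoly := \pi_ncpoly (TAdd (repr x) (repr y)).
Definition ncmul (x y : ncpoly) : ncpoly := \pi_ncpoly (TMul (repr x) (repr y)).
Definition ncopp (x : ncpoly) : ncpoly := ncmul (nccoef (-1)) x.

Lemma pi_ncadd x y : ncadd (\pi_ncpoly x) (\pi_ncpoly y) = \pi_ncpoly (TAdd x y).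
Proof. by apply/ncpolyP; apply: nce_add; apply/ncpolyP; rewrite reprK. Qed.

Lemma pi_ncmul x y : ncmul (\pi_ncpoly x) (\pi_ncpoly y) = \pi_ncpoly (TMul x y).
Proof. by apply/ncpolyP; apply: nce_mul; apply/ncpolyP; rewrite reprK. Qed.

Fact ncaddA : associative ncadd.
Proof.
elim/quotW=> x; elim/quotW=> y; elim/quotW=> z.
by rewrite (pi_ncadd y z) (pi_ncadd x y) !pi_ncadd; apply/ncpolyP/nce_addA.
Qed.

Fact ncaddC : commutative ncadd.
Proof.
elim/quotW=> x; elim/quotW=> y.
by rewrite !pi_ncadd; apply/ncpolyP; exact: nce_addC.
Qed.

Fact ncadd0 : left_id (nccoef 0) ncadd.
Proof.
by elim/quotW=> x; rewrite pi_ncadd; apply/ncpolyP; exact: nce_add0.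
Qed.

Fact ncmulA : associative ncmul.
Proof.
elim/quotW=> x; elim/quotW=> y; elim/quotW=> z.
by rewrite (pi_ncmul y z) (pi_ncmul x y) !pi_ncmul; apply/ncpolyP/nce_mulA.
Qed.

Fact ncmul1l : left_id (nccoef 1) ncmul.
Proof.
by elim/quotW=> x; rewrite pi_ncmul; apply/ncpolyP; exact: nce_mul1l.
Qed.

Fact ncmul1r : right_id (nccoef 1) ncmul.
Proof.
by elim/quotW=> x; rewrite pi_ncmul; apply/ncpolyP; exact: nce_mul1r.
Qed.

Fact ncmulDl : left_distributive ncmul ncadd.
Proof.
elim/quotW=> x; elim/quotW=> y; elim/quotW=> z.
rewrite (pi_ncadd x y) (pi_ncmul x z) (pi_ncmul y z) pi_ncadd pi_ncmul.
by apply/ncpolyP/nce_mulDl.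
Qed.

Fact ncmulDr : right_distributive ncmul ncadd.
Proof.
elim/quotW=> x; elim/quotW=> y; elim/quotW=> z.
rewrite (pi_ncadd y z) (pi_ncmul x y) (pi_ncmul x z) pi_ncadd pi_ncmul.
by apply/ncpolyP/nce_mulDr.
Qed.

Fact nccoefD_subproof a b : nccoef (a + b) = ncadd (nccoef a) (nccoef b).
Proof. by rewrite pi_ncadd; apply/ncpolyP; exact: nce_coefD. Qed.

Fact ncaddN : left_inverse (nccoef 0) ncopp ncadd.
Proof.
move=> x; rewrite /ncopp -{2}[x]ncmul1l -ncmulDl -nccoefD_subproof addNr.
elim/quotW: x => x; rewrite pi_ncmul; apply/ncpolyP; exact: nce_mul0l.
Qed.

HB.instance Definition _ :=
  GRing.isZmodule.Build ncpoly ncaddA ncaddC ncadd0 ncaddN.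
HB.instance Definition _ :=
  GRing.Zmodule_isPzRing.Build ncpoly ncmulA ncmul1l ncmul1r ncmulDl ncmulDr.

Fact nccoef_is_zmod_morphism : zmod_morphism nccoef.
Proof.
move=> a b; apply: (addIr (nccoef b)); rewrite subrK.
by rewrite -[LHS]nccoefD_subproof subrK.
Qed.

Fact nccoef_is_monoid_morphism : monoid_morphism nccoef.
Proof.
split=> // a b; rewrite [RHS]pi_ncmul; apply/ncpolyP; exact: nce_coefM.
Qed.

HB.instance Definition _ :=
  GRing.isZmodMorphism.Build B ncpoly nccoef nccoef_is_zmod_morphism.
HB.instance Definition _ :=
  GRing.isMonoidMorphism.Build B ncpoly nccoef nccoef_is_monoid_morphism.

Lemma ncscalar_comm a i : GRing.comm (nccoef a%:M) (ncvar i).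
Proof.
rewrite /GRing.comm -[LHS]/(ncmul _ _) -[RHS]/(ncmul _ _) !pi_ncmul.
by apply/ncpolyP; exact: nce_scalar.
Qed.

End NCPoly.

Arguments nccoef {F p I} b.
Arguments ncvar {F p I} i.

Section Evaluation.
Variables (F : comNzRingType) (p : nat) (I : Type) (S : pzRingType).
Variables (rho : {rmorphism 'M[F]_p -> S}) (x : I -> S).

Fixpoint ncteval (t : ncterm F p I) : S :=
  match t with
  | TCoef b => rho b
  | TVar i => x i
  | TAdd t1 t2 => ncteval t1 + ncteval t2
  | TMul t1 t2 => ncteval t1 * ncteval t2
  end.

(* By [nceval_pi], this does not depend on the representative as soon as the
   images of the scalars commute with the values of the indeterminates. *)
Definition nceval (P : ncpoly F p I) : S := ncteval (repr P).

Hypothesis scalar_comm : forall a i, GRing.comm (rho a%:M) (x i).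

Lemma ncteval_equiv t1 t2 : ncequiv t1 t2 -> ncteval t1 = ncteval t2.
Proof.
elim=> //=.
- by move=> y z w _ -> _ ->.
- by move=> y y' z z' _ -> _ ->.
- by move=> y y' z z' _ -> _ ->.
- by move=> *; rewrite addrA.
- by move=> *; rewrite addrC.
- by move=> *; rewrite rmorph0 add0r.
- by move=> *; rewrite mulrA.
- by move=> *; rewrite rmorph1 mul1r.
- by move=> *; rewrite rmorph1 mulr1.
- by move=> *; rewrite rmorph0 mul0r.
- by move=> *; rewrite mulrDl.
- by move=> *; rewrite mulrDr.
- by move=> *; rewrite rmorphD.
- by move=> *; rewrite rmorphM.
Qed.

Lemma nceval_pi t : nceval (\pi_(ncpoly F p I) t) = ncteval t.
Proof. by apply: ncteval_equiv; apply/ncpolyP; rewrite reprK. Qed.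

Lemma nceval_coef b : nceval (nccoef b) = rho b.
Proof. exact: nceval_pi. Qed.

Lemma nceval_var i : nceval (ncvar i) = x i.
Proof. exact: nceval_pi. Qed.

Lemma ncevalD : {morph nceval : P Q / P + Q}.
Proof.
elim/quotW=> P; elim/quotW=> Q.
by rewrite [_ + _]pi_ncadd !nceval_pi.
Qed.

Lemma ncevalM : {morph nceval : P Q / P * Q}.
Proof.
elim/quotW=> P; elim/quotW=> Q.
by rewrite [_ * _]pi_ncmul !nceval_pi.
Qed.

End Evaluation.

Section FreeProducts.
Variables (F : comNzRingType) (p : nat) (I J : Type).
Local Notation B := 'M[F]_p.
Local Notation BX := (ncpoly F p I).
Local Notation BY := (ncpoly F p J).
Local Notation BXY := (ncpoly F p (I + J)).

Definition ncinl : BX -> BXY := nceval (@nccoef F p (I + J)) (ncvar \o inl).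
Definition ncinr : BY -> BXY := nceval (@nccoef F p (I + J)) (ncvar \o inr).

Definition bimodule_map (A : Type) (f : ncpoly F p A -> B) : Prop :=
  {morph f : P Q / P + Q} /\
  forall b P b', f (nccoef b * P * nccoef b') = b * f P * b'.

Definition factor_val (x : BX + BY) : BXY :=
  match x with inl P => ncinl P | inr Q => ncinr Q end.

Definition factor_map (f1 : BX -> B) (f2 : BY -> B) (x : BX + BY) : B :=
  match x with inl P => f1 P | inr Q => f2 Q end.

Definition factor_side (x : BX + BY) : bool :=
  if x is inl _ then true else false.

Definition alternating_centered (psi1 : BX -> B) (psi2 : BY -> B)
    (s : seq (BX + BY)) : bool :=
  [&& (0 < size s)%N, sorted (fun x y => factor_side x != factor_side y) s &
      all (fun x => factor_map psi1 psi2 x == 0) s].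

Definition is_free_product psi1 psi2 (f : BXY -> B) : Prop :=
  [/\ bimodule_map f,
      forall P, f (ncinl P) = psi1 P,
      forall Q, f (ncinr Q) = psi2 Q &
      forall s, alternating_centered psi1 psi2 s ->
        f (\prod_(x <- s) factor_val x) = 0].

Definition is_cfree_product psi1 psi2 phi1 phi2 (f : BXY -> B) : Prop :=
  [/\ bimodule_map f,
      forall P, f (ncinl P) = phi1 P,
      forall Q, f (ncinr Q) = phi2 Q &
      forall s, alternating_centered psi1 psi2 s ->
        f (\prod_(x <- s) factor_val x) =
        \prod_(x <- s) factor_map phi1 phi2 x].

(* Definite descriptions: these maps exist and are unique when psi1, psi2
   (and phi1, phi2) are unital bimodule maps; the zero map is a default
   outside this case. *)
Definition free_product psi1 psi2 : BXY -> B :=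
  xget (fun=> 0) [set f | is_free_product psi1 psi2 f].

Definition cfree_product psi1 psi2 phi1 phi2 : BXY -> B :=
  xget (fun=> 0) [set f | is_cfree_product psi1 psi2 phi1 phi2 f].

End FreeProducts.

(* The sum of p block sizes all equal to d, which is the form in which the
   block operations of the matrix library read off the decomposition. *)
Notation blocksize p d := (\sum_(i < p) d)%N.

Section Blocks.
Variables (R : realType) (p d : nat).
Local Notation C := (Cplx R).
Local Notation N := (blocksize p d).

Definition block (M : 'M[C]_N) (i j : 'I_p) : 'M[C]_d :=
  @submxblock C p p (fun=> d) (fun=> d) M i j.

Definition ampl (m : 'M[C]_p) : 'M[C]_N :=
  \mxblock_(i < p, j < p) ((m i j)%:M : 'M[C]_(d, d)).

Fact ampl_is_zmod_morphism : zmod_morphism ampl.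
Proof.
move=> a b; rewrite /ampl -mxblockB.
by apply: eq_mxblock => i j; rewrite !mxE raddfB.
Qed.

Fact ampl_is_monoid_morphism : monoid_morphism ampl.
Proof.
split=> [|a b]; rewrite /ampl.
  rewrite -[RHS](@mxdiagZ _ p (fun=> d)); apply: eq_mxblock => i j.
  rewrite mxE; case: eqVneq => [_|_]; last by rewrite raddf0.
  by rewrite conform_mx_id.
rewrite [RHS]mul_mxblock; apply: eq_mxblock => i j.
rewrite mxE raddf_sum; apply: eq_bigr => k _.
by rewrite -scalar_mxM.
Qed.

HB.instance Definition _ :=
  GRing.isZmodMorphism.Build 'M[C]_p 'M[C]_N ampl ampl_is_zmod_morphism.
HB.instance Definition _ :=
  GRing.isMonoidMorphism.Build 'M[C]_p 'M[C]_N ampl ampl_is_monoid_morphism.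

Lemma ampl_scalar_comm (a : C) (M : 'M[C]_N) : GRing.comm (ampl a%:M) M.
Proof.
suff -> : ampl a%:M = a%:M by exact/esym/scalar_mxC.
rewrite -[RHS](@mxdiagZ _ p (fun=> d)); apply: eq_mxblock => i j.
rewrite mxE; case: eqVneq => [_|_]; last by rewrite raddf0.
by rewrite conform_mx_id.
Qed.

Definition conj_blocks (U : 'M[C]_d) (M : 'M[C]_N) : 'M[C]_N :=
  (\mxdiag_(i < p) U) *m M *m (\mxdiag_(i < p) U^t*).

Definition eps1 : 'cV[C]_d := \col_(i < d) (i == 0%N :> nat)%:R.

Definition psi (M : 'M[C]_N) : 'M[C]_p :=
  \matrix_(i, j) (d%:R^-1 * \tr (block M i j)).

Definition phi (M : 'M[C]_N) : 'M[C]_p :=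
  \matrix_(i, j) \tr (eps1 *m eps1^t* *m block M i j).

Definition mateval (I : Type) (x : I -> 'M[C]_N) : ncpoly C p I -> 'M[C]_N :=
  nceval ampl x.

Definition psi_of (I : Type) (x : I -> 'M[C]_N) (P : ncpoly C p I) : 'M[C]_p :=
  psi (mateval x P).

Definition phi_of (I : Type) (x : I -> 'M[C]_N) (P : ncpoly C p I) : 'M[C]_p :=
  phi (mateval x P).

Definition pair_family (I J : Type) (x : I -> 'M[C]_N) (y : J -> 'M[C]_N)
    (k : I + J) : 'M[C]_N :=
  match k with inl i => x i | inr j => y j end.

End Blocks.

Section OperatorNorm.
Variables (R : realType) (n : nat).

Definition l2norm (v : 'cV[Cplx R]_n) : R :=
  Num.sqrt (\sum_i Normc.normc (v i ord0) ^+ 2).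

Definition opnorm (M : 'M[Cplx R]_n) : R :=
  sup [set l2norm (M *m v) | v in [set v | l2norm v <= 1]].

End OperatorNorm.

Section Haar.
Variables (R : realType) (n : nat).

Definition unitary_fix_eps1 : set 'M[Cplx R]_n :=
  [set V | V \is unitarymx /\ V *m eps1 R n = eps1 R n].

Definition matrix_borel : set (set 'M[Cplx R]_n) := <<s @open 'M[Cplx R]_n >>.

(* U is a Borel random element of the compact group G whose law is invariant
   under the left translations of G, i.e. is the normalized Haar measure. *)
Definition haar_distributed (dsp : measure_display) (T : measurableType dsp)
    (Pr : probability T R) (G : set 'M[Cplx R]_n) (U : T -> 'M[Cplx R]_n) :=
  [/\ forall w, G (U w),
      forall S, matrix_borel S -> measurable (U @^-1` S) &
      forall V, G V -> forall S, matrix_borel S ->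
        Pr ((fun w => V *m U w) @^-1` S) = Pr (U @^-1` S)].

End Haar.

(* Main.v *)
Require Import Defs.
From HB Require Import structures.
From mathcomp Require Import all_boot all_order all_algebra.
From mathcomp Require Import complex.
From mathcomp Require Import all_classical all_reals all_analysis.
From mathcomp Require Import measurable_realfun generic_quotient.
From mathcomp Require Import ring lra.

Set Implicit Arguments.
Unset Strict Implicit.
Unset Printing Implicit Defensive.

Import Order.TTheory GRing.Theory Num.Theory.
Import numFieldNormedType.Exports.

Local Open Scope classical_set_scope.
Local Open Scope quotient_scope.
Local Open Scope sesquilinear_scope.
Local Open Scope ring_scope.

(** Both limits compare two bimodule maps on polynomials in two families: the
    joint state of the two matrix families and the free, or conditionally free,
    product of their separate states. The joint state restricts to the
    right states on each family, since conjugation by a unitary that fixes the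
    first basis vector changes neither a normalized trace nor the corner entry.
    Subtracting from each factor its block trace and multiplying out
    ([vanishes_word], [vanishes_poly]) reduces the theorem to alternating
    products of centered factors that are bounded in operator norm. On such a
    product the free product vanishes and the conditionally free product is the
    product of the values; that these maps exist is part of what must be proved
    ([free_productP], [cfree_productP]), by letting the two families act on
    functions on alternating words, as in the Fock space model of free products.

    What remains is asymptotic. Expanding a product of block matrices into blocks
    turns it into finite sums of alternating words in centered d x d matrices, in
    which every second letter is conjugated by the random unitary U. Write such a
    word as W L with last letter L, let Q be the projection off the first basis
    vector, and let S be either the normalized identity or the projection onto the
    first basis vector. The cut observable Z = Tr (S W Q L) is the difference
    between the state of W L and a quantity controlled by shorter words: the
    normalized trace of W L is Z plus a bounded entry divided by d, and the corner
    entry of W L is Z plus the corner entry of W times that of L.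

    The cut observable is small because the Haar law is invariant under
    U |-> (1 + e P) U for projections P orthogonal to the first basis vector and
    |1 + e| = 1. Letting e tend to 0 and polarizing gives Schwinger-Dyson
    equations ([schwinger_dyson]): integrated derivatives along the matrix units
    E_ij with i, j different from the first index vanish. Applied to
    Tr (S W E_ji L) times the conjugate of Z^2 times Z and summed over i and j,
    they produce (d - 1) E |Z|^4 from the place where W meets L, precisely because
    exactly one of the two letters there is conjugated. Every other term is
    bounded, or carries the trace of a shorter alternating word; by induction on
    the length and Young's inequality, E |Z|^4 = O(d^-2) ([cut_moment],
    [trace_moment_ex], [vector_moment_ex]). The fourth moment is what makes this
    bound summable along distinct dimensions, so almost sure convergence follows
    ([asnull_moments]). *)

(** * The modulus of complex numbers as a real number *)

Section ComplexModulus.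
Variable R : realType.
Local Notation C := (Cplx R).
Implicit Types z w : C.

(** The modulus with values in R: the norm of complex numbers takes its
    values in the complex numbers themselves, which order relations and
    expectations cannot use directly. *)
Definition nrm (z : C) : R := Normc.normc z.

Lemma normE z : `|z| = (nrm z)%:C%C. Proof. by []. Qed.

Lemma nrm_ge0 z : 0 <= nrm z. Proof. by case: z => a b; exact: sqrtr_ge0. Qed.

Lemma nrm0 : nrm 0 = 0. Proof. exact: Normc.normc0. Qed.

Lemma nrm1 : nrm 1 = 1. Proof. exact: Normc.normc1. Qed.

Lemma nrmM z w : nrm (z * w) = nrm z * nrm w. Proof. exact: Normc.normcM. Qed.

Lemma nrmD z w : nrm (z + w) <= nrm z + nrm w. Proof. exact: le_normcD. Qed.

Lemma nrmN z : nrm (- z) = nrm z. Proof. exact: normcN. Qed.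

Lemma nrmB z w : nrm (z - w) <= nrm z + nrm w.
Proof. by rewrite (le_trans (nrmD _ _))// nrmN. Qed.

Lemma nrmV z : nrm z^-1 = (nrm z)^-1. Proof. exact: Normc.normcV. Qed.

Lemma nrm_eq0 z : nrm z = 0 -> z = 0. Proof. exact: Normc.eq0_normc. Qed.

Lemma nrmJ z : nrm z^* = nrm z.
Proof. by case: z => a b; rewrite /nrm /= sqrrN. Qed.

Lemma nrmX z n : nrm (z ^+ n) = nrm z ^+ n.
Proof. by elim: n => [|n IH]; rewrite ?expr0 ?nrm1// !exprS nrmM IH. Qed.

Lemma nrm_realC (x : R) : nrm x%:C%C = `|x|.
Proof. by rewrite /nrm /= expr0n /= addr0 sqrtr_sqr. Qed.

Lemma nrm_nat n : nrm n%:R = n%:R.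
Proof.
have -> : n%:R = (n%:R : R)%:C%C :> C by rewrite rmorph_nat.
by rewrite nrm_realC ger0_norm.
Qed.

Lemma nrm_sum (I : Type) (r : seq I) (P : pred I) (F : I -> C) :
  nrm (\sum_(i <- r | P i) F i) <= \sum_(i <- r | P i) nrm (F i).
Proof.
elim/big_ind2: _ => [|x1 x2 y1 y2 h1 h2|i _]; rewrite ?nrm0//.
by rewrite (le_trans (nrmD _ _))// lerD.
Qed.

Lemma ReD z w : complex.Re (z + w) = complex.Re z + complex.Re w.
Proof. by case: z w => a b [c e]. Qed.

Lemma ReN z : complex.Re (- z) = - complex.Re z.
Proof. by case: z. Qed.

Lemma ReM z w : complex.Re (z * w) =
  complex.Re z * complex.Re w - complex.Im z * complex.Im w.
Proof. by case: z w => a b [c e]. Qed.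

Lemma ImD z w : complex.Im (z + w) = complex.Im z + complex.Im w.
Proof. by case: z w => a b [c e]. Qed.

Lemma ImN z : complex.Im (- z) = - complex.Im z.
Proof. by case: z. Qed.

Lemma ImM z w : complex.Im (z * w) =
  complex.Re z * complex.Im w + complex.Im z * complex.Re w.
Proof. by case: z w => a b [c e]. Qed.

Lemma Re_sum (I : Type) (r : seq I) (P : pred I) (F : I -> C) :
  complex.Re (\sum_(i <- r | P i) F i) = \sum_(i <- r | P i) complex.Re (F i).
Proof. by elim/big_rec2: _ => // i x y _ <-; rewrite ReD. Qed.

Lemma nrm_sqr z : nrm z ^+ 2 = complex.Re z ^+ 2 + complex.Im z ^+ 2.
Proof.
by case: z => a b; rewrite /nrm /= sqr_sqrtr// addr_ge0// sqr_ge0.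
Qed.

Lemma Re_le z : `|complex.Re z| <= nrm z.
Proof.
rewrite -(@ler_pXn2r _ 2)// ?nnegrE ?normr_ge0 ?nrm_ge0//.
by rewrite nrm_sqr real_normK ?num_real// lerDl sqr_ge0.
Qed.

Lemma Im_le z : `|complex.Im z| <= nrm z.
Proof.
rewrite -(@ler_pXn2r _ 2)// ?nnegrE ?normr_ge0 ?nrm_ge0//.
by rewrite nrm_sqr real_normK ?num_real// lerDr sqr_ge0.
Qed.

Lemma mul_conjE z : z * z^* = (nrm z ^+ 2)%:C%C.
Proof.
case: z => a b; rewrite nrm_sqr /=; apply/eqP; rewrite eq_complex/=.
by apply/andP; split; apply/eqP; ring.
Qed.

End ComplexModulus.

(** * Bounds on the operator norm *)

Section OperatorBounds.
Variable R : realType.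
Local Notation C := (Cplx R).

Lemma cauchy_schwarz (I : finType) (a b : I -> R) :
  \sum_i a i * b i <=
    Num.sqrt (\sum_i a i ^+ 2) * Num.sqrt (\sum_i b i ^+ 2).
Proof.
set A := \sum_i a i ^+ 2; set B := \sum_i b i ^+ 2.
have A0 : 0 <= A by apply: sumr_ge0 => i _; exact: sqr_ge0.
have B0 : 0 <= B by apply: sumr_ge0 => i _; exact: sqr_ge0.
have [A_eq0|A_neq0] := eqVneq A 0.
  have a0 i : a i = 0.
    have /eqP := A_eq0; rewrite psumr_eq0; last by move=> j _; exact: sqr_ge0.
    by move=> /allP /(_ i (mem_index_enum i)) /=; rewrite sqrf_eq0 => /eqP.
  by rewrite big1 => [|i _]; rewrite ?a0 ?mul0r// mulr_ge0// sqrtr_ge0.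
have [B_eq0|B_neq0] := eqVneq B 0.
  have b0 i : b i = 0.
    have /eqP := B_eq0; rewrite psumr_eq0; last by move=> j _; exact: sqr_ge0.
    by move=> /allP /(_ i (mem_index_enum i)) /=; rewrite sqrf_eq0 => /eqP.
  by rewrite big1 => [|i _]; rewrite ?b0 ?mulr0// mulr_ge0// sqrtr_ge0.
have x_gt0 : 0 < Num.sqrt A by rewrite sqrtr_gt0 lt_def A_neq0.
have y_gt0 : 0 < Num.sqrt B by rewrite sqrtr_gt0 lt_def B_neq0.
set x := Num.sqrt A in x_gt0 *; set y := Num.sqrt B in y_gt0 *.
have Ax : A = x ^+ 2 by rewrite sqr_sqrtr.
have By : B = y ^+ 2 by rewrite sqr_sqrtr.
rewrite -(ler_pM2r (mulr_gt0 x_gt0 y_gt0)) mulr_suml.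
apply: (@le_trans _ _ (\sum_i 2^-1 * (y ^+ 2 * a i ^+ 2 + x ^+ 2 * b i ^+ 2))).
  apply: ler_sum => i _.
  by have := sqr_ge0 (y * a i - x * b i); lra.
rewrite -mulr_sumr big_split /= -!mulr_sumr -/A -/B Ax By.
by rewrite le_eqVlt; apply/orP; left; apply/eqP; field.
Qed.

Lemma l2norm_ge0 n (v : 'cV[C]_n) : 0 <= l2norm v.
Proof. exact: sqrtr_ge0. Qed.

Lemma l2norm_sqr n (v : 'cV[C]_n) : l2norm v ^+ 2 = \sum_i nrm (v i ord0) ^+ 2.
Proof. by rewrite sqr_sqrtr// sumr_ge0// => i _; exact: sqr_ge0. Qed.

Lemma l2normD n (v w : 'cV[C]_n) : l2norm (v + w) <= l2norm v + l2norm w.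
Proof.
rewrite -(@ler_pXn2r _ 2)// ?nnegrE ?addr_ge0 ?l2norm_ge0//.
rewrite sqrrD !l2norm_sqr.
apply: (@le_trans _ _ (\sum_i (nrm (v i ord0) + nrm (w i ord0)) ^+ 2)).
  apply: ler_sum => i _; rewrite mxE.
  by rewrite ler_pXn2r ?nnegrE ?addr_ge0 ?nrm_ge0// nrmD.
rewrite (eq_bigr (fun i => nrm (v i ord0) ^+ 2 +
    nrm (v i ord0) * nrm (w i ord0) *+ 2 + nrm (w i ord0) ^+ 2)); last first.
  by move=> i _; rewrite sqrrD.
rewrite !big_split /= lerD2r lerD2l mulr2n.
by apply: lerD; exact: cauchy_schwarz.
Qed.

Lemma l2normZ n (a : C) (v : 'cV[C]_n) : l2norm (a *: v) = nrm a * l2norm v.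
Proof.
apply/eqP; rewrite -(@eqrXn2 _ 2)// ?mulr_ge0 ?l2norm_ge0 ?nrm_ge0//.
rewrite exprMn !l2norm_sqr mulr_sumr; apply/eqP.
by apply: eq_bigr => i _; rewrite mxE nrmM exprMn.
Qed.

Lemma nrm_le_l2norm n (v : 'cV[C]_n) i : nrm (v i ord0) <= l2norm v.
Proof.
rewrite -(@ler_pXn2r _ 2)// ?nnegrE ?l2norm_ge0 ?nrm_ge0//.
rewrite l2norm_sqr (bigD1 i)//= lerDl sumr_ge0// => j _; exact: sqr_ge0.
Qed.

Lemma l2norm_delta n (i : 'I_n) : l2norm (delta_mx i ord0 : 'cV[C]_n) = 1.
Proof.
rewrite /l2norm (bigD1 i)//= big1 => [|j ji]; rewrite !mxE.
  by rewrite !eqxx -/(nrm _) nrm1 expr1n addr0 sqrtr1.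
by rewrite (negbTE ji) andFb mulr0n -/(nrm _) nrm0 expr0n.
Qed.

Lemma l2norm_eq0 n (v : 'cV[C]_n) : l2norm v = 0 -> v = 0.
Proof.
move=> v0; apply/colP => i; rewrite mxE; apply: nrm_eq0; apply/eqP.
by rewrite eq_le nrm_ge0 andbT -v0 nrm_le_l2norm.
Qed.

(** The operator bound: c is at least the operator norm of M. Stating it
    without a supremum makes it compose under sums and products of matrices
    of any shape. *)
Definition opb m n (M : 'M[C]_(m, n)) (c : R) : Prop :=
  0 <= c /\ forall v : 'cV[C]_n, l2norm (M *m v) <= c * l2norm v.

Lemma opb_ge0 m n (M : 'M[C]_(m, n)) c : opb M c -> 0 <= c.
Proof. by case. Qed.

Lemma opbW m n (M : 'M[C]_(m, n)) c c' : c <= c' -> opb M c -> opb M c'.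
Proof.
move=> cc' [c0 h]; split; first exact: le_trans cc'.
by move=> v; rewrite (le_trans (h v))// ler_wpM2r ?l2norm_ge0.
Qed.

Lemma opb_mul m n k (M : 'M[C]_(m, n)) (M' : 'M[C]_(n, k)) c c' :
  opb M c -> opb M' c' -> opb (M *m M') (c * c').
Proof.
move=> [c0 h] [c'0 h']; split; first exact: mulr_ge0.
by move=> v; rewrite -mulmxA (le_trans (h _))// -mulrA ler_wpM2l.
Qed.

Lemma opbD m n (M M' : 'M[C]_(m, n)) c c' :
  opb M c -> opb M' c' -> opb (M + M') (c + c').
Proof.
move=> [c0 h] [c'0 h']; split; first exact: addr_ge0.
by move=> v; rewrite mulmxDl (le_trans (l2normD _ _))// mulrDl lerD.
Qed.

Lemma opb0 m n : opb (0 : 'M[C]_(m, n)) 0.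
Proof.
split=> // v; rewrite mul0mx mul0r /l2norm big1 ?sqrtr0// => i _.
by rewrite mxE -/(nrm _) nrm0 expr0n.
Qed.

Lemma opbZ m n (M : 'M[C]_(m, n)) a c : opb M c -> opb (a *: M) (nrm a * c).
Proof.
move=> [c0 h]; split; first by rewrite mulr_ge0 ?nrm_ge0.
by move=> v; rewrite -scalemxAl l2normZ -mulrA ler_wpM2l ?nrm_ge0.
Qed.

Lemma opbN m n (M : 'M[C]_(m, n)) c : opb M c -> opb (- M) c.
Proof. by move=> h; have := opbZ (-1) h; rewrite scaleN1r nrmN nrm1 mul1r. Qed.

Lemma opb_sum m n (I : Type) (r : seq I) (P : pred I) (F : I -> 'M[C]_(m, n))
    (c : I -> R) : (forall i, P i -> opb (F i) (c i)) ->
  opb (\sum_(i <- r | P i) F i) (\sum_(i <- r | P i) c i).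
Proof.
move=> h; elim/big_rec2: _ => [|i x y Pi hy]; first exact: opb0.
by apply: opbD => //; exact: h.
Qed.

Lemma opb1 n : opb (1%:M : 'M[C]_n) 1.
Proof. by split=> // v; rewrite mul1mx mul1r. Qed.

Lemma opb_scalar n (a : C) : opb (a%:M : 'M[C]_n) (nrm a).
Proof. by rewrite -scalemx1 -[nrm a]mulr1; apply: opbZ; exact: opb1. Qed.

Lemma opb_entry m n (M : 'M[C]_(m, n)) c i j : opb M c -> nrm (M i j) <= c.
Proof.
move=> [c0 h]; have := h (delta_mx j ord0); rewrite l2norm_delta mulr1.
apply: le_trans; rewrite -colE.
by have := nrm_le_l2norm (col j M) i; rewrite mxE.
Qed.

Lemma opb_delta m n (i : 'I_m) (j : 'I_n) : opb (delta_mx i j : 'M[C]_(m, n)) 1.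
Proof.
split=> // v; rewrite mul1r.
suff -> : delta_mx i j *m v = v j ord0 *: delta_mx i ord0.
  by rewrite l2normZ l2norm_delta mulr1 nrm_le_l2norm.
apply/colP => k; rewrite !mxE (bigD1 j)//= big1 => [|l lj]; rewrite !mxE.
  by rewrite !eqxx !andbT addr0 mulrC.
by rewrite (negbTE lj) andbF mulr0n mul0r.
Qed.

(** The operator norm of any matrix is finite, which is what allows a bound
    on the supremum defining it to be used pointwise. *)
Lemma opb_entries m n (M : 'M[C]_(m, n)) :
  opb M (\sum_i \sum_j nrm (M i j)).
Proof.
rewrite {1}[M]matrix_sum_delta; apply: opb_sum => i _; apply: opb_sum => j _.
by rewrite -[nrm _]mulr1; apply: opbZ; exact: opb_delta.
Qed.

(** The supremum bounds unit vectors only after it is known to be a supremum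
    of a bounded set; homogeneity then gives all vectors. *)
Lemma opnorm_opb n (M : 'M[C]_n) c : opnorm M <= c -> opb M c.
Proof.
have [_ hK] := opb_entries M; set K := \sum_i _ in hK => Mc.
have ub v : l2norm v <= 1 -> l2norm (M *m v) <= opnorm M.
  move=> v1; apply: ub_le_sup; last by exists v.
  exists K => _ [w /= w1 <-]; rewrite (le_trans (hK w))//.
  rewrite -[leRHS]mulr1 ler_wpM2l// /K.
  by apply: sumr_ge0 => i _; apply: sumr_ge0 => j _; exact: nrm_ge0.
have op0 : 0 <= opnorm M.
  apply: le_trans (ub 0 _); first exact: l2norm_ge0.
  by rewrite -(scale0r 0) l2normZ nrm0 mul0r.
split; first exact: le_trans Mc.
move=> v; have [v0|v_neq0] := eqVneq (l2norm v) 0.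
  by rewrite (l2norm_eq0 v0) mulmx0 -(scale0r 0) l2normZ nrm0 mul0r mulr0.
have v_gt0 : 0 < l2norm v by rewrite lt_def v_neq0 l2norm_ge0.
have := ub ((l2norm v)^-1%:C%C *: v).
rewrite -scalemxAr !l2normZ nrm_realC gtr0_norm ?invr_gt0// mulVf//.
move=> /(_ (lexx _)); rewrite mulrC ler_pdivrMr// => h.
by rewrite (le_trans h)// ler_wpM2r ?l2norm_ge0.
Qed.

Lemma l2norm_dot n (v : 'cV[C]_n) :
  (v^t* *m v) ord0 ord0 = (l2norm v ^+ 2)%:C%C.
Proof.
rewrite l2norm_sqr rmorph_sum mxE; apply: eq_bigr => i _.
by rewrite !mxE mulrC mul_conjE.
Qed.

Lemma nrm_dot_le n (u v : 'cV[C]_n) :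
  nrm ((u^t* *m v) ord0 ord0) <= l2norm u * l2norm v.
Proof.
rewrite mxE; apply: (le_trans (nrm_sum _ _ _)).
rewrite (eq_bigr (fun i => nrm (u i ord0) * nrm (v i ord0))); last first.
  by move=> i _; rewrite !mxE nrmM nrmJ.
exact: cauchy_schwarz.
Qed.

(** Cauchy-Schwarz applied to the inner product of v with M M* v. *)
Lemma opb_adj m n (M : 'M[C]_(m, n)) c : opb M c -> opb (M^t*) c.
Proof.
move=> [c0 h]; split=> // v; set w := _ *m v.
have [->|w0] := eqVneq (l2norm w) 0; first by rewrite mulr_ge0// l2norm_ge0.
have w_gt0 : 0 < l2norm w by rewrite lt_def w0 l2norm_ge0.
rewrite -(ler_pM2r w_gt0) -expr2.
have -> : l2norm w ^+ 2 = nrm ((v^t* *m (M *m w)) ord0 ord0).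
  have -> : v^t* *m (M *m w) = w^t* *m w.
    by rewrite /w trmx_mul map_mxM /= trmxCK !mulmxA.
  by rewrite l2norm_dot nrm_realC ger0_norm// sqr_ge0.
apply: (le_trans (nrm_dot_le _ _)); rewrite [leLHS]mulrC mulrAC.
by rewrite ler_wpM2r ?l2norm_ge0.
Qed.

Lemma opb_isometry m n (U : 'M[C]_(m, n)) : U^t* *m U = 1%:M -> opb U 1.
Proof.
move=> UU; split=> // v; rewrite mul1r.
rewrite -(@ler_pXn2r _ 2)// ?nnegrE ?l2norm_ge0// -lecR -!l2norm_dot.
by rewrite trmx_mul map_mxM /= mulmxA -(mulmxA _ _ U) UU mulmx1.
Qed.

Lemma opb_unitary n (U : 'M[C]_n) : U \is unitarymx -> opb U 1 /\ opb (U^t*) 1.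
Proof.
move=> /unitarymxP UU; split; apply: opb_isometry.
  by apply: mulmx1C; exact: UU.
by rewrite trmxCK.
Qed.

End OperatorBounds.

(** * Bounded random variables and Borel maps of matrices *)

Section BoundedRandomVariables.
Context {R : realType} {dsp : measure_display} {T : measurableType dsp}.
Variable Pr : probability T R.

(** A bounded random variable; boundedness makes every integrability
    condition automatic under a probability. *)
Definition brv (X : T -> R) : Prop :=
  measurable_fun setT X /\ exists K : R, forall w, `|X w| <= K.

Definition Ex (X : T -> R) : R := \int[Pr]_w X w.

Lemma brv_integrable X : brv X -> Pr.-integrable setT (EFin \o X).
Proof.
move=> [mX [K hK]]; apply: measurable_bounded_integrable => //.
  exact: le_lt_trans (probability_le1 Pr measurableT) (ltry _).
exists K; split; first exact: num_real.
by move=> x Kx w _; apply: le_trans (hK w) _; exact: ltW.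
Qed.

Lemma brv_cst (a : R) : brv (fun=> a).
Proof. by split; [exact: measurable_cst|exists `|a|]. Qed.

Lemma brvD X Y : brv X -> brv Y -> brv (fun w => X w + Y w).
Proof.
move=> [mX [K hK]] [mY [L hL]]; split; first exact: measurable_funD.
by exists (K + L) => w; rewrite (le_trans (ler_normD _ _))// lerD.
Qed.

Lemma brvM X Y : brv X -> brv Y -> brv (fun w => X w * Y w).
Proof.
move=> [mX [K hK]] [mY [L hL]]; split; first exact: measurable_funM.
by exists (K * L) => w; rewrite normrM ler_pM.
Qed.

Lemma brvN X : brv X -> brv (fun w => - X w).
Proof.
move=> [mX [K hK]]; split; first exact: measurable_funN.
by exists K => w; rewrite normrN.
Qed.

Lemma brv_sum (I : Type) (r : seq I) (P : pred I) (X : I -> T -> R) :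
  (forall i, brv (X i)) -> brv (fun w => \sum_(i <- r | P i) X i w).
Proof.
move=> hX; elim: r => [|i r IH].
  by under eq_fun do rewrite big_nil; exact: brv_cst.
under eq_fun do rewrite big_cons.
by case: (P i) => //; apply: brvD.
Qed.

Lemma ExD X Y : brv X -> brv Y -> Ex (fun w => X w + Y w) = Ex X + Ex Y.
Proof. by move=> hX hY; rewrite /Ex RintegralD//; exact: brv_integrable. Qed.

Lemma ExZ a X : brv X -> Ex (fun w => a * X w) = a * Ex X.
Proof. by move=> hX; rewrite /Ex RintegralZl//; exact: brv_integrable. Qed.

Lemma Ex_cst a : Ex (fun=> a) = a.
Proof.
rewrite /Ex Rintegral_cst// -[RHS]mulr1; congr (_ * _).
exact: (congr1 fine (probability_setT Pr)).
Qed.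

Lemma Ex_le X Y : brv X -> brv Y -> (forall w, X w <= Y w) -> Ex X <= Ex Y.
Proof. by move=> hX hY XY; apply: le_Rintegral => //; exact: brv_integrable. Qed.

Lemma Ex_sum (I : Type) (r : seq I) (P : pred I) (X : I -> T -> R) :
  (forall i, brv (X i)) ->
  Ex (fun w => \sum_(i <- r | P i) X i w) = \sum_(i <- r | P i) Ex (X i).
Proof.
move=> hX; elim: r => [|i r IH].
  by rewrite big_nil -{2}(Ex_cst 0); congr Ex; apply/funext => w; rewrite big_nil.
rewrite big_cons -IH; case Pi: (P i).
  by rewrite -ExD//; [congr Ex; apply/funext => w; rewrite big_cons Pi|exact: brv_sum].
by congr Ex; apply/funext => w; rewrite big_cons Pi.
Qed.

Lemma Ex_ge0 X : (forall w, 0 <= X w) -> 0 <= Ex X.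
Proof. by move=> X0; apply: Rintegral_ge0. Qed.

End BoundedRandomVariables.

Section MatrixBorel.
Variables (R : realType) (d : nat).
Local Notation C := (Cplx R).
Local Notation MU := (g_sigma_algebraType (@open 'M[C]_d)).

Lemma continuous_Re : continuous (fun z : C => complex.Re z).
Proof.
move=> z A /nbhs_ballP[e /= e0 sA].
have e0' : 0 < e%:C%C :> C by rewrite ltcR.
apply/nbhs_ballP; exists e%:C%C => //= y zy.
have {}zy : `|z - y| < e%:C%C := zy.
move: zy; rewrite normE ltcR => zy.
apply: sA; rewrite -ball_normE /=.
by rewrite -ReN -ReD; exact: le_lt_trans (Re_le _) zy.
Qed.

Lemma continuous_Im : continuous (fun z : C => complex.Im z).
Proof.
move=> z A /nbhs_ballP[e /= e0 sA].
have e0' : 0 < e%:C%C :> C by rewrite ltcR.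
apply/nbhs_ballP; exists e%:C%C => //= y zy.
have {}zy : `|z - y| < e%:C%C := zy.
move: zy; rewrite normE ltcR => zy.
apply: sA; rewrite -ball_normE /=.
by rewrite -ImN -ImD; exact: le_lt_trans (Im_le _) zy.
Qed.

Lemma continuous_borel (h : 'M[C]_d -> R) : continuous h ->
  measurable_fun setT (h : MU -> R).
Proof.
move=> ch; apply: (measurability _ (RGenOpens.measurableE R)).
move=> _ [_ [a [b ->] <-]]; rewrite setTI; apply: sub_sigma_algebra.
have /continuousP ch' := ch.
apply: ch'; exact: interval_open.
Qed.

(** Convergence of matrices is entrywise, and the entries of V M are finite
    sums of multiples of those of M. *)
Lemma continuous_mulmxl (V : 'M[C]_d) : continuous (mulmx V : 'M[C]_d -> 'M[C]_d).
Proof.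
move=> M A [P PM sPA].
have FM : Filter (nbhs M) by exact: nbhs_filter.
have : \forall N \near M, forall i j, P i j ((V *m N) i j).
  apply: (@filter_forall 'M[C]_d 'I_d
    (fun i N => forall j, P i j ((V *m N) i j)) (nbhs M) FM) => i.
  apply: (@filter_forall 'M[C]_d 'I_d
    (fun j N => P i j ((V *m N) i j)) (nbhs M) FM) => j.
  suff : (fun N : 'M[C]_d => (V *m N) i j) N @[N --> M] --> (V *m M) i j.
    by apply; exact: PM.
  rewrite mxE; under eq_fun do rewrite mxE.
  by apply: (@cvg_big C 'I_d +%R 0 xpredT (@add_continuous C) _ (nbhs M)) => //= k _; apply: cvgMl_tmp; exact: coord_continuous.
by apply: filterS => N h; exact: sPA.
Qed.

Lemma measurable_mulmxl (V : 'M[C]_d) :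
  measurable_fun setT (mulmx V : MU -> MU).
Proof.
apply: (@measurability _ _ MU MU _ _ (@open 'M[C]_d)) => //.
move=> _ [A openA <-]; rewrite setTI; apply: sub_sigma_algebra.
by move/continuousP: (@continuous_mulmxl V); apply.
Qed.

End MatrixBorel.

(** * Invariance of the Haar law *)

Section HaarInvariance.
Context {R : realType} {d : nat} {dsp : measure_display} {T : measurableType dsp}.
Variables (Pr : probability T R) (U : T -> 'M[Cplx R]_d).
Local Notation C := (Cplx R).
Local Notation MU := (g_sigma_algebraType (@open 'M[C]_d)).
Local Notation G := (@unitary_fix_eps1 R d).

Lemma Ex_pushforward (X : T -> MU) (h : MU -> R) (K : R) :
  measurable_fun setT X -> measurable_fun setT h ->
  (forall w, `|h (X w)| <= K) ->
  (Ex Pr (fun w => h (X w)))%:E = (\int[pushforward Pr X]_M (h M)%:E)%E.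
Proof.
move=> mX mh hK.
have bX : brv (fun w => h (X w)).
  by split; [exact: measurableT_comp|exists K].
rewrite (integral_pushforward mX)//; last 2 first.
- exact/measurable_EFinP.
- exact: (brv_integrable Pr bX).
rewrite preimage_setT /Ex /Rintegral fineK//.
apply: integrable_fin_num => //.
exact: (brv_integrable Pr bX).
Qed.

(** Invariance of the Haar law is an equality of measures of Borel sets;
    integrals of bounded functions follow by transport to the space of
    matrices. *)
Lemma Ex_eq_law (X Y : T -> MU) (h : MU -> R) (K : R) :
  measurable_fun setT X -> measurable_fun setT Y ->
  (forall A, measurable A -> Pr (X @^-1` A) = Pr (Y @^-1` A)) ->
  measurable_fun setT h ->
  (forall w, `|h (X w)| <= K) -> (forall w, `|h (Y w)| <= K) ->
  Ex Pr (fun w => h (X w)) = Ex Pr (fun w => h (Y w)).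
Proof.
move=> mX mY XY mh hX hY.
apply: EFin_inj; rewrite (Ex_pushforward mX mh hX) (Ex_pushforward mY mh hY).
apply: (eq_measure_integral
  (measure_function_pushforward__canonical__measure_function_Measure Pr mY)
  (m1 := measure_function_pushforward__canonical__measure_function_Measure Pr mX)).
by move=> A mA _; exact: XY.
Qed.

Hypothesis U_haar : haar_distributed Pr G U.

Lemma haar_in w : G (U w). Proof. by case: U_haar. Qed.

Lemma haar_measurable : measurable_fun setT (U : T -> MU).
Proof. by case: U_haar => _ mU _ _ A mA; rewrite setTI; exact: mU. Qed.

Lemma fix_eps1_mul V W : G V -> G W -> G (V *m W).
Proof.
move=> [Vu Ve] [Wu We]; split; first exact: mul_unitarymx.
by rewrite -mulmxA We Ve.
Qed.

Lemma Ex_haar_mul V (h : 'M[C]_d -> R) (K : R) : G V ->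
  measurable_fun setT (h : MU -> R) -> (forall M, G M -> `|h M| <= K) ->
  Ex Pr (fun w => h (V *m U w)) = Ex Pr (fun w => h (U w)).
Proof.
move=> GV mh hK; case: (U_haar) => _ _ inv.
apply: (@Ex_eq_law (fun w => V *m U w) U h K) => //.
- exact: measurableT_comp (measurable_mulmxl V) haar_measurable.
- exact: haar_measurable.
- by move=> A mA; exact: inv.
- by move=> w; apply: hK; apply: fix_eps1_mul => //; exact: haar_in.
- by move=> w; apply: hK; exact: haar_in.
Qed.

(** The test functions to which the invariance of the law applies: Borel,
    and bounded on the group only, since polynomials in the entries are
    unbounded on all matrices. *)
Definition regular (f : 'M[C]_d -> C) : Prop :=
  [/\ measurable_fun setT (fun M : MU => complex.Re (f M)),
      measurable_fun setT (fun M : MU => complex.Im (f M)) &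
      exists K : R, forall M, G M -> nrm (f M) <= K].

Lemma regular_cst a : regular (fun=> a).
Proof. by split; [exact: measurable_cst..|exists (nrm a)]. Qed.

Lemma regularD f g : regular f -> regular g -> regular (fun M => f M + g M).
Proof.
move=> [fR fI [K hK]] [gR gI [L hL]]; split.
- by under eq_fun do rewrite ReD; exact: measurable_funD.
- by under eq_fun do rewrite ImD; exact: measurable_funD.
- by exists (K + L) => M GM; rewrite (le_trans (nrmD _ _))// lerD ?hK ?hL.
Qed.

Lemma regularM f g : regular f -> regular g -> regular (fun M => f M * g M).
Proof.
move=> [fR fI [K hK]] [gR gI [L hL]]; split.
- under eq_fun do rewrite ReM.
  by apply: measurable_funB; exact: measurable_funM.
- under eq_fun do rewrite ImM.
  by apply: measurable_funD; exact: measurable_funM.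
- by exists (K * L) => M GM; rewrite nrmM ler_pM ?nrm_ge0 ?hK ?hL.
Qed.

Lemma regularN f : regular f -> regular (fun M => - f M).
Proof.
move=> hf; have := regularM (regular_cst (-1)) hf.
by under eq_fun do rewrite mulN1r.
Qed.

Lemma regularJ f : regular f -> regular (fun M => (f M)^*).
Proof.
move=> [fR fI [K hK]]; split.
- rewrite (_ : (fun _ => _) = fun M => complex.Re (f M))//.
  by apply/funext => M; case: (f M).
- rewrite (_ : (fun _ => _) = \- (fun M => complex.Im (f M))).
    exact: measurable_funN.
  by apply/funext => M /=; case: (f M).
- by exists K => M GM; rewrite nrmJ hK.
Qed.

Lemma regular_sum (I : Type) (r : seq I) (F : I -> 'M[C]_d -> C) :
  (forall i, regular (F i)) -> regular (fun M => \sum_(i <- r) F i M).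
Proof.
move=> hF; elim: r => [|i r IH].
  by under eq_fun do rewrite big_nil; exact: regular_cst.
by under eq_fun do rewrite big_cons; exact: regularD.
Qed.

Lemma regular_entry i j : regular (fun M => M i j).
Proof.
split.
- apply: continuous_borel => M.
  apply: (@continuous_comp _ _ _ (fun M : 'M[C]_d => M i j) (fun z : C => complex.Re z)).
    exact: coord_continuous.
  exact: continuous_Re.
- apply: continuous_borel => M.
  apply: (@continuous_comp _ _ _ (fun M : 'M[C]_d => M i j) (fun z : C => complex.Im z)).
    exact: coord_continuous.
  exact: continuous_Im.
- by exists 1 => M [/opb_unitary[/opb_entry h _] _].
Qed.

Lemma regular_brv f : regular f -> brv (fun w => complex.Re (f (U w))).
Proof.
move=> [fR _ [K hK]]; split; last first.
  by exists K => w; rewrite (le_trans (Re_le _))// hK//; exact: haar_in.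
exact: (measurableT_comp fR haar_measurable).
Qed.

Lemma regular_brv_sqr f : regular f -> brv (fun w => nrm (f (U w)) ^+ 2).
Proof.
move=> hf; have := regular_brv (regularM hf (regularJ hf)).
by under eq_fun do rewrite mul_conjE /=.
Qed.

Lemma regular_brv_pow4 f : regular f -> brv (fun w => nrm (f (U w)) ^+ 4).
Proof.
move=> hf; have h2 := regular_brv_sqr hf; have := brvM h2 h2.
by under eq_fun do rewrite -exprD.
Qed.

End HaarInvariance.

(** * Derivations along the stabilizer of the first basis vector *)

Section HaarDerivations.
Context {R : realType} {d : nat} {dsp : measure_display} {T : measurableType dsp}.
Variables (Pr : probability T R) (U : T -> 'M[Cplx R]_d).
Local Notation C := (Cplx R).
Local Notation G := (@unitary_fix_eps1 R d).
Local Notation MU := (g_sigma_algebraType (@open 'M[C]_d)).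
Implicit Types (f g : 'M[C]_d -> C) (fd gd : 'M[C]_d -> 'M[C]_d -> C).
Implicit Types (F K : 'M[C]_d -> 'M[C]_d) (Fd Kd : 'M[C]_d -> 'M[C]_d -> 'M[C]_d).

(** The orthogonal projections whose range is orthogonal to the first basis
    vector. *)
Definition proj_perp (P : 'M[C]_d) : Prop :=
  [/\ P^t* = P, P *m P = P & P *m eps1 R d = 0].

(** As P is a projection, 1 + e P multiplies its range by the phase 1 + e
    and fixes the orthogonal complement, which contains the first basis
    vector. These rotations are the algebraic form of the one-parameter
    group exp(i t P). *)
Lemma rotation_fix_eps1 (P : 'M[C]_d) (e : C) :
  proj_perp P -> nrm (1 + e) = 1 -> G (1%:M + e *: P).
Proof.
move=> [Ph PP Pe] e1; split; last by rewrite mulmxDl mul1mx -scalemxAl Pe scaler0 addr0.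
apply/unitarymxP; rewrite linearD /= map_mxD linearZ /= map_mxZ Ph.
rewrite trmx1 map_mx1 mulmxDl !mulmxDr !mul1mx mulmx1 -scalemxAl -scalemxAr PP.
rewrite -[RHS]addr0 -addrA; congr (_ + _); rewrite addrA scalerA -!scalerDl.
suff -> : e^* + e + e * e^* = 0 by rewrite scale0r.
have := mul_conjE (1 + e); rewrite e1 expr1n rmorphD rmorph1 /= => h.
apply: (addrI 1); rewrite addr0; rewrite -[RHS]h; ring.
Qed.

Lemma regular_mul V f : G V -> regular f -> regular (fun M => f (V *m M)).
Proof.
move=> GV [fR fI [K hK]]; split.
- exact: (measurableT_comp fR (measurable_mulmxl V)).
- exact: (measurableT_comp fI (measurable_mulmxl V)).
- by exists K => M GM; apply: hK; exact: fix_eps1_mul.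
Qed.

(** The function f has fd H as its derivative at M along the left
    translation by H, to first order with a remainder that is quadratic
    uniformly over the group. Linearity in H over the complex numbers is
    what later allows directions outside the Lie algebra of the group, such
    as matrix units. *)
Record Der f fd : Prop := MkDer {
  der_regular : regular f;
  der_regular' : forall H, regular (fd H);
  der_lin : forall M a H H', fd (a *: H + H') M = a * fd H M + fd H' M;
  der_exp : forall P, proj_perp P -> exists K : R, forall M, G M ->
    forall e, nrm (1 + e) = 1 ->
      nrm (f ((1%:M + e *: P) *m M) - f M - e * fd P M) <= K * nrm e ^+ 2
}.

Lemma Der_ext f fd g gd : Der f fd ->
  (forall M, f M = g M) -> (forall H M, fd H M = gd H M) -> Der g gd.
Proof.
move=> h fg fg'.
have <- : f = g by apply/funext.
by have <- : fd = gd by apply/funext => H; apply/funext => M.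
Qed.

Lemma Der_cst a : Der (fun=> a) (fun _ _ => 0).
Proof.
split; [exact: regular_cst|by move=> H; exact: regular_cst| |].
  by move=> M b H H'; rewrite mulr0 addr0.
by move=> P hP; exists 0 => M GM e he; rewrite mulr0 subrr subr0 nrm0 mul0r.
Qed.

Lemma DerD f fd g gd : Der f fd -> Der g gd ->
  Der (fun M => f M + g M) (fun H M => fd H M + gd H M).
Proof.
move=> [fg fg' fl fe] [gg gg' gl ge]; split.
- exact: regularD.
- by move=> H; exact: regularD.
- by move=> M a H H'; rewrite fl gl; ring.
- move=> P hP; have [K hK] := fe P hP; have [L hL] := ge P hP.
  exists (K + L) => M GM e he; rewrite mulrDl.
  apply: le_trans (lerD (hK M GM e he) (hL M GM e he)).
  by apply: le_trans (nrmD _ _); rewrite le_eqVlt; apply/orP; left; apply/eqP; congr nrm; ring.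
Qed.

Lemma nrm_rot_le2 (e : C) : nrm (1 + e) = 1 -> nrm e <= 2.
Proof.
move=> h; have -> : e = (1 + e) - 1 by rewrite addrC addKr.
by rewrite (le_trans (nrmB _ _))// h nrm1.
Qed.

Lemma DerM f fd g gd : Der f fd -> Der g gd ->
  Der (fun M => f M * g M) (fun H M => fd H M * g M + f M * gd H M).
Proof.
move=> [fg fg' fl fe] [gg gg' gl ge]; split.
- exact: regularM.
- by move=> H; apply: regularD; exact: regularM.
- by move=> M a H H'; rewrite fl gl; ring.
- move=> P hP; have [K hK] := fe P hP; have [L hL] := ge P hP.
  have [_ _ [kf hf]] := fg; have [_ _ [kg hg]] := gg.
  have [_ _ [kf' hf']] := fg' P; have [_ _ [kg' hg']] := gg' P.
  exists (K * kg + (kf' * kg' + (kf + 2 * kf') * L)) => M GM e he.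
  set V := 1%:M + e *: P.
  have GVM : G (V *m M) by apply: fix_eps1_mul => //; exact: rotation_fix_eps1.
  have -> : f (V *m M) * g (V *m M) - f M * g M -
      e * (fd P M * g M + f M * gd P M) =
    (f (V *m M) - f M - e * fd P M) * g (V *m M) +
    (e ^+ 2 * (fd P M * gd P M) +
    (f M + e * fd P M) * (g (V *m M) - g M - e * gd P M)) by ring.
  have nrm2 : 0 <= nrm e ^+ 2 by exact: sqr_ge0.
  apply: (le_trans (nrmD _ _)); rewrite nrmM [leRHS]mulrDl; apply: lerD.
    by rewrite mulrAC ler_pM ?nrm_ge0 ?hK ?hg.
  apply: (le_trans (nrmD _ _)); rewrite nrmM nrmX [leRHS]mulrDl; apply: lerD.
    by rewrite mulrC nrmM ler_wpM2r// ler_pM ?nrm_ge0 ?hf' ?hg'.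
  rewrite nrmM -mulrA ler_pM ?nrm_ge0 ?hL//.
  apply: (le_trans (nrmD _ _)); rewrite nrmM lerD ?hf//.
  by rewrite ler_pM ?nrm_ge0 ?nrm_rot_le2 ?hf'.
Qed.

(** The rotation parameter satisfies e + conj e = - |e|^2, so conj e equals
    - e to first order: conjugation turns the derivative along H into minus
    the conjugate of the derivative along the adjoint of H. For self-adjoint
    H this is the plain statement; the adjoint makes the formula linear in
    H. *)
Lemma DerJ f fd : Der f fd ->
  Der (fun M => (f M)^*) (fun H M => - (fd (H^t*) M)^*).
Proof.
move=> [fg fg' fl fe]; split.
- exact: regularJ.
- by move=> H; apply: regularN; exact: regularJ.
- move=> M a H H'; rewrite linearD linearZ /= map_mxD map_mxZ fl.
  by rewrite rmorphD rmorphM /= conjCK; ring.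
- move=> P hP; have [K hK] := fe P hP; have [_ _ [kf' hf']] := fg' P.
  exists (K + kf') => M GM e he; have [Ph _ _] := hP; rewrite Ph.
  set V := 1%:M + e *: P.
  have ee : e + e^* = - (e * e^*).
    have := mul_conjE (1 + e); rewrite he expr1n rmorphD rmorph1 /= => h.
    apply/eqP; rewrite -subr_eq0 opprK; apply/eqP.
    by apply: (addrI 1); rewrite addr0 -[RHS]h; ring.
  have -> : (f (V *m M))^* - (f M)^* - e * - (fd P M)^* =
      (f (V *m M) - f M - e * fd P M)^* + (e + e^*) * (fd P M)^*.
    by rewrite !rmorphB rmorphM /=; ring.
  apply: (le_trans (nrmD _ _)); rewrite nrmJ [leRHS]mulrDl lerD ?hK//.
  by rewrite ee nrmM nrmN nrmM !nrmJ mulrC ler_wpM2r ?hf'// mulr_ge0// nrm_ge0.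
Qed.

Lemma Der_sum (I : Type) (r : seq I) (f : I -> 'M[C]_d -> C)
    (fd : I -> 'M[C]_d -> 'M[C]_d -> C) :
  (forall i, Der (f i) (fd i)) ->
  Der (fun M => \sum_(i <- r) f i M) (fun H M => \sum_(i <- r) fd i H M).
Proof.
move=> hf; elim: r => [|i r IH].
  by apply: Der_ext (Der_cst 0) _ _ => *; rewrite big_nil.
by apply: Der_ext (DerD (hf i) IH) _ _ => *; rewrite big_cons.
Qed.

Lemma Der_entry i j : Der (fun M => M i j) (fun H M => (H *m M) i j).
Proof.
split.
- exact: regular_entry.
- move=> H; under eq_fun do rewrite mxE.
  by apply: regular_sum => k; apply: regularM; [exact: regular_cst|exact: regular_entry].
- by move=> M a H H'; rewrite mulmxDl -scalemxAl !mxE.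
- move=> P hP; exists 0 => M GM e he.
  have -> : ((1%:M + e *: P) *m M) i j = M i j + e * (P *m M) i j.
    by rewrite mulmxDl mul1mx -scalemxAl [LHS]mxE; congr (_ + _); rewrite [LHS]mxE.
  by rewrite (addrC (M i j)) addrK subrr nrm0 mul0r.
Qed.

Definition MDer F Fd : Prop :=
  forall i j, Der (fun M => F M i j) (fun H M => Fd H M i j).

Lemma MDer_ext F Fd K Kd : MDer F Fd ->
  (forall M, F M = K M) -> (forall H M, Fd H M = Kd H M) -> MDer K Kd.
Proof.
by move=> h FK FK' i j; apply: Der_ext (h i j) _ _ => *; rewrite ?FK ?FK'.
Qed.

Lemma MDer_cst A : MDer (fun=> A) (fun _ _ => 0).
Proof.
by move=> i j; apply: Der_ext (Der_cst (A i j)) _ _ => // *; rewrite mxE.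
Qed.

Lemma MDerM F Fd K Kd : MDer F Fd -> MDer K Kd ->
  MDer (fun M => F M *m K M) (fun H M => Fd H M *m K M + F M *m Kd H M).
Proof.
move=> hF hK i j.
apply: Der_ext (Der_sum (index_enum _) (fun k => DerM (hF i k) (hK k j))) _ _.
  by move=> M; rewrite mxE.
by move=> H M; rewrite !mxE -big_split.
Qed.

Lemma MDer_id : MDer id (fun H M => H *m M).
Proof. by move=> i j; exact: Der_entry. Qed.

Lemma MDerJ F Fd : MDer F Fd ->
  MDer (fun M => (F M)^t*) (fun H M => - (Fd (H^t*) M)^t*).
Proof.
by move=> hF i j; apply: Der_ext (DerJ (hF j i)) _ _ => *; rewrite !mxE.
Qed.

Lemma Der_tr F Fd : MDer F Fd ->
  Der (fun M => \tr (F M)) (fun H M => \tr (Fd H M)).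
Proof. by move=> hF; apply: Der_sum => i; exact: hF. Qed.

Hypothesis U_haar : haar_distributed Pr G U.

(** The point 1 + e is the rational parametrization (1 + i t)^2 / (1 + t^2)
    of the unit circle. *)
Lemma rotation_small (t : R) : 0 < t ->
  exists e : C, [/\ nrm (1 + e) = 1, e != 0 & nrm e <= 2 * t].
Proof.
move=> t0; have s0 : 0 < 1 + t ^+ 2 by rewrite ltr_wpDr ?sqr_ge0.
have sN0 : 1 + t ^+ 2 != 0 by rewrite gt_eqF.
exists (Complex (- 2 * t ^+ 2 / (1 + t ^+ 2)) (2 * t / (1 + t ^+ 2))); split.
- apply/eqP; rewrite -(@eqrXn2 _ 2)// ?nrm_ge0// nrm_sqr expr1n /=.
  by apply/eqP; field.
- apply/eqP => /(congr1 (fun z => complex.Im z)) /= /eqP.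
  by rewrite mulf_eq0 invr_eq0 (negbTE sN0) orbF mulf_eq0 pnatr_eq0 /= gt_eqF.
- rewrite -(@ler_pXn2r _ 2)// ?nnegrE ?nrm_ge0 ?mulr_ge0 ?(ltW t0)// nrm_sqr /=.
  have -> : (- 2 * t ^+ 2 / (1 + t ^+ 2)) ^+ 2 + (2 * t / (1 + t ^+ 2)) ^+ 2 =
    4 * t ^+ 2 / (1 + t ^+ 2) by field.
  rewrite ler_pdivrMr//.
  have -> : (2 * t) ^+ 2 * (1 + t ^+ 2) = 4 * t ^+ 2 + 4 * (t ^+ 2) ^+ 2 by ring.
  by rewrite lerDl mulr_ge0 ?sqr_ge0.
Qed.

(** Invariance makes the expectation of f(V U) - f(U) vanish for each
    rotation V = 1 + e P, so the expected derivative is bounded by a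
    constant times |e|; letting e tend to 0 leaves 0. The multiplier a
    collects the real and imaginary parts. *)
Lemma Ex_der_proj f fd P a : Der f fd -> proj_perp P ->
  Ex Pr (fun w => complex.Re (a * fd P (U w))) = 0.
Proof.
move=> hf hP; have [K0 hK0] := der_exp hf hP.
set x := Ex _ _.
pose K := `|K0|.
have key (e : C) : nrm (1 + e) = 1 -> e != 0 -> `|x| <= nrm a * K * nrm e.
  move=> he e0; set V := 1%:M + e *: P.
  have GV : G V by exact: rotation_fix_eps1.
  pose b := a / e.
  have gb : regular (fun M => b * f M) by apply: regularM (regular_cst b) _; exact: der_regular hf.
  have gbV : regular (fun M => b * f (V *m M)) by exact: (regular_mul GV gb).
  have ga : regular (fun M => a * fd P M).
    by apply: regularM (regular_cst a) _; exact: der_regular' hf P.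
  have inv : Ex Pr (fun w => complex.Re (b * f (V *m U w))) =
      Ex Pr (fun w => complex.Re (b * f (U w))).
    have [mR _ [L hL]] := gb.
    apply: (Ex_haar_mul U_haar GV (h := fun M => complex.Re (b * f M)) mR (K := L)).
    by move=> M GM; rewrite (le_trans (Re_le _))// hL.
  have bV := regular_brv U_haar gbV; have bb := regular_brv U_haar gb.
  have ba := regular_brv U_haar ga.
  have -> : x = - Ex Pr (fun w => complex.Re (b * f (V *m U w)) +
      (- complex.Re (b * f (U w)) + - complex.Re (a * fd P (U w)))).
    rewrite ExD ?inv//; last by apply: brvD; exact: brvN.
    rewrite ExD; [|exact: brvN..].
    (* The difference quotient with the first-order term removed has
       expectation - x by invariance, and is bounded by a constant times |e|. *)
    have exN X : brv X -> Ex Pr (fun w => - X w) = - Ex Pr X.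
      move=> hX; rewrite -mulN1r -ExZ//; congr Ex.
      by apply/funext => w; rewrite mulN1r.
    by rewrite !exN// addNKr opprK.
  rewrite normrN /Ex; apply: le_trans (le_normr_Rintegral _ _) _ => //.
    apply: (@brv_integrable _ _ _ Pr).
    by apply: brvD => //; apply: brvD; exact: brvN.
  rewrite -[leRHS](Ex_cst Pr); apply: Ex_le.
  - have [m [L hL]] : brv (fun w => complex.Re (b * f (V *m U w)) +
      (- complex.Re (b * f (U w)) + - complex.Re (a * fd P (U w)))).
      by apply: brvD => //; apply: brvD; exact: brvN.
    split; last by exists L => w; rewrite normr_id.
    exact: measurableT_comp (@normr_measurable R setT) m.
  - exact: brv_cst.
  - move=> w; have -> : complex.Re (b * f (V *m U w)) +
      (- complex.Re (b * f (U w)) + - complex.Re (a * fd P (U w))) =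
      complex.Re (b * (f (V *m U w) - f (U w) - e * fd P (U w))).
      rewrite -!ReN -!ReD; congr complex.Re; rewrite /b; field.
      exact: e0.
    apply: (le_trans (Re_le _)); rewrite nrmM.
    apply: (@le_trans _ _ (nrm b * (K * nrm e ^+ 2))).
      rewrite ler_wpM2l ?nrm_ge0//.
      apply: le_trans (hK0 _ (haar_in U_haar w) _ he) _.
      by rewrite ler_wpM2r ?sqr_ge0// ler_norm.
    have ne0 : nrm e != 0 by apply: contra e0 => /eqP /nrm_eq0 ->.
    rewrite /b nrmM nrmV le_eqVlt; apply/orP; left; apply/eqP; field.
    exact: ne0.
apply/eqP; rewrite -normr_le0; apply/ler_addgt0Pr => t t0; rewrite add0r.
set c := nrm a * K in key.
have c0 : 0 <= c by rewrite mulr_ge0 ?nrm_ge0// normr_ge0.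
have t'0 : 0 < t / (2 * (c + 1)) by rewrite divr_gt0// mulr_gt0// ltr_wpDl.
have [e [he e0 et]] := rotation_small t'0.
apply: le_trans (key e he e0) _; apply: (@le_trans _ _ (c * (2 * (t / (2 * (c + 1)))))).
  by rewrite ler_wpM2l.
have c1 : 0 < c + 1 by rewrite ltr_wpDl.
have -> : c * (2 * (t / (2 * (c + 1)))) = t * (c / (c + 1)).
  by field; rewrite gt_eqF.
by rewrite ler_piMr ?(ltW t0)// ler_pdivrMr// mul1r lerDl.
Qed.

End HaarDerivations.

(** * The Schwinger-Dyson equations *)

Section SchwingerDyson.
Context {R : realType} {d : nat} {dsp : measure_display} {T : measurableType dsp}.
Variables (Pr : probability T R) (U : T -> 'M[Cplx R]_d).
Local Notation C := (Cplx R).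
Local Notation G := (@unitary_fix_eps1 R d).
Hypothesis U_haar : haar_distributed Pr G U.
Variables (f : 'M[C]_d -> C) (fd : 'M[C]_d -> 'M[C]_d -> C).
Hypothesis fD : Der f fd.

Definition null_direction (H : 'M[C]_d) : Prop :=
  forall a : C, Ex Pr (fun w => complex.Re (a * fd H (U w))) = 0.

Lemma null_directionD H H' b :
  null_direction H -> null_direction H' -> null_direction (b *: H + H').
Proof.
move=> h h' a; have ga x K : brv (fun w => complex.Re (x * fd K (U w))).
  apply: (regular_brv U_haar (f := fun M => x * fd K M)).
  by apply: regularM; [exact: regular_cst|exact: der_regular' fD K].
rewrite (_ : (fun _ => _) = fun w =>
    complex.Re (a * b * fd H (U w)) + complex.Re (a * fd H' (U w))).
  by rewrite ExD// h h' addr0.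
by apply/funext => w; rewrite -ReD (der_lin fD) mulrDr mulrA.
Qed.

Lemma null_direction0 : null_direction 0.
Proof.
have h := der_lin fD; move=> a; rewrite -(Ex_cst Pr 0); congr Ex.
apply/funext => w; have := h (U w) 1 0 0.
rewrite scaler0 addr0 mul1r => /eqP; rewrite -subr_eq0 opprD addrA subrr add0r.
by rewrite oppr_eq0 => /eqP ->; rewrite mulr0.
Qed.

Lemma null_directionZ H b : null_direction H -> null_direction (b *: H).
Proof.
by move=> h; rewrite -[_ *: _]addr0; apply: null_directionD => //; exact: null_direction0.
Qed.

(** A nonzero multiple of v v* is a projection orthogonal to the first basis
    vector. *)
Lemma null_direction_rank1 (v : 'cV[C]_d) :
  v^t* *m eps1 R d = 0 -> null_direction (v *m v^t*).
Proof.
move=> ve; have [v0|vN0] := eqVneq (l2norm v) 0.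
  by rewrite (l2norm_eq0 v0) mul0mx; exact: null_direction0.
set s : C := ((l2norm v ^+ 2)%:C)%C.
have sN0 : s != 0 by rewrite /s eq_complex /= eqxx andbT sqrf_eq0.
have vv : v^t* *m v = s%:M by rewrite [LHS]mx11_scalar l2norm_dot.
rewrite -[v *m _](scalerK sN0) scalerA mulrC -scalerA; apply: null_directionZ.
move=> a; apply: (Ex_der_proj U_haar a fD); split.
- rewrite linearZ /= map_mxZ /= trmx_mul map_mxM /= trmxCK.
  congr (_ *: _); rewrite fmorphV; congr (_^-1).
  by apply/eqP; rewrite eq_complex /= oppr0 !eqxx.
- rewrite -scalemxAl -scalemxAr mulmxA -(mulmxA v) vv mul_mx_scalar -scalemxAl.
  by rewrite scalerA mulVf// scale1r.
- by rewrite -scalemxAl -mulmxA ve mulmx0 scaler0.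
Qed.

(** Polarization: the directions v v* for v = e_i, e_j, e_i + e_j and e_i +
    i e_j span E_ij over the complex numbers. *)
Lemma null_direction_delta (i j : 'I_d) : i != 0%N :> nat -> j != 0%N :> nat ->
  null_direction (delta_mx i j).
Proof.
move=> i0 j0.
have dt (k l : nat) (x : 'I_k) (y : 'I_l) : (delta_mx x y : 'M[C]_(k, l))^t* = delta_mx y x.
  by rewrite trmx_delta map_delta_mx.
have de (k : 'I_d) : k != 0%N :> nat -> delta_mx 0 k *m eps1 R d = 0 :> 'M[C]_1.
  move=> k0; apply/matrixP => x y; rewrite !mxE (bigD1 k)//= big1.
    by rewrite !mxE (negbTE k0) mulr0 addr0.
  by move=> l lk; rewrite !mxE (negbTE lk) andbF mul0r.
(* The direction v v* for v = e_i + c e_j, used with c = 1 and c = i. *)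
have key (c : C) : null_direction (delta_mx i i + c^* *: delta_mx i j +
    c *: delta_mx j i + (c * c^*) *: delta_mx j j).
  have adj : (delta_mx i 0 + c *: delta_mx j 0 : 'cV[C]_d)^t* =
      delta_mx 0 i + c^* *: delta_mx 0 j.
    by rewrite linearD /= map_mxD linearZ /= map_mxZ !dt.
  have perp : (delta_mx i 0 + c *: delta_mx j 0 : 'cV[C]_d)^t* *m eps1 R d = 0.
    by rewrite adj mulmxDl -scalemxAl !de// scaler0 addr0.
  have := null_direction_rank1 perp; rewrite adj.
  rewrite mulmxDl !mulmxDr -!scalemxAl -!scalemxAr !mul_delta_mx scalerA.
  by rewrite addrA.
have ii (k : 'I_d) : k != 0%N :> nat -> null_direction (delta_mx k k).
  move=> k0; have := @null_direction_rank1 (delta_mx k 0).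
  by rewrite dt de// mul_delta_mx; apply.
have sym : null_direction (delta_mx i j + delta_mx j i).
  have := null_directionD (-1) (ii i i0) (null_directionD (-1) (ii j j0) (key 1)).
  rewrite rmorph1 mulr1 !scale1r !scaleN1r.
  by rewrite [- delta_mx j j + _]addrC addrK -!addrA addKr.
have asym : null_direction (delta_mx i j - delta_mx j i).
  have := null_directionD (-1) (ii i i0) (null_directionD (-1) (ii j j0) (key 'i)).
  rewrite conjCi mulrN -expr2 sqrCi opprK scale1r !scaleN1r.
  rewrite [- delta_mx j j + _]addrC addrK -!addrA addKr => /(null_directionZ 'i).
  by rewrite scalerDr !scalerA mulrN -expr2 sqrCi opprK scale1r scaleN1r.
have := null_directionZ 2^-1 (null_directionD 1 sym asym).
rewrite scale1r addrACA subrr addr0 -mulr2n -[X in _ *: X]scaler_nat scalerA mulVf ?scale1r//.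
Qed.

End SchwingerDyson.

(** Each function f_ij is differentiated along its own matrix unit; summing
    over all pairs is what contracts words into traces. *)
Lemma schwinger_dyson (R : realType) (d : nat) (dsp : measure_display)
    (T : measurableType dsp) (Pr : probability T R) (U : T -> 'M[Cplx R]_d)
    (f : 'I_d -> 'I_d -> 'M[Cplx R]_d -> Cplx R)
    (fd : 'I_d -> 'I_d -> 'M[Cplx R]_d -> 'M[Cplx R]_d -> Cplx R) :
  haar_distributed Pr (@unitary_fix_eps1 R d) U ->
  (forall i j, Der (f i j) (fd i j)) ->
  Ex Pr (fun w => complex.Re (\sum_(i : 'I_d | i != 0%N :> nat) \sum_(j : 'I_d | j != 0%N :> nat)
    fd i j (delta_mx i j) (U w))) = 0.
Proof.
move=> U_haar fD.
have bf i j : brv (fun w => complex.Re (fd i j (delta_mx i j) (U w))).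
  exact: (regular_brv U_haar (der_regular' (fD i j) _)).
under [X in Ex _ X]eq_fun do rewrite Re_sum.
rewrite Ex_sum; last first.
  move=> i; under eq_fun do rewrite Re_sum.
  exact: brv_sum.
rewrite big1// => i i0; under [X in Ex _ X]eq_fun do rewrite Re_sum.
rewrite Ex_sum// big1// => j j0.
have := null_direction_delta U_haar (fD i j) i0 j0 1.
by under [X in Ex _ X]eq_fun do rewrite mul1r.
Qed.

(** * Words, their derivatives, and averages over matrix units *)

Lemma tr_delta_mul (F : nzRingType) d (M : 'M[F]_d) (i j : 'I_d) : \tr (delta_mx i j *m M) = M j i.
Proof.
rewrite /mxtrace (bigD1 i)//= big1 => [|k ki].
  rewrite !mxE (bigD1 j)//= big1 => [|l lj]; first by rewrite !mxE !eqxx mul1r !addr0.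
  by rewrite !mxE (negbTE lj) andbF mul0r.
by rewrite !mxE big1// => l _; rewrite !mxE (negbTE ki) mul0r.
Qed.

Section Words.
Variables (R : realType) (d : nat).
Local Notation C := (Cplx R).
Local Notation G := (@unitary_fix_eps1 R d).
Implicit Types (x : bool * 'M[C]_d) (s : seq (bool * 'M[C]_d)) (M H : 'M[C]_d).

(** A letter is a matrix together with a flag: a flagged letter is
    conjugated by the variable unitary M. *)
Definition lval M x : 'M[C]_d := if x.1 then M *m x.2 *m M^t* else x.2.

Fixpoint wval M s : 'M[C]_d :=
  if s is x :: s' then lval M x *m wval M s' else 1%:M.

(** On the unitary group the conjugate M a M* has derivative the commutator
    of the direction with M a M*, since the two factors M and M* contribute
    H and - H. *)
Definition lder x H M : 'M[C]_d :=
  if x.1 then H *m lval M x - lval M x *m H else 0.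

Fixpoint wder s H M : 'M[C]_d :=
  if s is x :: s' then lder x H M *m wval M s' + lval M x *m wder s' H M else 0.

Lemma MDer_lval x : MDer (fun M => lval M x) (lder x).
Proof.
rewrite /lval /lder; case: x => -[] c /=; last exact: MDer_cst.
apply: MDer_ext (MDerM (MDerM (@MDer_id R d) (MDer_cst c)) (MDerJ (@MDer_id R d))) _ _ => //.
move=> H M; rewrite mulmx0 addr0 trmx_mul map_mxM /= trmxCK.
by rewrite mulmxN !mulmxA.
Qed.

Lemma MDer_wval s : MDer (fun M => wval M s) (wder s).
Proof.
elim: s => [|x s IH]; first exact: MDer_cst.
exact: MDer_ext (MDerM (MDer_lval x) IH) _ _.
Qed.

Lemma wval_cat M s1 s2 : wval M (s1 ++ s2) = wval M s1 *m wval M s2.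
Proof. by elim: s1 => [|x s IH] /=; rewrite ?mul1mx// IH mulmxA. Qed.

Lemma wval1 M x : wval M [:: x] = lval M x.
Proof. by rewrite /= mulmx1. Qed.

Lemma wval_rcons M s x : wval M (rcons s x) = wval M s *m lval M x.
Proof. by rewrite -cats1 wval_cat wval1. Qed.

Lemma opb_lval M x c : G M -> opb x.2 c -> opb (lval M x) c.
Proof.
move=> [Mu _] xc; rewrite /lval; case: x.1 => //.
have [h1 h2] := opb_unitary Mu.
by have := opb_mul (opb_mul h1 xc) h2; rewrite mul1r mulr1.
Qed.

Definition wbounded c s : Prop := forall x, x \in s -> opb x.2 c.

Lemma wbounded_cons c x s : wbounded c (x :: s) -> opb x.2 c /\ wbounded c s.
Proof.
by move=> h; split=> [|y ys]; apply: h; rewrite inE ?eqxx// ys orbT.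
Qed.

Lemma opb_wval M c s : G M -> wbounded c s -> opb (wval M s) (c ^+ size s).
Proof.
move=> GM; elim: s => [_|x s IH] /=; first by rewrite expr0; exact: opb1.
by move=> /wbounded_cons[hx hs]; rewrite exprS; apply: opb_mul (opb_lval GM hx) (IH hs).
Qed.

Lemma opb_lder M x c H h : G M -> opb x.2 c -> opb H h ->
  opb (lder x H M) (2 * (c * h)).
Proof.
move=> GM xc Hh; have c0 := opb_ge0 xc; have h0 := opb_ge0 Hh.
have xl := opb_lval GM xc; rewrite /lder; case: x.1; last first.
  by apply: opbW (opb0 _ _ _); rewrite !mulr_ge0.
rewrite mulr_natl mulr2n {1}[c * h]mulrC; apply: opbD; first exact: opb_mul.
by apply: opbN; exact: opb_mul.
Qed.

Lemma opb_wder M c s H h : G M -> wbounded c s -> opb H h ->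
  opb (wder s H M) ((2 * size s)%:R * (c ^+ size s * h)).
Proof.
move=> GM; elim: s => [_ _|x s IH] /=; first by rewrite muln0 mul0r; exact: opb0.
move=> /wbounded_cons[hx hs] Hh.
have := opbD (opb_mul (opb_lder GM hx Hh) (opb_wval GM hs))
  (opb_mul (opb_lval GM hx) (IH hs Hh)).
by apply: opbW; rewrite le_eqVlt; apply/orP; left; apply/eqP; rewrite exprS mulnS natrD; ring.
Qed.

(** The projection onto the orthogonal complement of the first basis vector. *)
Definition Qmx : 'M[C]_d := \sum_(i : 'I_d | i != 0%N :> nat) delta_mx i i.

Lemma delta_sandwich M (i j k l : 'I_d) :
  delta_mx i j *m M *m delta_mx k l = M j k *: delta_mx i l.
Proof.
apply/matrixP => a b; rewrite !mxE (bigD1 k)//= big1 => [|k' kk'].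
  rewrite !mxE eqxx addr0 (bigD1 j)//= big1 => [|j' jj'].
    by rewrite !mxE eqxx andbT addr0 /= mulrAC; case: (a == i); case: (b == l);
      rewrite /= ?mulr1 ?mulr0 ?mul1r ?mul0r.
  by rewrite !mxE (negbTE jj') andbF mul0r.
by rewrite !mxE (negbTE kk') mulr0.
Qed.

Lemma tr_Qmx M : \tr (Qmx *m M) = \sum_(i : 'I_d | i != 0%N :> nat) M i i.
Proof.
by rewrite mulmx_suml raddf_sum; apply: eq_bigr => i _; rewrite /= tr_delta_mul.
Qed.

(** The mechanism by which summing over directions creates traces: E_ij M
    E_ji is M_jj E_ii. *)
Lemma average_units M :
  \sum_(i : 'I_d | i != 0%N :> nat) \sum_(j : 'I_d | j != 0%N :> nat)
    delta_mx i j *m M *m delta_mx j i = \tr (Qmx *m M) *: Qmx.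
Proof.
rewrite tr_Qmx [RHS]scaler_sumr; apply: eq_bigr => i _.
rewrite scaler_suml; apply: eq_bigr => j _; exact: delta_sandwich.
Qed.

Lemma opb_Qmx : opb Qmx 1.
Proof.
split=> // v; rewrite mul1r -(@ler_pXn2r _ 2)// ?nnegrE ?l2norm_ge0//.
rewrite !l2norm_sqr; apply: ler_sum => k _.
rewrite ler_pXn2r ?nnegrE ?nrm_ge0//.
rewrite mulmx_suml summxE.
have dk (i : 'I_d) : (delta_mx i i *m v) k ord0 = (k == i)%:R * v i ord0.
  rewrite mxE (bigD1 i)//= big1 => [|l li]; rewrite !mxE.
    by rewrite eqxx andbT addr0.
  by rewrite (negbTE li) andbF mul0r.
have [k0|k0] := eqVneq (k : nat) 0%N.
  rewrite big1 ?nrm0 ?nrm_ge0// => i i0; rewrite dk.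
  by case: (k =P i) => [ki|_]; rewrite ?mul0r//; rewrite -ki k0 in i0.
rewrite (bigD1 k)//= big1 => [|i /andP[_ ik]]; rewrite dk ?eqxx ?mul1r ?addr0//.
by rewrite eq_sym (negbTE ik) mul0r.
Qed.

Lemma compress_units (N : 'M[C]_d) :
  \sum_(i : 'I_d | i != 0%N :> nat) \sum_(j : 'I_d | j != 0%N :> nat)
    N i j *: delta_mx i j = Qmx *m N *m Qmx.
Proof.
rewrite /Qmx !mulmx_suml; apply: eq_bigr => i _.
by rewrite mulmx_sumr; apply: eq_bigr => j _; rewrite delta_sandwich.
Qed.

End Words.

(** * Contracting the derivative of a word *)

Section Contraction.
Variables (R : realType) (d : nat).
Hypothesis d_gt0 : (0 < d)%N.
Local Notation C := (Cplx R).
Local Notation G := (@unitary_fix_eps1 R d).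
Local Notation Q := (@Qmx R d).
Implicit Types (x : bool * 'M[C]_d) (s : seq (bool * 'M[C]_d)) (M H : 'M[C]_d).

Lemma tr_Q : \tr Q = d.-1%:R.
Proof.
rewrite -[Q]mulmx1 tr_Qmx; under eq_bigr do rewrite mxE eqxx.
case: d d_gt0 => // n _; rewrite big_mkcond big_ord_recl /= add0r.
under eq_bigr do rewrite /=.
by rewrite sumr_const card_ord.
Qed.

(** The derivative of the word s along E_ij, closed on the right by E_ji and
    summed over i and j. *)
Definition cder s M : 'M[C]_d :=
  \sum_(i : 'I_d | i != 0%N :> nat) \sum_(j : 'I_d | j != 0%N :> nat)
    wder s (delta_mx i j) M *m delta_mx j i.

Lemma if_sub (V : zmodType) (b : bool) (x y : V) :
  (if b then x - y else 0) = (if b then x else 0) - (if b then y else 0).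
Proof. by case: b; rewrite ?subr0. Qed.

Lemma if_subZ (V : lmodType C) (b : bool) (x z : V) (a : C) :
  (if b then x - a *: z else 0) =
  (if b then x else 0) - (if b then a else 0) *: z.
Proof. by case: b; rewrite ?scale0r ?subr0. Qed.

Lemma cder_nil M : cder [::] M = 0.
Proof. by rewrite /cder big1// => i _; rewrite big1// => j _; rewrite mul0mx. Qed.

Lemma cder_cons x s M : cder (x :: s) M =
  (if x.1 then \tr (Q *m wval M (x :: s)) *: Q -
     \tr (Q *m wval M s) *: (lval M x *m Q) else 0) + lval M x *m cder s M.
Proof.
rewrite /cder /= [X in _ = _ + X]mulmx_sumr.
rewrite (eq_bigr (fun i : 'I_d => (\sum_(j : 'I_d | j != 0%N :> nat)
    lder x (delta_mx i j) M *m wval M s *m delta_mx j i) +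
    lval M x *m \sum_(j : 'I_d | j != 0%N :> nat)
    wder s (delta_mx i j) M *m delta_mx j i)); last first.
  move=> i _; rewrite mulmx_sumr -big_split /=; apply: eq_bigr => j _.
  by rewrite mulmxDl !mulmxA.
rewrite big_split /=; congr (_ + _); rewrite /lder; case: x.1; last first.
  by rewrite big1// => i _; rewrite big1// => j _; rewrite !mul0mx.
rewrite -!average_units scalemxAr -average_units mulmx_sumr -sumrB.
apply: eq_bigr => i _; rewrite mulmx_sumr -sumrB; apply: eq_bigr => j _.
by rewrite !mulmxBl !mulmxA.
Qed.

(** The sum of u over the nonempty suffixes of a word. *)
Fixpoint tailsum (u : seq (bool * 'M[C]_d) -> R) s : R :=
  if s is x :: s' then u (x :: s') + tailsum u s' else 0.

(** The flag of the last letter. The empty word counts as not conjugated, as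
    it has no derivative. *)
Definition lastside s : bool := (last (false, 0) s).1.

Lemma tailsum_ge0 u s : (forall s', 0 <= u s') -> 0 <= tailsum u s.
Proof. by move=> u0; elim: s => //= x s IH; rewrite addr_ge0. Qed.

(** Differentiating a letter L followed by the rest u of the word puts E_ij
    and E_ji around L u and around u, which yields the factors Tr (Q L u)
    and Tr (Q u). Only when u is empty, at the last letter, is the latter
    the large number Tr Q; all other factors are traces of nonempty suffixes
    of s. *)
Lemma cder_split M c s : G M -> wbounded c s -> 0 <= c ->
  exists2 A, cder s M =
    A - (if lastside s then \tr Q else 0) *: (wval M s *m Q) &
    opb A ((1 + 2 * c) ^+ size s * tailsum (fun u => nrm (\tr (Q *m wval M u))) s).
Proof.
move=> GM hs c0; elim: s hs => [_|x s IH /wbounded_cons[hx hs]].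
  exists 0; last by rewrite mulr0; exact: opb0.
  by rewrite scale0r subr0 cder_nil.
set t := tailsum _; set k := 1 + 2 * c.
have k1 : 1 <= k by rewrite lerDl mulr_ge0.
have k0 : 0 <= k by exact: le_trans k1.
have kn n : 1 <= k ^+ n by rewrite exprn_ege1.
have t0 u : 0 <= t u by apply: tailsum_ge0 => ?; exact: nrm_ge0.
have [A hA bA] := IH hs.
pose b1 : 'M[C]_d := if x.1 then \tr (Q *m wval M (x :: s)) *: Q else 0.
have ob1 : opb b1 (nrm (\tr (Q *m wval M (x :: s)))).
  rewrite /b1; case: x.1; last by apply: opbW (opb0 _ _ _); exact: nrm_ge0.
  by rewrite -[nrm _]mulr1; apply: opbZ; exact: opb_Qmx.
have oA := opb_mul (opb_lval GM hx) bA.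
case: s hs IH hA bA oA @b1 ob1 => [|y s] hs IH hA bA oA b1 ob1.
  exists b1.
    rewrite cder_cons cder_nil mulmx0 addr0 /b1 /lastside [last _ _]/= wval1.
    rewrite [wval M [::]]/= mulmx1.
    exact: if_subZ.
  apply: opbW ob1; have -> : t [:: x] = nrm (\tr (Q *m wval M [:: x])) by rewrite /t /= addr0.
  by rewrite expr1 ler_peMl ?nrm_ge0.
pose b2 : 'M[C]_d := if x.1 then \tr (Q *m wval M (y :: s)) *: (lval M x *m Q) else 0.
have ob2 : opb b2 (t (y :: s) * c).
  have ht : nrm (\tr (Q *m wval M (y :: s))) <= t (y :: s).
    by rewrite /t [leRHS]/= lerDl; exact: t0.
  rewrite /b2; case: x.1; last by apply: opbW (opb0 _ _ _); rewrite mulr_ge0.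
  apply: (@opbW _ _ _ _ (nrm (\tr (Q *m wval M (y :: s))) * (c * 1))).
    by rewrite mulr1 ler_wpM2r.
  by apply: opbZ; apply: opb_mul (opb_lval GM hx) (opb_Qmx _ _).
exists (b1 - b2 + lval M x *m A).
  have b12 : b1 - b2 = if x.1 then \tr (Q *m wval M (x :: y :: s)) *: Q -
      \tr (Q *m wval M (y :: s)) *: (lval M x *m Q) else 0.
    by rewrite if_sub.
  rewrite cder_cons -[X in X + _ = _]b12 hA.
  rewrite [lval M x *m (A - _)]mulmxBr -[lval M x *m (_ *: _)]scalemxAr.
  rewrite [lval M x *m (wval _ _ *m _)]mulmxA; exact: addrA.
apply: opbW (opbD (opbD ob1 (opbN ob2)) oA).
set s1 := y :: s; rewrite -/s1 in t0 *.
have -> : t (x :: s1) = nrm (\tr (Q *m wval M (x :: s1))) + t s1 by [].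
rewrite -/k -[tailsum _ s1]/(t s1) [size (x :: s1)]/= [k ^+ (size s1).+1]exprS.
have := nrm_ge0 (\tr (Q *m wval M (x :: s1))).
have := kn (size s1); have := t0 s1.
move: (t s1) (k ^+ size s1) (nrm _) => a b n a0 b1' n0.
have hn : n <= k * b * n by rewrite ler_peMl// mulr_ege1.
have h : a <= b * a by rewrite ler_peMl.
have h2 : c * a <= c * (b * a) by rewrite ler_wpM2l.
have -> : k * b * (n + a) = k * b * n + (b * a + 2 * (c * (b * a))).
  by rewrite /k; ring.
have h3 : 0 <= b * a by rewrite mulr_ge0// (le_trans ler01).
by lra.
Qed.

End Contraction.

(** * The cut observable *)

Lemma signed_le (R : realDomainType) (b : bool) (a u v p q : R) :
  `|u| <= p -> `|v| <= q ->
  a <= (if b then 1 else -1) * ((if b then 1 else -1) * a + u + v) + (p + q).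
Proof.
rewrite !ler_norml => /andP[u1 u2] /andP[v1 v2].
by case: b; lra.
Qed.

Section CutObservable.
Variables (R : realType) (d : nat).
Hypothesis d_gt0 : (0 < d)%N.
Local Notation C := (Cplx R).
Local Notation G := (@unitary_fix_eps1 R d).
Local Notation Q := (@Qmx R d).
Variables (S : 'M[C]_d) (s : seq (bool * 'M[C]_d)) (x : bool * 'M[C]_d).
Implicit Types (M H E : 'M[C]_d).

(** The state S of the word s x with the projection E inserted before its
    last letter x. *)
Definition cutobs E M : C := \tr (S *m (wval M s *m E *m lval M x)).

Definition cutder E H M : C :=
  \tr (S *m (wder s H M *m E *m lval M x + wval M s *m E *m lder x H M)).

Lemma Der_cutobs E : Der (cutobs E) (cutder E).
Proof.
have h1 := MDerM (MDer_wval s) (MDer_cst E).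
have h2 := MDerM h1 (MDer_lval x).
have h3 := MDerM (MDer_cst S) h2.
apply: Der_ext (Der_tr h3) _ _ => //.
by move=> H M; rewrite mul0mx add0r mulmx0 addr0.
Qed.

(** Multiplying Z by this function gives |Z|^4. *)
Definition cubic M : C := (cutobs Q M)^* * ((cutobs Q M)^* * cutobs Q M).

Definition cubicder H M : C :=
  - (cutder Q (H^t* ) M)^* * ((cutobs Q M)^* * cutobs Q M) +
  (cutobs Q M)^* * (- (cutder Q (H^t* ) M)^* * cutobs Q M +
    (cutobs Q M)^* * cutder Q H M).

Lemma Der_cubic : Der cubic cubicder.
Proof.
have h := Der_cutobs Q; have hJ := DerJ h.
exact: (DerM hJ (DerM hJ h)).
Qed.

(** The index order in E_ji is opposite to the direction E_ij along which
    this function is differentiated, so that the two meet and contract. *)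
Definition sdfun (i j : 'I_d) M : C := cutobs (delta_mx j i) M * cubic M.

Definition sdder (i j : 'I_d) H M : C :=
  cutder (delta_mx j i) H M * cubic M + cutobs (delta_mx j i) M * cubicder H M.

Lemma Der_sd i j : Der (sdfun i j) (sdder i j).
Proof. exact: (DerM (Der_cutobs _) Der_cubic). Qed.

Definition sdsum M : C :=
  \sum_(i : 'I_d | i != 0%N :> nat) \sum_(j : 'I_d | j != 0%N :> nat)
    sdder i j (delta_mx i j) M.

Lemma average_lder M :
  \sum_(i : 'I_d | i != 0%N :> nat) \sum_(j : 'I_d | j != 0%N :> nat)
    delta_mx j i *m lder x (delta_mx i j) M =
  if x.1 then \tr Q *: (Q *m lval M x) - \tr (Q *m lval M x) *: Q else 0.
Proof.
rewrite exchange_big /lder /=; case: x.1; last first.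
  by rewrite big1// => i _; rewrite big1// => j _; rewrite mulmx0.
rewrite -average_units scalemxAl -{1}[Q]mulmx1 -average_units mulmx_suml -sumrB.
apply: eq_bigr => i _; rewrite mulmx_suml -sumrB; apply: eq_bigr => j _.
by rewrite mulmxBr !mulmxA mulmx1.
Qed.

Lemma sum_cutder M :
  \sum_(i : 'I_d | i != 0%N :> nat) \sum_(j : 'I_d | j != 0%N :> nat)
    cutder (delta_mx j i) (delta_mx i j) M =
  \tr (S *m (cder s M *m lval M x)) +
  \tr (S *m (wval M s *m
    (if x.1 then \tr Q *: (Q *m lval M x) - \tr (Q *m lval M x) *: Q else 0))).
Proof.
rewrite -average_lder -mxtraceD -mulmxDr /cder mulmx_suml mulmx_sumr -big_split /=.
rewrite mulmx_sumr raddf_sum; apply: eq_bigr => i _ /=.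
rewrite mulmx_suml mulmx_sumr -big_split /= mulmx_sumr raddf_sum.
by apply: eq_bigr => j _; rewrite /cutder /= !mulmxA.
Qed.

(** Summing the entries of L S W against the directions E_ij reassembles a
    single direction Q L S W Q of bounded norm. Hence the derivative of the
    cubic factor contributes a term without any power of the dimension. *)
Lemma sum_cutobs_cubicder M :
  \sum_(i : 'I_d | i != 0%N :> nat) \sum_(j : 'I_d | j != 0%N :> nat)
    cutobs (delta_mx j i) M * cubicder (delta_mx i j) M =
  cubicder (Q *m (lval M x *m S *m wval M s) *m Q) M.
Proof.
have lin := der_lin Der_cubic M.
have add0 : cubicder 0 M = 0.
  have := lin 1 0 0; rewrite scaler0 addr0 mul1r => /eqP.
  by rewrite -subr_eq0 opprD addrA subrr add0r oppr_eq0 => /eqP.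
have linsum (r : seq 'I_d) (P : pred 'I_d) (F : 'I_d -> 'M[C]_d) :
    cubicder (\sum_(i <- r | P i) F i) M = \sum_(i <- r | P i) cubicder (F i) M.
  elim/big_rec2: _ => // i y z _ <-.
  by have := lin 1 (F i) z; rewrite scale1r mul1r.
have linZ a H : cubicder (a *: H) M = a * cubicder H M.
  by have := lin a H 0; rewrite addr0 add0 addr0.
rewrite -compress_units linsum; apply: eq_bigr => i _.
rewrite linsum; apply: eq_bigr => j _; rewrite linZ; congr (_ * _).
rewrite /cutobs mulmxA mulmxA mxtrace_mulC mulmxA -[RHS]tr_delta_mul.
by rewrite mxtrace_mulC !mulmxA.
Qed.

Lemma sdsumE M : sdsum M =
  (\tr (S *m (cder s M *m lval M x)) +
  \tr (S *m (wval M s *m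
    (if x.1 then \tr Q *: (Q *m lval M x) - \tr (Q *m lval M x) *: Q else 0))))
   * cubic M +
  cubicder (Q *m (lval M x *m S *m wval M s) *m Q) M.
Proof.
rewrite -sum_cutder -sum_cutobs_cubicder mulr_suml -big_split /=.
apply: eq_bigr => i _; rewrite mulr_suml -big_split /=.
by apply: eq_bigr => j _.
Qed.

Hypothesis S_opb : opb S 1.
Hypothesis S_tr : forall M c, opb M c -> nrm (\tr (S *m M)) <= c.
Hypothesis sides : lastside s != x.1.
Variable c : R.
Hypothesis c_ge1 : 1 <= c.
Hypothesis s_bounded : wbounded c s.
Hypothesis x_bounded : opb x.2 c.

Let c_ge0 : 0 <= c. Proof. exact: le_trans c_ge1. Qed.

(** These traces are the error terms of the Schwinger-Dyson equation; for
    nonempty s they belong to proper subwords of s x. *)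
Definition smalltr M : R :=
  tailsum (fun u => nrm (\tr (Q *m wval M u))) s + nrm (\tr (Q *m lval M x)).

Lemma nrm_cutder M H h : G M -> opb H h ->
  nrm (cutder Q H M) <= (2 * (size s).+1)%:R * (c ^+ (size s).+1 * h).
Proof.
move=> GM Hh; apply: S_tr.
have := opbD
  (opb_mul (opb_mul (opb_wder GM s_bounded Hh) (opb_Qmx _ _)) (opb_lval GM x_bounded))
  (opb_mul (opb_mul (opb_wval GM s_bounded) (opb_Qmx _ _)) (opb_lder GM x_bounded Hh)).
by apply: opbW; rewrite le_eqVlt; apply/orP; left; apply/eqP; rewrite exprS mulnS natrD; ring.
Qed.

Lemma nrm_cubicder M H k :
  nrm (cutder Q (H^t* ) M) <= k -> nrm (cutder Q H M) <= k ->
  nrm (cubicder H M) <= 3 * k * nrm (cutobs Q M) ^+ 2.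
Proof.
rewrite /cubicder; move: (cutobs Q M) (cutder Q (H^t* ) M) (cutder Q H M).
move=> Z a b ak bk.
have -> : - a^* * (Z^* * Z) + Z^* * (- a^* * Z + Z^* * b) =
  - a^* * (Z^* * Z) + (- a^* * (Z^* * Z) + b * (Z^* * Z^*)) by ring.
have h1 : nrm (- a^* * (Z^* * Z)) <= k * nrm Z ^+ 2.
  by rewrite !nrmM nrmN !nrmJ -expr2 ler_wpM2r ?sqr_ge0.
have h2 : nrm (b * (Z^* * Z^*)) <= k * nrm Z ^+ 2.
  by rewrite !nrmM !nrmJ -expr2 ler_wpM2r ?sqr_ge0.
have -> : 3 * k * nrm Z ^+ 2 = k * nrm Z ^+ 2 + (k * nrm Z ^+ 2 + k * nrm Z ^+ 2).
  by ring.
apply: le_trans (nrmD _ _) _; apply: lerD => //.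
by apply: le_trans (nrmD _ _) _; exact: lerD.
Qed.

Lemma sd_real_part (b : bool) (n : nat) (Z r k : C) :
  complex.Re (((if b then n%:R else - n%:R) * Z + r) * (Z^* * (Z^* * Z)) + k) =
  (if b then 1 else -1) * (n%:R * nrm Z ^+ 4) +
    complex.Re (r * (Z^* * (Z^* * Z))) + complex.Re k.
Proof.
have hZ : Z * (Z^* * (Z^* * Z)) = ((nrm Z ^+ 4)%:C)%C.
  have -> : Z * (Z^* * (Z^* * Z)) = (Z * Z^*) * (Z * Z^*) by ring.
  by rewrite mul_conjE -rmorphM -exprD.
have hZn : complex.Re (n%:R * (Z * (Z^* * (Z^* * Z)))) = n%:R * nrm Z ^+ 4.
  have -> : n%:R = ((n%:R : R)%:C)%C :> C by rewrite rmorph_nat.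
  by rewrite hZ -rmorphM.
rewrite mulrDl !ReD -hZn; congr (_ + _ + _).
case: b.
  by rewrite mul1r; apply: (congr1 (fun z : C => complex.Re z)); ring.
by rewrite mulN1r -ReN; apply: (congr1 (fun z : C => complex.Re z)); ring.
Qed.

(** Exactly one of the two letters that meet at the cut is conjugated. If it
    is x, its derivative gives + Tr Q times the cut observable; if it is the
    last letter of s, that derivative gives - Tr Q times it. *)
Lemma sum_cutder_main M : G M -> exists2 r : C,
  \tr (S *m (cder s M *m lval M x)) +
  \tr (S *m (wval M s *m
    (if x.1 then \tr Q *: (Q *m lval M x) - \tr (Q *m lval M x) *: Q else 0)))
  = (if x.1 then \tr Q else - \tr Q) * cutobs Q M + r &
  nrm r <= (1 + 2 * c) ^+ (size s).+1 * smalltr M.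
Proof.
move=> GM; have [A -> bA] := cder_split GM s_bounded c_ge0.
set t := tailsum _ _ in bA; set k := 1 + 2 * c in bA *.
have ck : c <= k by rewrite /k; have := c_ge0; lra.
have k0 : 0 <= k by exact: le_trans ck.
have t0 : 0 <= t by apply: tailsum_ge0 => ?; exact: nrm_ge0.
have bAx : nrm (\tr (S *m (A *m lval M x))) <= k ^+ (size s).+1 * t.
  apply: le_trans (S_tr (opb_mul bA (opb_lval GM x_bounded))) _.
  by rewrite exprSr mulrAC ler_wpM2r// ler_wpM2l// exprn_ge0.
have bQx : nrm (\tr (S *m (wval M s *m Q))) <= k ^+ (size s).+1.
  apply: le_trans (S_tr (opb_mul (opb_wval GM s_bounded) (opb_Qmx _ _))) _.
  rewrite mulr1; apply: (@le_trans _ _ (k ^+ size s)).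
    by rewrite lerXn2r ?nnegrE.
  by rewrite exprSr ler_peMr ?exprn_ge0// (le_trans c_ge1).
clear bA; have q0 := nrm_ge0 (\tr (Q *m lval M x)).
rewrite /smalltr -/t; have -> : lastside s = ~~ x.1 by move: sides; case: x.1; case: lastside.
case: x.1 => /=.
  rewrite scale0r subr0.
  exists (\tr (S *m (A *m lval M x)) -
    \tr (Q *m lval M x) * \tr (S *m (wval M s *m Q))).
    rewrite /cutobs; move: (lval M x) (wval M s) (@Qmx R d) => L W P.
    rewrite mulmxBr -!scalemxAr mulmxBr -!scalemxAr mxtraceD raddfN /= !mxtraceZ.
    by rewrite !mulmxA; ring.
  apply: (le_trans (nrmB _ _)); rewrite nrmM mulrDr; apply: lerD => //.
  by rewrite mulrC ler_wpM2r.
exists (\tr (S *m (A *m lval M x))).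
  rewrite mulmx0 mulmx0 mxtrace0 addr0 mulmxBl mulmxBr mxtraceD raddfN /=.
  by rewrite -scalemxAl -scalemxAr mxtraceZ /cutobs !mulmxA; ring.
by rewrite mulrDr ler_wpDr// mulr_ge0// exprn_ge0.
Qed.

(** The real part of the Schwinger-Dyson sum, solved for its dominant term.
    The sign depends on which side of the cut is conjugated. *)
Lemma sd_pointwise M : G M ->
  d.-1%:R * nrm (cutobs Q M) ^+ 4 <=
    (if x.1 then 1 else -1) * complex.Re (sdsum M) +
    ((1 + 2 * c) ^+ (size s).+1 * smalltr M * nrm (cutobs Q M) ^+ 3 +
     3 * ((2 * (size s).+1)%:R * (c ^+ (size s).+1 * c ^+ (size s).+1))
       * nrm (cutobs Q M) ^+ 2).
Proof.
move=> GM; rewrite sdsumE; have [r -> hr] := sum_cutder_main GM.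
set N := Q *m _ *m Q.
have bN : opb N (c ^+ (size s).+1).
  have := opb_mul (opb_mul (opb_Qmx R d) (opb_mul (opb_mul (opb_lval GM x_bounded)
    S_opb) (opb_wval GM s_bounded))) (opb_Qmx R d).
  by rewrite mul1r !mulr1 -exprS.
have b1 := nrm_cutder GM bN; have b2 := nrm_cutder GM (opb_adj bN).
set k1 := _ ^+ _ in hr *; set k2 := _%:R * _ in b1 b2 *.
rewrite (tr_Q R d_gt0); set Z := cutobs Q M.
have hcubic := nrm_cubicder b2 b1; rewrite -/Z in hcubic.
have hr3 : nrm (r * cubic M) <= k1 * smalltr M * nrm Z ^+ 3.
  have -> : nrm (r * cubic M) = nrm r * nrm Z ^+ 3.
    by rewrite /cubic !nrmM !nrmJ !exprS expr0 mulr1.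
  by rewrite ler_wpM2r ?exprn_ge0 ?nrm_ge0.
rewrite /cubic -/Z in hr3 *; rewrite sd_real_part.
apply: signed_le; first exact: le_trans (Re_le _) hr3.
exact: le_trans (Re_le _) hcubic.
Qed.

End CutObservable.

(** * The fourth moment of the cut observable *)

Section RealInequalities.
Variable R : realFieldType.
Implicit Types x y z a b : R.

(** Young inequality with the weight d / 4 chosen so that, together with
    [young_square], half of the dominant term is left. *)
Lemma young_cubic d k a z : 0 < d -> 0 <= z ->
  k * a * z ^+ 3 <= d / 4 * z ^+ 4 + 64 * k ^+ 4 * a ^+ 4 / d ^+ 3.
Proof.
move=> d0 z0; set y := 4 * k * a / d.
have dN0 : d != 0 by rewrite gt_eqF.
have -> : k * a * z ^+ 3 = d / 4 * (y * z ^+ 3) by rewrite /y; field.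
have -> : 64 * k ^+ 4 * a ^+ 4 / d ^+ 3 = d / 4 * y ^+ 4 by rewrite /y; field.
rewrite -mulrDr ler_wpM2l ?divr_ge0 ?(ltW d0)//.
have [yz|zy] := leP y z.
  apply: (@le_trans _ _ (z * z ^+ 3)); first by rewrite ler_wpM2r// exprn_ge0.
  by rewrite -exprS lerDl (_ : 4 = 2 * 2)%N// exprM sqr_ge0.
have y0 : 0 <= y by rewrite (le_trans z0)// ltW.
apply: (@le_trans _ _ (y * y ^+ 3)).
  by rewrite ler_wpM2l// lerXn2r ?nnegrE// ltW.
by rewrite -exprS lerDr exprn_ge0.
Qed.

Lemma young_square d k z : 0 < d -> k * z ^+ 2 <= d / 4 * z ^+ 4 + k ^+ 2 / d.
Proof.
move=> d0; have dN0 : d != 0 by rewrite gt_eqF.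
rewrite -subr_ge0.
have -> : d / 4 * z ^+ 4 + k ^+ 2 / d - k * z ^+ 2 =
  (d / 2 * z ^+ 2 - k) ^+ 2 / d by field.
by rewrite divr_ge0 ?sqr_ge0// ltW.
Qed.

Lemma pow4D x y : (x + y) ^+ 4 <= 8 * (x ^+ 4 + y ^+ 4).
Proof.
have h a b : (a + b) ^+ 2 <= 2 * (a ^+ 2 + b ^+ 2).
  by rewrite -subr_ge0 (_ : _ - _ = (a - b) ^+ 2) ?sqr_ge0//; ring.
rewrite (_ : 4 = 2 * 2)%N// !exprM.
apply: (@le_trans _ _ ((2 * (x ^+ 2 + y ^+ 2)) ^+ 2)).
  by rewrite lerXn2r ?nnegrE ?sqr_ge0// mulr_ge0// addr_ge0// sqr_ge0.
rewrite exprMn (_ : 8 = 4 * 2); last by ring.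
by rewrite -mulrA (_ : 2 ^+ 2 = 4); [rewrite ler_wpM2l|ring].
Qed.

End RealInequalities.

Lemma tailsum_pow4 (R : realType) (d : nat)
    (u : seq (bool * 'M[Cplx R]_d) -> R) s : (forall v, 0 <= u v) ->
  tailsum u s ^+ 4 <= 8 ^+ size s * tailsum (fun v => u v ^+ 4) s.
Proof.
move=> u0; elim: s => [|x s IH]; first by rewrite /= expr0n mulr0.
rewrite [tailsum u _]/= [tailsum _ (_ :: _)]/= [size _]/= [8 ^+ _]exprS.
apply: le_trans (pow4D _ _) _; rewrite -mulrA ler_wpM2l//.
rewrite [leRHS]mulrDr; apply: lerD => //.
by rewrite ler_peMl ?exprn_ge0// exprn_ege1// ler1n.
Qed.

Section CutMoment.
Context {R : realType} {dsp : measure_display} {T : measurableType dsp}.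
Variable Pr : probability T R.
Variables (d : nat) (d_gt1 : (1 < d)%N) (U : T -> 'M[Cplx R]_d).
Local Notation C := (Cplx R).
Local Notation Q := (@Qmx R d).
Hypothesis U_haar : haar_distributed Pr (@unitary_fix_eps1 R d) U.
Implicit Types (M H : 'M[C]_d).

Let d_gt0 : (0 < d)%N. Proof. exact: ltnW. Qed.

Lemma regular_tr_wval A s : regular (fun M => \tr (A *m wval M s)).
Proof. exact: der_regular (Der_tr (MDerM (MDer_cst A) (MDer_wval s))). Qed.

Lemma brv_tr_wval A s : brv (fun w => nrm (\tr (A *m wval (U w) s)) ^+ 4).
Proof. exact: (regular_brv_pow4 U_haar (regular_tr_wval A s)). Qed.

Lemma brv_cutobs S s x E : brv (fun w => nrm (cutobs S s x E (U w)) ^+ 4).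
Proof. exact: (regular_brv_pow4 U_haar (der_regular (Der_cutobs S s x E))). Qed.

Lemma Ex_tailsum s (b : R) : 0 <= b ->
  (forall s1 s2, s = s1 ++ s2 -> s2 <> [::] ->
     Ex Pr (fun w => nrm (\tr (Q *m wval (U w) s2)) ^+ 4) <= b) ->
  brv (fun w => tailsum (fun u => nrm (\tr (Q *m wval (U w) u)) ^+ 4) s) /\
  Ex Pr (fun w => tailsum (fun u => nrm (\tr (Q *m wval (U w) u)) ^+ 4) s) <=
    (size s)%:R * b.
Proof.
move=> b0; elim: s => [_|x s IH h].
  by split; [exact: brv_cst|rewrite /= Ex_cst mul0r].
have [|bs es] := IH.
  by move=> s1 s2 e; apply: (h (x :: s1)); rewrite e.
have bx := brv_tr_wval Q (x :: s).
split; first exact: brvD bx bs.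
apply: (@le_trans _ _ (b + (size s)%:R * b)).
  have -> : Ex Pr (fun w => tailsum (fun u => nrm (\tr (Q *m wval (U w) u)) ^+ 4)
    (x :: s)) = _ := ExD Pr bx bs.
  by apply: lerD => //; apply: (h [::]).
by rewrite [size (x :: s)]/= -[(size s).+1]add1n natrD mulrDl mul1r.
Qed.

Variables (S : 'M[C]_d) (s : seq (bool * 'M[C]_d)) (x : bool * 'M[C]_d) (c b : R).
Hypothesis S_opb : opb S 1.
Hypothesis S_tr : forall M c, opb M c -> nrm (\tr (S *m M)) <= c.
Hypothesis sides : lastside s != x.1.
Hypothesis c_ge1 : 1 <= c.
Hypothesis s_bounded : wbounded c s.
Hypothesis x_bounded : opb x.2 c.
Hypothesis b_ge0 : 0 <= b.
Hypothesis small_s : forall s1 s2, s = s1 ++ s2 -> s2 <> [::] ->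
  Ex Pr (fun w => nrm (\tr (Q *m wval (U w) s2)) ^+ 4) <= b * d%:R ^+ 2.
Hypothesis small_x :
  Ex Pr (fun w => nrm (\tr (Q *m wval (U w) [:: x])) ^+ 4) <= b * d%:R ^+ 2.

(** A constant that depends on the words only through their length, so that
    it serves all dimensions at once. *)
Definition cut_const : R :=
  128 * 16 * ((1 + 2 * c) ^+ (size s).+1) ^+ 4 * 8 ^+ (size s).+1 *
    ((size s).+1%:R * b) +
  8 * (3 * ((2 * (size s).+1)%:R * (c ^+ (size s).+1 * c ^+ (size s).+1))) ^+ 2.

Let smalltr4 M : R :=
  tailsum (fun u => nrm (\tr (Q *m wval M u)) ^+ 4) s +
    nrm (\tr (Q *m wval M [:: x])) ^+ 4.

Let smalltr_pow4 M : smalltr s x M ^+ 4 <= 8 ^+ (size s).+1 * smalltr4 M.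
Proof.
rewrite /smalltr /smalltr4 wval1 [8 ^+ _]exprS; apply: le_trans (pow4D _ _) _.
rewrite -mulrA ler_wpM2l// [leRHS]mulrDr; apply: lerD.
  by apply: tailsum_pow4 => v; exact: nrm_ge0.
by rewrite ler_peMl ?exprn_ge0 ?nrm_ge0// exprn_ege1// ler1n.
Qed.

Let brv_smalltr4 : brv (fun w => smalltr4 (U w)) /\
  Ex Pr (fun w => smalltr4 (U w)) <= (size s).+1%:R * (b * d%:R ^+ 2).
Proof.
have B0 : 0 <= b * d%:R ^+ 2 by rewrite mulr_ge0// exprn_ge0.
have [h1 h2] := Ex_tailsum B0 small_s.
have h3 := brv_tr_wval Q [:: x].
split; first exact: brvD h1 h3.
by rewrite /smalltr4 (ExD Pr h1 h3) -[(size s).+1]addn1 natrD mulrDl mul1r; apply: lerD.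
Qed.

(** In expectation the Schwinger-Dyson sum disappears from [sd_pointwise].
    The error terms have fourth moments of order d^2 and enter divided by
    d^3 after the Young inequality, while the dominant term carries the
    factor d: this leaves order d^-2. *)
Lemma cut_moment :
  Ex Pr (fun w => nrm (cutobs S s x Q (U w)) ^+ 4) * d%:R ^+ 2 <= cut_const.
Proof.
(* The dominant term carries d - 1, which is comparable to d as soon as d is
   at least 2. *)
pose delta : R := d.-1%:R.
have d0 : 0 < delta by rewrite ltr0n -subn1 subn_gt0.
have dN0 : delta != 0 by rewrite gt_eqF.
have dd : d%:R <= 2 * delta.
  rewrite -natrM ler_nat; move: d_gt1; case: d => // n n0.
  by rewrite mul2n -addnn -add1n leq_add2r.
rewrite /cut_const; set k1 := (1 + 2 * c) ^+ _; set k2 := 3 * _.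
pose sg : R := if x.1 then 1 else -1.
have [b4 e4] := brv_smalltr4.
have bZ := brv_cutobs S s x Q.
pose l1 := 64 * k1 ^+ 4 * 8 ^+ (size s).+1 / delta ^+ 3.
have l1_ge0 : 0 <= l1.
  by rewrite /l1 divr_ge0 ?exprn_ge0 ?(ltW d0)// !mulr_ge0 ?exprn_ge0//
    addr_ge0// mulr_ge0// (le_trans ler01 c_ge1).
have gS : brv (fun w => complex.Re (sdsum S s x (U w))).
  apply: (regular_brv U_haar (f := sdsum S s x)).
  rewrite /sdsum; under eq_fun do rewrite big_mkcond.
  apply: regular_sum => i; case: (i != 0%N :> nat); last exact: regular_cst.
  under eq_fun do rewrite big_mkcond.
  apply: regular_sum => j; case: (j != 0%N :> nat); last exact: regular_cst.
  exact: der_regular' (Der_sd S s x i j) _.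
have c2 : 0 <= 1 + 2 * c by rewrite addr_ge0// mulr_ge0// (le_trans ler01 c_ge1).
have E0 : Ex Pr (fun w => complex.Re (sdsum S s x (U w))) = 0.
  exact: (schwinger_dyson U_haar (Der_sd S s x)).
(* The two Young inequalities each cost a quarter of the dominant term. *)
have pw w : delta / 2 * nrm (cutobs S s x Q (U w)) ^+ 4 <=
    sg * complex.Re (sdsum S s x (U w)) + (l1 * smalltr4 (U w) + k2 ^+ 2 / delta).
  have := sd_pointwise d_gt0 S_opb S_tr sides c_ge1 s_bounded x_bounded
    (haar_in U_haar w).
  rewrite -/sg -/k1 -/k2 -/delta.
  have := young_cubic k1 (smalltr s x (U w)) d0 (nrm_ge0 (cutobs S s x Q (U w))).
  have := young_square k2 (nrm (cutobs S s x Q (U w))) d0.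
  have : 64 * k1 ^+ 4 * smalltr s x (U w) ^+ 4 / delta ^+ 3 <= l1 * smalltr4 (U w).
    have -> : l1 * smalltr4 (U w) = 64 * k1 ^+ 4 *
      (8 ^+ (size s).+1 * smalltr4 (U w)) / delta ^+ 3 by rewrite /l1; field; exact: dN0.
    rewrite ler_wpM2r ?invr_ge0 ?exprn_ge0 ?(ltW d0)//.
    have k14 : 0 <= 64 * k1 ^+ 4 by rewrite mulr_ge0// exprn_even_ge0.
    exact: (ler_wpM2l k14 (smalltr_pow4 _)).
  move: (sg * _) (l1 * _) (nrm _ ^+ 4) (k2 * _) (k1 * _ * _) (_ / delta ^+ 3) (k2 ^+ 2 / delta).
  move=> u v z p q r t; lra.
have hE : delta / 2 * Ex Pr (fun w => nrm (cutobs S s x Q (U w)) ^+ 4) <=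
    l1 * ((size s).+1%:R * (b * d%:R ^+ 2)) + k2 ^+ 2 / delta.
  have bs := brvM (brv_cst sg) gS; have b4' := brvM (brv_cst l1) b4.
  have bc := @brv_cst R _ T (k2 ^+ 2 / delta).
  rewrite -ExZ//; apply: le_trans (Ex_le _ _ _ pw) _.
  - exact: brvM (brv_cst _) bZ.
  - exact: brvD bs (brvD b4' bc).
  rewrite (ExD _ bs (brvD b4' bc)) (ExD _ b4' bc) (ExZ _ _ gS) E0 mulr0 add0r.
  by rewrite (ExZ _ _ b4) Ex_cst lerD2r ler_wpM2l.
move: hE; set E := Ex _ _ => hE.
have E_ge0 : 0 <= E by apply: Ex_ge0 => w; rewrite exprn_ge0 ?nrm_ge0.
have hE' : E <= 2 / delta * (l1 * ((size s).+1%:R * (b * d%:R ^+ 2)) + k2 ^+ 2 / delta).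
  have p : 0 <= 2 / delta by rewrite divr_ge0// ltW.
  apply: le_trans (ler_wpM2l p hE); rewrite le_eqVlt; apply/orP; left.
  by apply/eqP; field; exact: dN0.
have D2 : d%:R ^+ 2 <= (2 * delta) ^+ 2.
  by rewrite lerXn2r ?nnegrE// mulr_ge0// ltW.
have D4 : d%:R ^+ 2 * d%:R ^+ 2 <= (2 * delta) ^+ 4.
  by rewrite -exprD lerXn2r ?nnegrE// mulr_ge0// ltW.
apply: le_trans (ler_wpM2r _ hE') _; first by rewrite exprn_ge0.
have -> : 2 / delta * (l1 * ((size s).+1%:R * (b * d%:R ^+ 2)) + k2 ^+ 2 / delta) *
    d%:R ^+ 2 = 128 * k1 ^+ 4 * 8 ^+ (size s).+1 * ((size s).+1%:R * b) / delta ^+ 4 *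
      (d%:R ^+ 2 * d%:R ^+ 2) + 2 * k2 ^+ 2 / delta ^+ 2 * d%:R ^+ 2.
  by rewrite /l1; field; exact: dN0.
apply: lerD.
  apply: le_trans (ler_wpM2l _ D4) _.
    have k14 : 0 <= k1 ^+ 4 by rewrite !exprn_ge0.
    have sb : 0 <= (size s).+1%:R * b by rewrite mulr_ge0.
    have k8 : 0 <= 8 ^+ (size s).+1 :> R by rewrite exprn_ge0.
    apply: divr_ge0; last exact: (exprn_ge0 4 (ltW d0)).
    apply: mulr_ge0 sb; apply: mulr_ge0 k8; exact: mulr_ge0 k14.
  rewrite le_eqVlt; apply/orP; left; apply/eqP.
  by move: (k1 ^+ 4) (8 ^+ _) (_ * b) => u v z; field; exact: dN0.
apply: le_trans (ler_wpM2l _ D2) _.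
  by rewrite divr_ge0 ?exprn_ge0 ?(ltW d0)// mulr_ge0// sqr_ge0.
rewrite le_eqVlt; apply/orP; left; apply/eqP.
by move: (k2 ^+ 2) => u; field; exact: dN0.
Qed.

End CutMoment.

(** * Moments of traces of centered words *)

Section States.
Variables (R : realType) (d : nat).
Hypothesis d_gt0 : (0 < d)%N.
Local Notation C := (Cplx R).
Local Notation G := (@unitary_fix_eps1 R d).
Local Notation Q := (@Qmx R d).
Implicit Types (M : 'M[C]_d).

Definition i0 : 'I_d := Ordinal d_gt0.

Lemma eps1E : eps1 R d = delta_mx i0 ord0.
Proof. by apply/colP => i; rewrite !mxE eqxx andbT. Qed.

Lemma eps1_proj : eps1 R d *m (eps1 R d)^t* = delta_mx i0 i0.
Proof. by rewrite eps1E trmx_delta map_delta_mx mul_delta_mx. Qed.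

Lemma Q_complement : delta_mx i0 i0 + Q = 1%:M.
Proof.
have -> : 1%:M = \sum_(i : 'I_d) delta_mx i i :> 'M[C]_d.
  apply/matrixP => a b; rewrite summxE !mxE (bigD1 a)//= big1 => [|i ia].
    by rewrite !mxE eqxx addr0 /= eq_sym.
  by rewrite mxE eq_sym (negbTE ia).
rewrite [RHS](bigD1 i0)//=; congr (_ + _).
Qed.

Lemma tr_Q_sub M : \tr (Q *m M) = \tr M - M i0 i0.
Proof.
have -> : Q = 1%:M - delta_mx i0 i0 by rewrite -Q_complement addrC addKr.
by rewrite mulmxBl mul1mx raddfB /= tr_delta_mul.
Qed.

(** Inserting 1 = Q + (1 - Q) between two factors: the corner entry is
    multiplicative up to a cut term. *)
Lemma entry_split M N : (M *m N) i0 i0 =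
  M i0 i0 * N i0 i0 + \tr (delta_mx i0 i0 *m (M *m Q *m N)).
Proof.
rewrite tr_delta_mul -{1}[N]mul1mx -Q_complement mulmxDl mulmxDr mxE; congr (_ + _).
  rewrite mulmxA mxE (bigD1 i0)//= big1 => [|i ii0].
    rewrite addr0 mxE (bigD1 i0)//= big1 => [|i ii0].
      by rewrite !mxE !eqxx mulr1 addr0.
    by rewrite !mxE (negbTE ii0) mulr0.
  rewrite mxE big1 ?mul0r// => j _.
  by rewrite !mxE (negbTE ii0) andbF mulr0.
by rewrite mulmxA.
Qed.

Lemma tr_lval M x : G M -> \tr (lval M x) = \tr x.2.
Proof.
move=> [/unitarymxP Mu _]; rewrite /lval; case: x.1 => //.
by rewrite mxtrace_mulC mulmxA (mulmx1C Mu) mul1mx.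
Qed.

(** The unitary and its adjoint both fix the first basis vector. *)
Lemma entry_lval M x : G M -> lval M x i0 i0 = x.2 i0 i0.
Proof.
move=> [/unitarymxP Mu Me]; rewrite /lval; case: x.1 => //.
have e2 : (eps1 R d)^t* *m M = (eps1 R d)^t*.
  have : M^t* *m eps1 R d = eps1 R d.
    by rewrite -{1}Me mulmxA (mulmx1C Mu) mul1mx.
  by move=> /(congr1 (fun N => N^t*)); rewrite trmx_mul map_mxM /= trmxCK.
have ent (N : 'M[C]_d) : N i0 i0 = ((eps1 R d)^t* *m N *m eps1 R d) ord0 ord0.
  by rewrite eps1E trmx_delta map_delta_mx -rowE -colE !mxE.
rewrite [LHS]ent [RHS]ent !mulmxA e2 -!mulmxA.
suff -> : M^t* *m eps1 R d = eps1 R d by [].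
by rewrite -{1}Me mulmxA (mulmx1C Mu) mul1mx.
Qed.

Lemma opb_trace_state : opb (d%:R^-1%:M : 'M[C]_d) 1.
Proof.
apply: opbW (opb_scalar _ _); rewrite nrmV nrm_nat invf_le1 ?ltr0n//.
by rewrite ler1n.
Qed.

Lemma trace_state_le M c : opb M c -> nrm (\tr (d%:R^-1%:M *m M)) <= c.
Proof.
move=> Mc; rewrite mul_scalar_mx mxtraceZ nrmM nrmV nrm_nat mulrC.
rewrite ler_pdivrMr ?ltr0n//; apply: (le_trans (nrm_sum _ _ _)).
apply: (@le_trans _ _ (\sum_(i < d) c)).
  by apply: ler_sum => i _; exact: opb_entry.
by rewrite sumr_const card_ord mulr_natr.
Qed.

Lemma vector_state_le M c : opb M c -> nrm (\tr (delta_mx i0 i0 *m M)) <= c.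
Proof. by move=> Mc; rewrite tr_delta_mul; exact: opb_entry. Qed.

End States.

Definition alternating (R : realType) (d : nat) (s : seq (bool * 'M[Cplx R]_d)) :=
  sorted (fun x y => x.1 != y.1) s.

Lemma alternating_cat (R : realType) (d : nat) (s1 s2 : seq (bool * 'M[Cplx R]_d)) :
  alternating (s1 ++ s2) -> alternating s1 /\ alternating s2.
Proof.
by rewrite /alternating => h; have [/[dup] h1 h2] := cat_sorted2 h; split.
Qed.

Lemma alternating_rcons (R : realType) (d : nat) (s : seq (bool * 'M[Cplx R]_d)) x :
  s <> [::] -> alternating (rcons s x) -> lastside s != x.1.
Proof.
case: s => // y s _; rewrite /alternating /lastside /= rcons_path => /andP[_].
by [].
Qed.

Section Moments.
Context {R : realType} {dsp : measure_display} {T : measurableType dsp}.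
Variable Pr : probability T R.
Local Notation C := (Cplx R).

Definition centered_word (c : R) (d : nat) (s : seq (bool * 'M[C]_d)) : Prop :=
  [/\ alternating s, wbounded c s & forall x, x \in s -> \tr x.2 = 0].

Lemma centered_word_cat c d (s1 s2 : seq (bool * 'M[C]_d)) :
  centered_word c (s1 ++ s2) -> centered_word c s1 /\ centered_word c s2.
Proof.
move=> [/alternating_cat[a1 a2] b t]; split; split => //.
- by move=> x xs; apply: b; rewrite mem_cat xs.
- by move=> x xs; apply: t; rewrite mem_cat xs.
- by move=> x xs; apply: b; rewrite mem_cat xs orbT.
- by move=> x xs; apply: t; rewrite mem_cat xs orbT.
Qed.

(** The trace is not normalized: order d^2 for its fourth moment means order
    d^-2 for that of the normalized trace. *)
Definition trace_moment (c : R) (m : nat) (K : R) : Prop :=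
  forall d (U : T -> 'M[C]_d), (1 < d)%N ->
    haar_distributed Pr (@unitary_fix_eps1 R d) U ->
  forall s, centered_word c s -> s <> [::] -> (size s <= m)%N ->
    Ex Pr (fun w => nrm (\tr (wval (U w) s)) ^+ 4) <= K * d%:R ^+ 2.

Section Step.
Variables (c : R) (m : nat) (K : R).
Hypotheses (c_ge1 : 1 <= c) (K_ge0 : 0 <= K) (tm : trace_moment c m K).
Variables (d : nat) (U : T -> 'M[C]_d).
Hypothesis d_gt1 : (1 < d)%N.
Hypothesis U_haar : haar_distributed Pr (@unitary_fix_eps1 R d) U.
Local Notation Q := (@Qmx R d).

Let d_gt0 : (0 < d)%N. Proof. exact: ltnW. Qed.

Definition small_const : R := 8 * (K + (c ^+ m) ^+ 4).

(** A word and its compression by Q differ in trace by one bounded entry. *)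
Lemma small_moment s : centered_word c s -> s <> [::] -> (size s <= m)%N ->
  Ex Pr (fun w => nrm (\tr (Q *m wval (U w) s)) ^+ 4) <= small_const * d%:R ^+ 2.
Proof.
move=> cs s0 sm; have [_ bs _] := cs.
have hb : brv (fun w => nrm (\tr (wval (U w) s)) ^+ 4).
  have := brv_tr_wval U_haar 1%:M s.
  by under eq_fun do rewrite mul1mx.
have b8 := brvM (@brv_cst R _ T 8) (brvD hb (@brv_cst R _ T ((c ^+ m) ^+ 4))).
have pw w : nrm (\tr (Q *m wval (U w) s)) ^+ 4 <=
    8 * (nrm (\tr (wval (U w) s)) ^+ 4 + (c ^+ m) ^+ 4).
  apply: le_trans (pow4D _ _).
  have c0 : 0 <= c by exact: le_trans c_ge1.
  rewrite lerXn2r ?nnegrE ?nrm_ge0 ?addr_ge0 ?nrm_ge0 ?exprn_ge0//.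
  rewrite (tr_Q_sub d_gt0) (le_trans (nrmB _ _))// lerD2l.
  apply: le_trans (opb_entry _ _ (opb_wval (haar_in U_haar w) bs)) _.
  by rewrite ler_weXn2l.
apply: le_trans (Ex_le Pr (brv_tr_wval U_haar Q s) b8 pw) _.
have bc := @brv_cst R _ T ((c ^+ m) ^+ 4).
rewrite (ExZ _ _ (brvD hb bc)) (ExD _ hb bc) Ex_cst.
rewrite /small_const -mulrA ler_wpM2l// mulrDl; apply: lerD; first exact: tm.
by rewrite ler_peMr ?exprn_ge0 ?(le_trans ler01 c_ge1)// exprn_ege1// ler1n.
Qed.

(** The traces that enter as errors are those of proper subwords, to which
    the bound for lengths at most m applies. *)
Lemma cut_moment_word S s x : opb S 1 ->
  (forall M c', opb M c' -> nrm (\tr (S *m M)) <= c') ->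
  centered_word c (rcons s x) -> s <> [::] -> (size s <= m)%N ->
  Ex Pr (fun w => nrm (cutobs S s x Q (U w)) ^+ 4) * d%:R ^+ 2 <=
    cut_const s c small_const.
Proof.
move=> S1 S2 cs s0 sm; have [alt _ _] := cs.
have sides := alternating_rcons s0 alt.
have [cs1 cs2] : centered_word c s /\ centered_word c [:: x].
  by apply: centered_word_cat; rewrite cats1.
have [_ bs _] := cs1; have [_ bx _] := cs2.
apply: (cut_moment d_gt1 U_haar S1 S2 sides c_ge1 bs).
- by apply: bx; rewrite inE.
- by rewrite mulr_ge0// addr_ge0// exprn_even_ge0.
- move=> s1 s2 es s20; apply: small_moment => //.
    by move: cs1; rewrite es => /centered_word_cat[].
  by apply: leq_trans sm; rewrite es size_cat leq_addl.
- apply: small_moment => //; apply: leq_trans sm.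
  by case: s s0 {sides cs alt cs1 bs}.
Qed.

End Step.

(** Induction on the length. For one letter the trace is exactly 0.
    Otherwise Tr (W L) is d times the cut observable for the normalized
    trace, plus one bounded entry of L W; the constant is uniform in the
    dimension and in the letters. *)
Lemma trace_moment_ex c m : 1 <= c -> exists2 K, 0 <= K & trace_moment c m K.
Proof.
move=> c1; elim: m => [|m [K K0 tm]].
  by exists 0 => // d U _ _ [].
have c0 : 0 <= c by exact: le_trans c1.
(* The constant depends on the word through its length only, so a dummy word
   of length m serves to name it. *)
pose z := cut_const (nseq m (false, 0 : 'M[C]_0)) c (small_const c m K).
have z0 : 0 <= z.
  rewrite /z /cut_const; apply: addr_ge0; last by rewrite mulr_ge0// sqr_ge0.
  have k2 : 0 <= 1 + 2 * c by rewrite addr_ge0// mulr_ge0.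
  have sc : 0 <= small_const c m K by rewrite mulr_ge0// addr_ge0// exprn_even_ge0.
  apply: mulr_ge0; last by rewrite mulr_ge0.
  apply: mulr_ge0; last by rewrite exprn_ge0.
  by apply: mulr_ge0; rewrite ?exprn_even_ge0// mulr_ge0.
exists (K + 8 * (z + (c ^+ m.+1) ^+ 4)).
  by rewrite addr_ge0// mulr_ge0// addr_ge0// exprn_even_ge0.
move=> d U d1 U_haar s cs s0 sm.
have d0 : (0 < d)%N by exact: ltnW.
have [sm'|] := leqP (size s) m.
  apply: le_trans (tm d U d1 U_haar s cs s0 sm') _.
  by rewrite ler_wpM2r ?exprn_ge0// lerDl mulr_ge0// addr_ge0// exprn_even_ge0.
move=> ms; have {}sm : size s = m.+1 by apply/eqP; rewrite eqn_leq sm ms.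
case/lastP: s cs s0 sm {ms} => // s x cs _; rewrite size_rcons => -[sm].
have [_ bs ts] := cs.
have [s0|s0] := eqVneq s [::].
  have -> : Ex Pr (fun w => nrm (\tr (wval (U w) (rcons s x))) ^+ 4) = 0.
    rewrite -(Ex_cst Pr 0); congr Ex; apply/funext => w.
    rewrite s0 wval1 (tr_lval x (haar_in U_haar w)) ts ?nrm0 ?expr0n//.
    by rewrite mem_rcons inE eqxx.
  by rewrite mulr_ge0 ?exprn_ge0// addr_ge0// mulr_ge0// addr_ge0// exprn_even_ge0.
move/eqP: s0 => s0.
have hz := cut_moment_word c1 K0 tm d1 U_haar (opb_trace_state R d0)
  (trace_state_le d0) cs s0 (eq_leq sm).
have {}hz : Ex Pr (fun w => nrm (cutobs d%:R^-1%:M s x (@Qmx R d) (U w)) ^+ 4) *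
    d%:R ^+ 2 <= z.
  by apply: le_trans hz _; rewrite /z /cut_const size_nseq sm.
have bZ := brv_cutobs U_haar (d%:R^-1%:M) s x (@Qmx R d).
have bc := @brv_cst R _ T ((c ^+ m.+1) ^+ 4).
have bd := brvM (@brv_cst R _ T (d%:R ^+ 4)) bZ.
have b8 := brvM (@brv_cst R _ T 8) (brvD bd bc).
have bT : brv (fun w => nrm (\tr (wval (U w) (rcons s x))) ^+ 4).
  have := brv_tr_wval U_haar 1%:M (rcons s x).
  by under eq_fun do rewrite mul1mx.
have dN0 : d%:R != 0 :> C by rewrite pnatr_eq0 -lt0n.
have pw w : nrm (\tr (wval (U w) (rcons s x))) ^+ 4 <=
    8 * (d%:R ^+ 4 * nrm (cutobs d%:R^-1%:M s x (@Qmx R d) (U w)) ^+ 4 +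
         (c ^+ m.+1) ^+ 4).
  rewrite -exprMn; apply: le_trans (pow4D _ _).
  rewrite lerXn2r ?nnegrE ?nrm_ge0 ?addr_ge0 ?mulr_ge0 ?nrm_ge0 ?exprn_ge0//.
  have GU := haar_in U_haar w.
  have bx : opb x.2 c by apply: bs; rewrite mem_rcons inE eqxx.
  have bs' : wbounded c s by move=> y ys; apply: bs; rewrite mem_rcons inE ys orbT.
  have -> : \tr (wval (U w) (rcons s x)) =
      d%:R * cutobs d%:R^-1%:M s x (@Qmx R d) (U w) +
      (lval (U w) x *m wval (U w) s) (i0 d0) (i0 d0).
    rewrite wval_rcons -{1}[lval _ _]mul1mx -(Q_complement R d0).
    rewrite mulmxDl mulmxDr mxtraceD addrC /cutobs mul_scalar_mx mxtraceZ.
    rewrite mulrA mulfV// mul1r mulmxA; congr (_ + _).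
    by rewrite mxtrace_mulC -mulmxA tr_delta_mul.
  apply: (le_trans (nrmD _ _)); rewrite nrmM nrm_nat lerD2l exprS -sm.
  exact: opb_entry (opb_mul (opb_lval GU bx) (opb_wval GU bs')).
apply: le_trans (Ex_le Pr bT b8 pw) _.
rewrite (ExZ _ _ (brvD bd bc)) (ExD _ bd bc) Ex_cst (ExZ _ _ bZ).
rewrite [leRHS]mulrDl ler_wpDl ?mulr_ge0 ?exprn_ge0// -[leRHS]mulrA ler_wpM2l// [leRHS]mulrDl.
apply: lerD.
  have -> (e : R) : d%:R ^+ 4 * e = e * d%:R ^+ 2 * d%:R ^+ 2 by ring.
  by rewrite ler_wpM2r ?exprn_ge0.
by rewrite ler_peMr ?exprn_ge0// exprn_ege1// ler1n.
Qed.

End Moments.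

(** * Moments of the corner entry of centered words *)

Section VectorMoments.
Context {R : realType} {dsp : measure_display} {T : measurableType dsp}.
Variable Pr : probability T R.
Local Notation C := (Cplx R).

Definition vecdiff d (d0 : (0 < d)%N) (s : seq (bool * 'M[C]_d)) (M : 'M[C]_d) : C :=
  wval M s (i0 d0) (i0 d0) - \prod_(x <- s) x.2 (i0 d0) (i0 d0).

Lemma regular_vecdiff d (d0 : (0 < d)%N) s : regular (@vecdiff d d0 s).
Proof. exact: (regularD (der_regular (MDer_wval s _ _)) (regular_cst _)). Qed.

(** Induction on the length by [entry_split]: the corner entry of W L is
    that of W times that of L plus the cut observable for the vector state. *)
Lemma vector_moment_ex (c : R) m : 1 <= c -> exists2 K : R, 0 <= K &
  forall d (d0 : (0 < d)%N) (U : T -> 'M[C]_d), (1 < d)%N ->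
    haar_distributed Pr (@unitary_fix_eps1 R d) U ->
  forall s, centered_word c s -> (size s <= m)%N ->
    Ex Pr (fun w => nrm (vecdiff d0 s (U w)) ^+ 4) * d%:R ^+ 2 <= K.
Proof.
move=> c1; have c0 : 0 <= c by exact: le_trans c1.
have nil0 d (d0 : (0 < d)%N) (U : T -> 'M[C]_d) :
    Ex Pr (fun w => nrm (vecdiff d0 [::] (U w)) ^+ 4) * d%:R ^+ 2 = 0.
  rewrite (_ : (fun _ => _) = fun=> 0) ?Ex_cst ?mul0r//; apply/funext => w.
  by rewrite /vecdiff /= mxE eqxx big_nil subrr nrm0 expr0n.
elim: m => [|m [K K0 IH]].
  exists 0 => // d d0 U _ _ s _; rewrite leqn0 size_eq0 => /eqP ->.
  by rewrite nil0.
have [Kt Kt0 tm] := trace_moment_ex Pr m c1.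
pose z := cut_const (nseq m (false, 0 : 'M[C]_0)) c (small_const c m Kt).
have c4 : 0 <= c ^+ 4 by exact: exprn_ge0.
exists (K + 8 * (c ^+ 4 * K + `|z|)).
  by rewrite addr_ge0// mulr_ge0// addr_ge0// mulr_ge0.
move=> d d0 U d1 U_haar s cs sm.
have KK : K <= K + 8 * (c ^+ 4 * K + `|z|).
  by rewrite lerDl mulr_ge0// addr_ge0// mulr_ge0.
have [sm'|ms] := leqP (size s) m.
  exact: le_trans (IH d d0 U d1 U_haar s cs sm') _.
have {}sm : size s = m.+1 by apply/eqP; rewrite eqn_leq sm ms.
case/lastP: s cs sm {ms} => // s x cs; rewrite size_rcons => -[sm].
have [cs1 cs2] : centered_word c s /\ centered_word c [:: x].
  by apply: centered_word_cat; rewrite cats1.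
have [_ bs _] := cs1; have [_ bx _] := cs2.
have {}bx : opb x.2 c by apply: bx; rewrite inE.
have [s0|/eqP s0] := eqVneq s [::].
  rewrite s0 (_ : Ex _ _ = 0) ?mul0r ?(le_trans K0)//.
  rewrite -(Ex_cst Pr 0); congr Ex; apply/funext => w.
  rewrite /vecdiff big_seq1 wval1 (entry_lval d0 x (haar_in U_haar w)) subrr.
  by rewrite nrm0 expr0n.
have hz := cut_moment_word c1 Kt0 tm d1 U_haar (opb_delta R (i0 d0) (i0 d0))
  (vector_state_le d0) cs s0 (eq_leq sm).
have {}hz : Ex Pr (fun w => nrm (cutobs (delta_mx (i0 d0) (i0 d0)) s x (@Qmx R d)
    (U w)) ^+ 4) * d%:R ^+ 2 <= z.
  by apply: le_trans hz _; rewrite /z /cut_const size_nseq sm.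
have hs := IH d d0 U d1 U_haar s cs1 (eq_leq sm).
have bZ := brv_cutobs U_haar (delta_mx (i0 d0) (i0 d0)) s x (@Qmx R d).
have bY := regular_brv_pow4 U_haar (regular_vecdiff d0 s).
have bc := brvM (@brv_cst R _ T (c ^+ 4)) bY.
have b8 := brvM (@brv_cst R _ T 8) (brvD bc bZ).
have pw w : nrm (vecdiff d0 (rcons s x) (U w)) ^+ 4 <=
    8 * (c ^+ 4 * nrm (vecdiff d0 s (U w)) ^+ 4 +
      nrm (cutobs (delta_mx (i0 d0) (i0 d0)) s x (@Qmx R d) (U w)) ^+ 4).
  rewrite -exprMn; apply: le_trans (pow4D _ _).
  rewrite lerXn2r ?nnegrE ?nrm_ge0 ?addr_ge0 ?mulr_ge0 ?nrm_ge0//.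
  have -> : vecdiff d0 (rcons s x) (U w) = x.2 (i0 d0) (i0 d0) * vecdiff d0 s (U w) +
      cutobs (delta_mx (i0 d0) (i0 d0)) s x (@Qmx R d) (U w).
    rewrite /vecdiff /cutobs wval_rcons (entry_split d0).
    rewrite (entry_lval d0 x (haar_in U_haar w)) -cats1 big_cat big_seq1 /=; ring.
  apply: (le_trans (nrmD _ _)); rewrite nrmM lerD2r ler_wpM2r ?nrm_ge0//.
  exact: opb_entry.
have d20 : 0 <= d%:R ^+ 2 :> R by rewrite exprn_ge0.
have bY' := regular_brv_pow4 U_haar (regular_vecdiff d0 (rcons s x)).
apply: le_trans (ler_wpM2r d20 (Ex_le Pr bY' b8 pw)) _.
rewrite (ExZ _ _ (brvD bc bZ)) (ExD _ bc bZ) (ExZ _ _ bY).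
apply: (@le_trans _ _ (8 * (c ^+ 4 * K + `|z|))); last by rewrite lerDr.
rewrite -mulrA ler_wpM2l// [leLHS]mulrDl; apply: lerD; last exact: le_trans hz (ler_norm _).
by rewrite -mulrA ler_wpM2l.
Qed.

End VectorMoments.

(** * Almost sure convergence to zero *)

Section NullSequences.
Variable R : realType.
Local Notation C := (Cplx R).
Implicit Types u v : nat -> C.

Definition null u : Prop := (fun n => nrm (u n)) @ \oo --> (0 : R).

Lemma null_le u (v : nat -> R) : (\forall n \near \oo, nrm (u n) <= v n) ->
  v @ \oo --> (0 : R) -> null u.
Proof.
move=> uv v0; apply: (@squeeze_cvgr _ _ _ _ (fun=> 0) v) => //; last exact: cvg_cst.
by apply: filterS uv => n ->; rewrite nrm_ge0.
Qed.

Lemma null0 : null (fun=> 0).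
Proof. by rewrite /null; under eq_fun do rewrite nrm0; exact: cvg_cst. Qed.

Lemma nullD u v : null u -> null v -> null (fun n => u n + v n).
Proof.
move=> u0 v0; apply: (@null_le _ (fun n => nrm (u n) + nrm (v n))).
  by apply: nearW => n; exact: nrmD.
by rewrite -[X in _ --> X]addr0; exact: cvgD.
Qed.

(** Neighbourhoods in a space of matrices are products of neighbourhoods of
    the entries. *)
Lemma null_matrix m n (F : nat -> 'M[C]_(m, n)) :
  (forall i j, null (fun k => F k i j)) -> F @ \oo --> (0 : 'M[C]_(m, n)).
Proof.
move=> h A [P P0 sPA].
have : \forall k \near \oo, forall i j, P i j (F k i j).
  apply: (@filter_forall nat 'I_m (fun i k => forall j, P i j (F k i j)) \oo _) => i.
  apply: (@filter_forall nat 'I_n (fun j k => P i j (F k i j)) \oo _) => j.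
  have := P0 i j; rewrite mxE => /nbhs_ballP[e /= e0 sP].
  have e0' : 0 < complex.Re e by move: e0; rewrite ltcE => /andP[].
  have eE : e = (complex.Re e)%:C%C.
    by move: e0; rewrite ltcE => /andP[/eqP ei _]; case: e ei {sP e0'} => a b /= ->.
  have /cvgrPdist_lt /(_ _ e0') := h i j.
  apply: filterS => k; rewrite sub0r normrN ger0_norm ?nrm_ge0// => hk.
  apply: sP; suff : `|0 - F k i j| < e by [].
  by rewrite sub0r normrN normE eE ltcR.
by apply: filterS => k hk; exact: sPA.
Qed.

End NullSequences.

Section AlmostSureNull.
Context {R : realType} {dsp : measure_display} {T : measurableType dsp}.
Variable Pr : probability T R.
Local Notation C := (Cplx R).

(** An injective sequence of positive integers uses each term of the
    convergent series of inverse squares at most once; the bound 2 comes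
    from telescoping 1 / n^2 <= 1 / (n - 1) - 1 / n. *)
Lemma sum_inv_sqr_injective (d : nat -> nat) (n : nat) :
  (forall k, (0 < d k)%N) -> injective d ->
  \sum_(0 <= k < n) ((d k)%:R ^- 2 : R) <= 2.
Proof.
move=> d0 dI; pose h (k : nat) : R := k%:R ^- 2.
have h0 k : 0 <= h k by rewrite invr_ge0 exprn_ge0.
pose N := (\max_(k < n) d k)%N.
have -> : \sum_(0 <= k < n) ((d k)%:R ^- 2 : R) =
    \sum_(j <- map d (index_iota 0 n)) h j by rewrite big_map.
have sub : {subset map d (index_iota 0 n) <= index_iota 1 N.+1}.
  move=> j /mapP[k]; rewrite !mem_index_iota /= => kn ->.
  by rewrite d0 ltnS andTb /N (bigD1 (Ordinal kn))//= leq_maxl.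
apply: (@le_trans _ _ (\sum_(j <- index_iota 1 N.+1) h j)).
  rewrite (perm_big [seq j <- index_iota 1 N.+1 | j \in map d (index_iota 0 n)]).
    rewrite big_filter big_mkcond /=; apply: ler_sum => j _.
    by case: ifP.
  apply: uniq_perm; last 2 first.
  - exact/filter_uniq/iota_uniq.
  - move=> j; rewrite mem_filter /=.
    by apply/idP/andP => [jd|[]//]; split => //; exact: sub.
  by rewrite map_inj_uniq// iota_uniq.
suff : \sum_(1 <= j < N.+1) h j <= 2 - 2 / N.+1%:R.
  by move/le_trans; apply; rewrite gerBl divr_ge0.
elim: N {sub} => [|N IH]; first by rewrite big_geq// divr1 subrr.
rewrite big_nat_recr//=; apply: le_trans (lerD IH (lexx _)) _.
have x0 : 0 < N.+1%:R :> R by rewrite ltr0n.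
have x1 : 0 < N.+2%:R :> R by rewrite ltr0n.
rewrite -subr_ge0 /h; have -> : N.+2%:R = N.+1%:R + 1 :> R by rewrite -natr1.
have -> : 2 - 2 / (N.+1%:R + 1) - (2 - 2 / N.+1%:R + N.+1%:R ^- 2) =
  (N.+1%:R - 1) / (N.+1%:R ^+ 2 * (N.+1%:R + 1)) :> R.
  have x2 : 0 < N.+1%:R + 1 :> R by rewrite natr1.
  by field; rewrite !gt_eqF.
by rewrite divr_ge0 ?subr_ge0 ?ler1n// mulr_ge0// ?sqr_ge0// addr_ge0.
Qed.

(** The expected sum of the X n is finite by monotone convergence, so the
    sum is almost surely finite and its terms tend to 0. *)
Lemma ae_cvg0_of_moments (X : nat -> T -> R) (d : nat -> nat) (K : R) :
  (forall k, (0 < d k)%N) -> injective d ->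
  (forall n, brv (X n)) -> (forall n w, 0 <= X n w) ->
  (forall n, Ex Pr (X n) * (d n)%:R ^+ 2 <= K) ->
  {ae Pr, forall w, (fun n => X n w) @ \oo --> (0 : R)}.
Proof.
move=> d0 dI bX X0 hX.
have K0 : 0 <= K.
  by apply: le_trans (hX 0%N); rewrite mulr_ge0 ?Ex_ge0// exprn_ge0.
pose Y w : \bar R := (\sum_(n <oo) (X n w)%:E)%E.
have mXE n : measurable_fun setT (fun w => (X n w)%:E).
  by apply/measurable_EFinP; case: (bX n).
have intX n : (\int[Pr]_w (X n w)%:E)%E = (Ex Pr (X n))%:E.
  rewrite /Ex /Rintegral fineK//; apply: integrable_fin_num => //.
  exact: (brv_integrable Pr (bX n)).
have iY : Pr.-integrable setT Y.
  apply/integrableP; split.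
    by apply: ge0_emeasurable_sum => // n w _; rewrite lee_fin.
  rewrite (eq_integral Y) => [|w _]; last first.
    by rewrite gee0_abs// nneseries_ge0// => n _ _; rewrite lee_fin.
  rewrite integral_nneseries// => [|n w _]; last by rewrite lee_fin.
  apply: (@le_lt_trans _ _ (K * 2)%:E); last by rewrite ltry.
  apply: lime_le; first by apply: is_cvg_nneseries => n _ _; rewrite intX lee_fin Ex_ge0.
  apply: nearW => n; rewrite (eq_bigr (fun k => (Ex Pr (X k))%:E)) => [|k _]; last exact: intX.
  rewrite sumEFin lee_fin.
  apply: (@le_trans _ _ (\sum_(0 <= k < n) K * (d k)%:R ^- 2)).
    apply: ler_sum => k _; rewrite ler_pdivlMr ?hX// exprn_gt0// ltr0n; exact: d0.
  by rewrite -mulr_sumr ler_wpM2l// sum_inv_sqr_injective.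
have := integrable_ae measurableT iY.
apply: filterS => w /(_ I) Yfin.
pose u n := X n w.
apply: cvg_series_cvg_0; apply: nondecreasing_is_cvgn.
  by apply/nondecreasing_seqP => n; rewrite /series /= big_nat_recr//= lerDl.
exists (fine (Y w)) => _ [n _ <-]; rewrite -lee_fin fineK// /series /= -sumEFin.
by apply: nneseries_lim_ge => k _ _; rewrite lee_fin.
Qed.

Definition asnull (f : nat -> T -> C) : Prop :=
  {ae Pr, forall w, null (fun n => f n w)}.

(** A fourth moment of order d^-2 is summable along an injective sequence of
    dimensions. The finitely many n with d n at most 1 do not affect the
    limit. *)
Lemma asnull_moments (f : nat -> T -> C) (d : nat -> nat) (K : R) :
  (forall k, (0 < d k)%N) -> injective d -> d @ \oo --> \oo ->
  (forall n, brv (fun w => nrm (f n w) ^+ 4)) ->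
  (forall n, (1 < d n)%N -> Ex Pr (fun w => nrm (f n w) ^+ 4) * (d n)%:R ^+ 2 <= K) ->
  asnull f.
Proof.
move=> d0 dI doo bf hf.
(* The moment bound is only known in dimension at least 2. *)
pose X n w := if (1 < d n)%N then nrm (f n w) ^+ 4 else 0.
have ev : \forall n \near \oo, (1 < d n)%N.
  exact: (doo _ (nbhs_infty_gt 1%N)).
have hX : {ae Pr, forall w, (fun n => X n w) @ \oo --> (0 : R)}.
  apply: (@ae_cvg0_of_moments X d `|K|) => //.
  - by move=> n; rewrite /X; case: (1 < d n)%N => //; exact: brv_cst.
  - by move=> n w; rewrite /X; case: (1 < d n)%N => //; rewrite exprn_ge0// nrm_ge0.
  - move=> n; rewrite /X; have := hf n; case: (1 < d n)%N => [hn|_].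
      exact: le_trans (hn isT) (ler_norm _).
    by rewrite Ex_cst mul0r.
apply: filterS hX => w hw; apply/cvgrPdist_lt => e e0.
have /cvgrPdist_lt /(_ (e ^+ 4) (exprn_gt0 _ e0)) hn := hw.
near=> n.
have dn : (1 < d n)%N by near: n.
have : `|0 - X n w| < e ^+ 4 by near: n.
rewrite !sub0r !normrN /X dn !ger0_norm ?nrm_ge0 ?exprn_ge0 ?nrm_ge0//.
by rewrite ltr_pXn2r// ?nnegrE ?nrm_ge0// ltW.
Unshelve. all: by end_near.
Qed.

Lemma asnullD f g : asnull f -> asnull g -> asnull (fun n w => f n w + g n w).
Proof.
by move=> hf hg; apply: filterS2 hf hg => w fw gw; exact: nullD.
Qed.

Lemma asnull_ext f g : (forall n w, f n w = g n w) -> asnull f -> asnull g.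
Proof.
move=> fg hf; apply: filterS hf => w.
by under [X in _ -> null X]eq_fun do rewrite -fg.
Qed.

Lemma asnull0 : asnull (fun _ _ => 0).
Proof. by apply: aeW => w; exact: null0. Qed.

Lemma asnull_sum (I : Type) (r : seq I) (f : I -> nat -> T -> C) :
  (forall i, asnull (f i)) -> asnull (fun n w => \sum_(i <- r) f i n w).
Proof.
move=> hf; elim: r => [|i r IH].
  by apply: filterS asnull0 => w; under [X in _ -> null X]eq_fun do rewrite big_nil.
apply: filterS (asnullD (hf i) IH) => w.
by under [X in _ -> null X]eq_fun do rewrite big_cons.
Qed.

End AlmostSureNull.

(** * Block matrices *)

Section BlockAlgebra.
Variables (R : realType) (p d : nat).
Local Notation C := (Cplx R).
Local Notation N := (blocksize p d).
Implicit Types (M : 'M[C]_N) (i j : 'I_p).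

Lemma block_mul M M' i j :
  block (M *m M') i j = \sum_k block M i k *m block M' k j.
Proof.
rewrite /block -{1}[M](@submxblockK C p p (fun=> d) (fun=> d)).
rewrite -{1}[M'](@submxblockK C p p (fun=> d) (fun=> d)).
by rewrite mul_mxblock mxblockK.
Qed.

Lemma block_ampl (m : 'M[C]_p) i j : block (ampl d m) i j = (m i j)%:M.
Proof. by rewrite /block /ampl mxblockK. Qed.

Lemma block1 i j : block (1 : 'M[C]_N) i j = (i == j)%:R%:M.
Proof. by rewrite -(rmorph1 (@ampl R p d)) block_ampl mxE. Qed.

Lemma blockD M M' i j : block (M + M') i j = block M i j + block M' i j.
Proof. by rewrite /block submxblockD. Qed.

Lemma block_conj (U : 'M[C]_d) M i j :
  block (conj_blocks U M) i j = U *m block M i j *m U^t*.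
Proof.
rewrite /conj_blocks /block -{1}[M](@submxblockK C p p (fun=> d) (fun=> d)).
by rewrite mul_mxdiag_mxblock mul_mxblock_mxdiag mxblockK.
Qed.

Lemma block_inj M M' : (forall i j, block M i j = block M' i j) -> M = M'.
Proof.
move=> h; rewrite -[M](@submxblockK C p p (fun=> d) (fun=> d)).
rewrite -[M'](@submxblockK C p p (fun=> d) (fun=> d)).
by apply: eq_mxblock => i j; exact: h.
Qed.

(** The isometric inclusion of the k-th summand of the decomposed space. *)
Definition block_embed k : 'M[C]_(N, d) := \matrix_(r, b) (r == tagnat.Rank k b)%:R.

Lemma block_embed_orth k l :
  (block_embed k)^t* *m block_embed l = ((k == l)%:R)%:M.
Proof.
apply/matrixP => a b; rewrite !mxE (bigD1 (tagnat.Rank k a))//= [X in _ + X]big1 => [|r ra].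
  rewrite !mxE eqxx conjC1 mul1r addr0 -val_eqE tagnat.eq_Rank.
  by case: (k == l); rewrite ?mul0rn// val_eqE.
by rewrite !mxE (negbTE ra) conjC0 mul0r.
Qed.

Lemma opb_block_embed k : opb (block_embed k) 1.
Proof. by apply: opb_isometry; rewrite block_embed_orth eqxx. Qed.

Lemma block_compress M i j : block M i j = (block_embed i)^t* *m M *m block_embed j.
Proof.
apply/matrixP => a b; rewrite !mxE (bigD1 (tagnat.Rank j b))//= [X in _ + X]big1 => [|r rb].
  rewrite !mxE eqxx mulr1 addr0 (bigD1 (tagnat.Rank i a))//= [X in _ + X]big1 => [|r ra].
    by rewrite !mxE eqxx conjC1 mul1r addr0.
  by rewrite !mxE (negbTE ra) conjC0 mul0r.
by rewrite !mxE (negbTE rb) mulr0.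
Qed.

Lemma opb_block M i j c : opb M c -> opb (block M i j) c.
Proof.
move=> Mc; rewrite block_compress.
have := opb_mul (opb_mul (opb_adj (opb_block_embed i)) Mc) (opb_block_embed j).
by rewrite mul1r mulr1.
Qed.

(** Writing M as the sum of its blocks placed by the inclusions; the
    constant does not depend on the block size. *)
Lemma opb_of_blocks M c : (forall i j, opb (block M i j) c) ->
  opb M (\sum_(i < p) \sum_(j < p) c).
Proof.
move=> h.
have -> : M = \sum_i \sum_j block_embed i *m block M i j *m (block_embed j)^t*.
  apply: block_inj => k l; rewrite [RHS]block_compress mulmx_sumr mulmx_suml.
  rewrite (bigD1 k)//= [X in _ + X]big1 => [|i ik]; last first.
    rewrite mulmx_sumr mulmx_suml big1// => j _.
    by rewrite !mulmxA block_embed_orth eq_sym (negbTE ik) raddf0 !mul0mx.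
  rewrite addr0 mulmx_sumr mulmx_suml (bigD1 l)//= [X in _ + X]big1 => [|j jl].
    rewrite addr0 !mulmxA block_embed_orth eqxx mul1mx -mulmxA.
    by rewrite block_embed_orth eqxx mulmx1.
  by rewrite -!mulmxA block_embed_orth (negbTE jl) raddf0 !mulmx0.
apply: opb_sum => i _; apply: opb_sum => j _.
have := opb_mul (opb_mul (opb_block_embed i) (h i j)) (opb_adj (opb_block_embed j)).
by rewrite mul1r mulr1.
Qed.

Lemma opb_ampl (a : 'M[C]_p) c : (forall i j, nrm (a i j) <= c) ->
  opb (ampl d a) (\sum_(i < p) \sum_(j < p) c).
Proof.
move=> h; apply: opb_of_blocks => i j; rewrite block_ampl.
exact: opbW (h i j) (opb_scalar _ _).
Qed.

End BlockAlgebra.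

(** * Alternating centered products of block matrices *)

(** A proposition-valued analogue of the boolean all. *)
Fixpoint seqall (A : Type) (P : A -> Prop) (s : seq A) : Prop :=
  if s is x :: s' then P x /\ seqall P s' else True.

Lemma seqall_cat (A : Type) (P : A -> Prop) (s1 s2 : seq A) :
  seqall P (s1 ++ s2) <-> seqall P s1 /\ seqall P s2.
Proof. by elim: s1 => [|x s IH] /=; tauto. Qed.

Definition alt (bs : seq bool) : bool := sorted (fun a b => a != b) bs.

Section AsymptoticWords.
Context {R : realType} {dsp : measure_display} {T : measurableType dsp}.
Variable Pr : probability T R.
Local Notation C := (Cplx R).
Variable d : nat -> nat.
Hypotheses (d_gt0 : forall n, (0 < d n)%N) (d_inj : injective d) (d_oo : d @ \oo --> \oo).
Variable U : forall n, T -> 'M[C]_(d n).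
Hypothesis U_haar : forall n, haar_distributed Pr (@unitary_fix_eps1 R (d n)) (U n).

Definition mxseq : Type := forall n, 'M[C]_(d n).
Implicit Types (s : seq (bool * mxseq)).

Definition word_at n s : seq (bool * 'M[C]_(d n)) := [seq (x.1, x.2 n) | x <- s].

Definition centered_seq (x : bool * mxseq) : Prop :=
  (exists c : R, forall n, opb (x.2 n) c) /\ forall n, \tr (x.2 n) = 0.

Lemma centered_word_at s : seqall centered_seq s -> alt (map fst s) ->
  exists2 c : R, 1 <= c & forall n, centered_word c (word_at n s).
Proof.
move=> hs alts.
have [c c1 hc] : exists2 c : R, 1 <= c &
    forall n, wbounded c (word_at n s) /\ forall x, x \in word_at n s -> \tr x.2 = 0.
  elim: s hs {alts} => [_|x s IH /= [[[c hc] tx] /IH[c' c'1 hc']]].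
    by exists 1.
  exists (c' + `|c|); first by rewrite (le_trans c'1)// lerDl.
  move=> n; have [h1 h2] := hc' n; split => y; rewrite inE => /orP[/eqP ->|ys].
  - apply: opbW (hc n); rewrite (le_trans (ler_norm _))// lerDr.
    exact: le_trans c'1.
  - by apply: opbW (h1 y ys); rewrite lerDl.
  - exact: tx.
  - exact: h2.
exists c => // n; have [h1 h2] := hc n; split => //.
by move: alts; rewrite /alternating /word_at /alt !sorted_map.
Qed.

Lemma trace_word_null s : s <> [::] -> seqall centered_seq s -> alt (map fst s) ->
  asnull Pr (fun n w => (d n)%:R^-1 * \tr (wval (U n w) (word_at n s))).
Proof.
move=> s0 hs alts; have [c c1 hc] := centered_word_at hs alts.
have [K K0 tm] := trace_moment_ex Pr (size s) c1.
have bT n : brv (fun w => nrm (\tr (wval (U n w) (word_at n s))) ^+ 4).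
  have := brv_tr_wval (U_haar n) 1%:M (word_at n s).
  by under eq_fun do rewrite mul1mx.
have nE n w : nrm ((d n)%:R^-1 * \tr (wval (U n w) (word_at n s))) ^+ 4 =
    (d n)%:R ^- 4 * nrm (\tr (wval (U n w) (word_at n s))) ^+ 4.
  by rewrite nrmM nrmV nrm_nat exprMn exprVn.
apply: (@asnull_moments _ _ _ Pr _ d K) => // n.
  by under eq_fun do rewrite nE; apply: brvM (bT n); exact: brv_cst.
move=> dn; under [X in Ex _ X]eq_fun do rewrite nE.
rewrite (ExZ Pr _ (bT n)).
have dN0 : (d n)%:R != 0 :> R by rewrite pnatr_eq0 -lt0n.
have h := tm (d n) (U n) dn (U_haar n) (word_at n s) (hc n).
have {}h : Ex Pr (fun w => nrm (\tr (wval (U n w) (word_at n s))) ^+ 4) <= K * (d n)%:R ^+ 2.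
  by apply: h; rewrite ?size_map//; case: s s0 {hs alts tm bT nE hc}.
apply: (@le_trans _ _ ((d n)%:R ^- 4 * (K * (d n)%:R ^+ 2) * (d n)%:R ^+ 2)).
  by rewrite ler_wpM2r ?exprn_ge0// ler_wpM2l// invr_ge0 exprn_ge0.
by rewrite le_eqVlt; apply/orP; left; apply/eqP; field.
Qed.

Lemma vector_word_null s : seqall centered_seq s -> alt (map fst s) ->
  asnull Pr (fun n w => vecdiff (d_gt0 n) (word_at n s) (U n w)).
Proof.
move=> hs alts; have [c c1 hc] := centered_word_at hs alts.
have [K K0 vm] := vector_moment_ex Pr (size s) c1.
apply: (@asnull_moments _ _ _ Pr _ d K) => // n.
  exact: (regular_brv_pow4 (U_haar n) (regular_vecdiff _ _)).
by move=> dn; apply: vm => //; rewrite size_map.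
Qed.

Lemma word_at_rcons n s x : word_at n (rcons s x) = rcons (word_at n s) (x.1, x.2 n).
Proof. by rewrite /word_at map_rcons. Qed.

Variable p : nat.
Local Notation N n := (blocksize p (d n)).

Definition bmxseq : Type := forall n, 'M[C]_(N n).
Implicit Types (t : seq (bool * bmxseq)).

Definition bval n w (x : bool * bmxseq) : 'M[C]_(N n) :=
  if x.1 then conj_blocks (U n w) (x.2 n) else x.2 n.

(** In a word of block matrices each flagged factor is conjugated blockwise. *)
Fixpoint bword n w t : 'M[C]_(N n) :=
  if t is x :: t' then bval n w x *m bword n w t' else 1%:M.

Fixpoint phiprod n t : 'M[C]_p :=
  if t is x :: t' then phi (x.2 n) *m phiprod n t' else 1%:M.

Definition centered_bseq (x : bool * bmxseq) : Prop :=
  (exists c : R, forall n, opb (x.2 n) c) /\ forall n, psi (x.2 n) = 0.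

Definition bentry (x : bool * bmxseq) i j : bool * mxseq :=
  (x.1, fun n => block (x.2 n) i j).

Lemma bval_entry n w x i j : block (bval n w x) i j =
  lval (U n w) ((bentry x i j).1, (bentry x i j).2 n).
Proof. by rewrite /bval /lval /bentry /=; case: x.1; rewrite ?block_conj. Qed.

Lemma centered_bentry x i j : centered_bseq x -> centered_seq (bentry x i j).
Proof.
move=> [[c hc] tx]; split; first by exists c => n; exact: opb_block.
move=> n; have /matrixP /(_ i j) := tx n; rewrite !mxE => /eqP.
by rewrite mulf_eq0 invr_eq0 pnatr_eq0 (gtn_eqF (d_gt0 n)) /= => /eqP.
Qed.

Lemma blockword_cons n w s x t i j :
  wval (U n w) (word_at n s) *m block (bword n w (x :: t)) i j =
  \sum_k wval (U n w) (word_at n (rcons s (bentry x i k))) *m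
    block (bword n w t) k j.
Proof.
rewrite /= block_mul mulmx_sumr; apply: eq_bigr => k _.
by rewrite bval_entry word_at_rcons wval_rcons mulmxA.
Qed.

Lemma bword_nil n w i j : block (bword n w [::]) i j = ((i == j)%:R)%:M.
Proof. exact: block1. Qed.

(** Induction on the factors not yet expanded: s is an alternating word of
    scalar blocks already extracted, and each step expands one factor of t
    into its blocks, whose traces vanish because the block trace of the
    factor does. *)
Lemma trace_blockword_null t s i j :
  (s = [::] -> t <> [::]) -> seqall centered_seq s -> seqall centered_bseq t ->
  alt (map fst s ++ map fst t) ->
  asnull Pr (fun n w => (d n)%:R^-1 *
    \tr (wval (U n w) (word_at n s) *m block (bword n w t) i j)).
Proof.
elim: t s i j => [|x t IH] s i j.
  move=> s0 hs _; rewrite cats0 => alts.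
  have {}s0 : s <> [::] by move=> /s0.
  have [<-|ij] := eqVneq i j.
    apply: asnull_ext (trace_word_null s0 hs alts) => n w.
    by rewrite bword_nil eqxx mulmx1.
  apply: asnull_ext (asnull0 Pr) => n w.
  by rewrite bword_nil (negbTE ij) raddf0 mulmx0 mxtrace0 mulr0.
move=> _ hs [hx ht] alts.
apply: asnull_ext (@asnull_sum _ _ _ Pr _ (index_enum 'I_p) (fun k n w => (d n)%:R^-1 *
  \tr (wval (U n w) (word_at n (rcons s (bentry x i k))) *m block (bword n w t) k j)) _).
  by move=> n w; rewrite blockword_cons raddf_sum mulr_sumr.
move=> k; apply: IH => //.
- by case: s {hs alts}.
- by rewrite -cats1; apply/seqall_cat; split=> //; split=> //; exact: centered_bentry.
- by move: alts; rewrite map_rcons cat_rcons.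
Qed.

Lemma phiE n (M : 'M[C]_(N n)) i j :
  phi M i j = block M i j (i0 (d_gt0 n)) (i0 (d_gt0 n)).
Proof. by rewrite mxE (eps1_proj R (d_gt0 n)) tr_delta_mul. Qed.

(** The expansion into blocks of [trace_blockword_null], where the products
    of corner entries sum up to an entry of the product of the p x p
    matrices. *)
Lemma vector_blockword_null t s i j :
  seqall centered_seq s -> seqall centered_bseq t ->
  alt (map fst s ++ map fst t) ->
  asnull Pr (fun n w =>
    (wval (U n w) (word_at n s) *m block (bword n w t) i j)
      (i0 (d_gt0 n)) (i0 (d_gt0 n)) -
    (\prod_(x <- word_at n s) x.2 (i0 (d_gt0 n)) (i0 (d_gt0 n))) * phiprod n t i j).
Proof.
elim: t s i j => [|x t IH] s i j.
  move=> hs _; rewrite cats0 => alts.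
  have [<-|ij] := eqVneq i j.
    apply: asnull_ext (vector_word_null hs alts) => n w.
    by rewrite bword_nil eqxx mulmx1 /phiprod mxE eqxx mulr1.
  apply: asnull_ext (asnull0 Pr) => n w.
  by rewrite bword_nil (negbTE ij) raddf0 mulmx0 /phiprod !mxE (negbTE ij) mulr0 subrr.
move=> hs [hx ht] alts.
apply: asnull_ext (@asnull_sum _ _ _ Pr _ (index_enum 'I_p) (fun k n w =>
  (wval (U n w) (word_at n (rcons s (bentry x i k))) *m block (bword n w t) k j)
      (i0 (d_gt0 n)) (i0 (d_gt0 n)) -
    (\prod_(y <- word_at n (rcons s (bentry x i k))) y.2 (i0 (d_gt0 n)) (i0 (d_gt0 n)))
      * phiprod n t k j) _).
  move=> n w; rewrite blockword_cons summxE sumrB; congr (_ - _).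
  rewrite [phiprod _ _]/= mxE mulr_sumr; apply: eq_bigr => k _.
  by rewrite word_at_rcons -cats1 big_cat big_seq1 /= phiE mulrA.
move=> k; apply: IH => //.
- by rewrite -cats1; apply/seqall_cat; split=> //; split=> //; exact: centered_bentry.
- by move: alts; rewrite map_rcons cat_rcons.
Qed.

Theorem psi_bword_null t i j : t <> [::] -> seqall centered_bseq t ->
  alt (map fst t) -> asnull Pr (fun n w => psi (bword n w t) i j).
Proof.
move=> t0 ht altt; have := @trace_blockword_null t [::] i j (fun=> t0) I ht altt.
by apply: asnull_ext => n w; rewrite mul1mx mxE.
Qed.

Theorem phi_bword_null t i j : seqall centered_bseq t -> alt (map fst t) ->
  asnull Pr (fun n w => (phi (bword n w t) - phiprod n t) i j).
Proof.
move=> ht altt; have := @vector_blockword_null t [::] i j I ht altt.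
apply: asnull_ext => n w; rewrite mul1mx big_nil mul1r -phiE [RHS]mxE.
by congr (_ + _); rewrite [RHS]mxE.
Qed.

End AsymptoticWords.

(** * Linear operators on functions *)

Section LinearEndomorphisms.
Variables (F : comNzRingType) (W : Type).

(** Linear operators on functions from W to F. The product of f and g
    applies f first: the operators of interest are transposes of operators
    on the free module over W, and this order makes transposition
    multiplicative. *)
Record linend : Type := LinEnd {
  lfun : (W -> F) -> (W -> F);
  lfunP : forall a G H, lfun (fun w => a * G w + H w) =
                        (fun w => a * lfun G w + lfun H w)
}.

Lemma linend_eq (f g : linend) : (forall G w, lfun f G w = lfun g G w) -> f = g.
Proof.
case: f g => f fP [g gP] /= fg.
have e : f = g by apply/funext => G; apply/funext => w; exact: fg.
by rewrite e in fP *; congr LinEnd; exact: Prop_irrelevance.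
Qed.

HB.instance Definition _ := gen_eqMixin linend.
HB.instance Definition _ := gen_choiceMixin linend.

Program Definition le0 := @LinEnd (fun _ _ => 0) _.
Next Obligation. by move=> a G H; apply/funext => w; rewrite mulr0 addr0. Qed.
Program Definition leopp (f : linend) := @LinEnd (fun G w => - lfun f G w) _.
Next Obligation.
by move=> f a G H; apply/funext => w /=; rewrite lfunP opprD mulrN.
Qed.
Program Definition leadd (f g : linend) :=
  @LinEnd (fun G w => lfun f G w + lfun g G w) _.
Next Obligation.
by move=> f g a G H; apply/funext => w /=; rewrite !lfunP mulrDr addrACA.
Qed.
Program Definition le1 := @LinEnd (fun G => G) _.
Next Obligation. by []. Qed.
Program Definition lemul (f g : linend) :=
  @LinEnd (fun G => lfun g (lfun f G)) _.
Next Obligation. by move=> f g a G H /=; rewrite !lfunP. Qed.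
Program Definition lescale (a : F) := @LinEnd (fun G w => a * G w) _.
Next Obligation.
by move=> a b G H; apply/funext => w; rewrite mulrDr mulrCA.
Qed.

Fact leaddA : associative leadd.
Proof. by move=> f g h; apply: linend_eq => G w /=; rewrite addrA. Qed.
Fact leaddC : commutative leadd.
Proof. by move=> f g; apply: linend_eq => G w /=; rewrite addrC. Qed.
Fact leadd0 : left_id le0 leadd.
Proof. by move=> f; apply: linend_eq => G w /=; rewrite add0r. Qed.
Fact leaddN : left_inverse le0 leopp leadd.
Proof. by move=> f; apply: linend_eq => G w /=; rewrite addNr. Qed.
HB.instance Definition _ := GRing.isZmodule.Build linend leaddA leaddC leadd0 leaddN.

Fact lemulA : associative lemul. Proof. by move=> f g h; apply: linend_eq. Qed.
Fact lemul1l : left_id le1 lemul. Proof. by move=> f; apply: linend_eq. Qed.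
Fact lemul1r : right_id le1 lemul. Proof. by move=> f; apply: linend_eq. Qed.
Fact lemulDl : left_distributive lemul leadd.
Proof.
move=> f g h; apply: linend_eq => G w /=.
have -> : (fun w0 => lfun f G w0 + lfun g G w0) =
    (fun w0 => 1 * lfun f G w0 + lfun g G w0).
  by apply/funext => w0; rewrite mul1r.
by rewrite lfunP mul1r.
Qed.
Fact lemulDr : right_distributive lemul leadd.
Proof. by move=> f g h; apply: linend_eq. Qed.
HB.instance Definition _ :=
  GRing.Zmodule_isPzRing.Build linend lemulA lemul1l lemul1r lemulDl lemulDr.

Lemma lfunD (f g : linend) G w : lfun (f + g) G w = lfun f G w + lfun g G w.
Proof. by []. Qed.
Lemma lfunM (f g : linend) G : lfun (f * g) G = lfun g (lfun f G).
Proof. by []. Qed.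

Lemma lfun_sum (I : Type) (r : seq I) (f : I -> linend) G w :
  lfun (\sum_(i <- r) f i) G w = \sum_(i <- r) lfun (f i) G w.
Proof. by elim: r => [|i r IH]; rewrite ?big_nil// !big_cons lfunD IH. Qed.

Lemma lescale_comm a (f : linend) : lescale a * f = f * lescale a.
Proof.
apply: linend_eq => G w; rewrite !lfunM /=.
have -> : (fun w0 => a * G w0) = (fun w0 => a * G w0 + 0 * G w0).
  by apply/funext => w0; rewrite mul0r addr0.
have -> : (fun w0 => a * G w0 + 0 * G w0) = (fun w0 => a * G w0 + (fun v => 0 * G v + (fun=> 0) v) w0).
  by apply/funext => w0; rewrite addr0.
have f0 : lfun f (fun=> 0) = fun=> 0.
  have := lfunP f (-1) (fun=> 0) (fun=> 0).
  under [X in lfun f X]eq_fun do rewrite mulr0 addr0.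
  by move=> ->; apply/funext => v; rewrite mulN1r addNr.
by rewrite !lfunP f0 mul0r !addr0.
Qed.

Fact lescale_is_zmod_morphism : zmod_morphism lescale.
Proof. by move=> a b; apply: linend_eq => G w; rewrite /= mulrBl. Qed.
Fact lescale_is_monoid_morphism : monoid_morphism lescale.
Proof.
split; first by apply: linend_eq => G w; rewrite /= mul1r.
by move=> a b; apply: linend_eq => G w; rewrite /= mulrA [b * a]mulrC.
Qed.
HB.instance Definition _ :=
  GRing.isZmodMorphism.Build F linend lescale lescale_is_zmod_morphism.
HB.instance Definition _ :=
  GRing.isMonoidMorphism.Build F linend lescale lescale_is_monoid_morphism.

End LinearEndomorphisms.

(** * Two states of a matrix algebra in one pointed representation *)

Section PointedRepresentation.
Variable F : fieldType.

(** Two vectors whose pairing is 1 can be moved to the first vector of the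
    standard basis and its dual. *)
Lemma pointed_basis m (r : 'rV[F]_m.+1) (c : 'cV[F]_m.+1) : r *m c = 1%:M ->
  exists g : 'M[F]_m.+1, [/\ g \in unitmx, delta_mx ord0 ord0 *m g = r &
    g *m c = delta_mx ord0 ord0].
Proof.
move=> rc; have r0 : r != 0.
  by apply: contra_eq_neq rc => ->; rewrite mul0mx eq_sym oner_eq0.
have rk : \rank r = 1%N by rewrite rank_rV r0.
set k := (col_ebase r) ord0 ord0.
have k0 : k != 0.
  by have := col_ebase_unit r; rewrite unitmxE det_mx11 unitfE.
pose h : 'M[F]_m.+1 := k *: row_ebase r.
have hu : h \in unitmx by rewrite unitmxZ ?unitfE// row_ebase_unit.
have eh : delta_mx ord0 ord0 *m h = r.
  rewrite -[RHS](mulmx_ebase r) rk -scalemxAr [col_ebase r]mx11_scalar -/k.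
  rewrite mul_scalar_mx -scalemxAl; congr (_ *: (_ *m _)).
  apply/matrixP => a b; rewrite !mxE ord1 eqxx /=.
  by rewrite -val_eqE /= [(0 == _)%N]eq_sym andbC; case: (val b).
(* The matrix h already sends the row; the transvection 1 - v e corrects the
   column and keeps the row, because e v = 0. *)
pose v : 'cV[F]_m.+1 := h *m c - delta_mx ord0 ord0.
pose e : 'rV[F]_m.+1 := delta_mx ord0 ord0.
have ev : e *m v = 0.
  rewrite mulmxBr mulmxA eh rc mul_delta_mx; apply/eqP; rewrite subr_eq0; apply/eqP.
  by apply/matrixP => a b; rewrite !ord1 !mxE.
have vE : v = h *m c - delta_mx ord0 ord0 by [].
have ehc : e *m (h *m c) = 1%:M by rewrite mulmxA eh.
have eE : delta_mx ord0 ord0 = e by [].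
clearbody v e.
have inv1 : (1%:M - v *m e) *m (1%:M + v *m e) = 1%:M.
  rewrite mulmxDr mulmx1 mulmxBl mul1mx -mulmxA [e *m _]mulmxA ev mul0mx mulmx0.
  by rewrite subr0 subrK.
have su : 1%:M - v *m e \in unitmx by case/mulmx1_unit: inv1.
exists ((1%:M - v *m e) *m h); split; first by rewrite unitmx_mul su hu.
  by rewrite eE mulmxA mulmxBr mulmx1 mulmxA ev mul0mx subr0 -eE.
rewrite -mulmxA mulmxBl mul1mx.
by rewrite -mulmxA ehc mulmx1 vE subKr.
Qed.

(** Changing the basis as in [pointed_basis] turns the functional given by r
    and c into the corner coefficient, and any second functional with the
    same c into a row vector eta with first coordinate 1. *)
Lemma pointed_conjugation D (r q : 'rV[F]_D) (c : 'cV[F]_D) :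
  r *m c = 1%:M -> q *m c = 1%:M ->
  exists m (f : 'M[F]_D -> 'M[F]_m.+1) (eta : 'rV[F]_m.+1),
  [/\ linear f, f 1%:M = 1%:M, {morph f : A B / A *m B},
      forall A, f A ord0 ord0 = (r *m A *m c) ord0 ord0 &
      eta ord0 ord0 = 1 /\
      forall A, (eta *m f A) ord0 ord0 = (q *m A *m c) ord0 ord0].
Proof.
case: D r q c => [|m] r q c rc qc.
  move: rc; rewrite [r]thinmx0 mul0mx => /matrixP /(_ ord0 ord0) /eqP.
  by rewrite !mxE eq_sym oner_eq0.
have [g [gu ge gc]] := pointed_basis rc.
have gcE : invmx g *m delta_mx ord0 ord0 = c by rewrite -gc mulKmx.
have col0 n (A : 'M[F]_(n, m.+1)) a :
    A a ord0 = (A *m (delta_mx ord0 ord0 : 'cV_m.+1)) a ord0.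
  by rewrite -colE mxE.
have row0 (B : 'cV[F]_m.+1) :
    B ord0 ord0 = (delta_mx ord0 ord0 *m B) (ord0 : 'I_1) ord0.
  by rewrite -rowE mxE.
exists m, (fun A => g *m A *m invmx g), (q *m invmx g); split.
- by move=> a A B; rewrite mulmxDr mulmxDl -scalemxAr -scalemxAl.
- by rewrite mulmx1 mulmxV.
- by move=> A B; rewrite !mulmxA mulmxKV.
- by move=> A; rewrite col0 row0 -!mulmxA gcE !mulmxA ge.
- split; first by rewrite col0 -mulmxA gcE qc mxE eqxx.
  by move=> A; rewrite col0 !mulmxA mulmxKV// -!mulmxA gcE.
Qed.

(** The matrix algebra acts on itself by right multiplication. The
    normalized trace and the corner entry both come from the functional
    given by the trace, paired with the identity matrix and with d E_ii;
    this common functional is what [pointed_conjugation] asks for. *)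
Lemma pointed_representation d (i : 'I_d) : (d%:R : F) != 0 ->
  exists m (L : 'M[F]_d -> 'M[F]_m.+1) (eta : 'rV[F]_m.+1),
  [/\ linear L, L 1%:M = 1%:M, {morph L : A B / A *m B},
      forall A, L A ord0 ord0 = d%:R^-1 * \tr A &
      eta ord0 ord0 = 1 /\ forall A, (eta *m L A) ord0 ord0 = A i i].
Proof.
move=> dN0.
(* The column c is the normalized trace as a functional on matrices. *)
pose c : 'cV[F]_(d * d) := d%:R^-1 *: (mxvec 1%:M)^T.
have rcE A : (mxvec A *m c) ord0 ord0 = d%:R^-1 * \tr A.
  rewrite -scalemxAr mxE; congr (_ * _).
  rewrite mxE (reindex _ (curry_mxvec_bij _ _)) /=.
  rewrite (eq_bigr (fun k : 'I_d * 'I_d => A k.1 k.2 * (k.1 == k.2)%:R)).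
    rewrite -(pair_bigA _ (fun a b => A a b * (a == b)%:R)) /=.
    apply: eq_bigr => a _; rewrite (bigD1 a)//= big1 => [|b ba].
      by rewrite eqxx mulr1 addr0.
    by rewrite eq_sym (negbTE ba) mulr0.
  by case=> a b _ /=; rewrite mxE !mxvecE mxE.
have qcE A : (mxvec (d%:R *: delta_mx i i *m A) *m c) ord0 ord0 = A i i.
  by rewrite rcE -scalemxAl mxtraceZ tr_delta_mul mulrA mulVf// mul1r.
have rc : mxvec 1%:M *m c = 1%:M.
  by rewrite [LHS]mx11_scalar rcE mxtrace1 mulVf.
have qc : mxvec (d%:R *: delta_mx i i) *m c = 1%:M.
  by rewrite [LHS]mx11_scalar -[_ *: _]mulmx1 qcE mxE eqxx.
have [m [f [eta [f_lin f1 fM f0 [eta0 feta]]]]] := pointed_conjugation rc qc.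
exists m, (fun A => f (lin_mulmxr A)), eta; split.
- by move=> a A B; rewrite linearP f_lin.
- rewrite -[RHS]f1; congr f; apply/row_matrixP => j.
  by rewrite rowE mul_rV_lin /= mulmx1 vec_mxK rowE mulmx1.
- move=> A B; rewrite -fM; congr f; apply/row_matrixP => j.
  by rewrite !rowE mulmxA !mul_rV_lin /= mxvecK mulmxA.
- by move=> A; rewrite f0 mul_rV_lin /= mxvecK mul1mx rcE.
- by split=> // A; rewrite feta mul_rV_lin /= mxvecK qcE.
Qed.

End PointedRepresentation.

(** * Operators on functions on alternating words *)

Section FreeFock.
Variables (F : comNzRingType) (m : nat).
(** Alternating words in basis vectors other than the distinguished one:
    since the sides alternate, only the side of the first letter is
    recorded, and the empty word has none. *)
Definition fockword : Type := option (bool * 'I_m * seq 'I_m).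
Local Notation W := fockword.
Local Notation S := (linend F W).
Implicit Types (b : bool) (A : 'M[F]_m.+1) (G H : W -> F) (js : seq 'I_m).

Definition mkword b js : W := if js is j :: js' then Some (b, j, js') else None.

(** The function G on the span of the words obtained from js by putting in
    front either nothing or a letter of side b. The distinguished basis
    vector stands for the empty letter, so this span is a copy of the
    representation of side b. *)
Definition fockvec b G js : 'rV[F]_m.+1 :=
  \row_k (if unlift ord0 k is Some j then G (mkword b (j :: js))
          else G (mkword (~~ b) js)).

(** The action of side b on functions on words: A acts on the leading letter
    of side b, which is created from the distinguished vector if the word
    starts on the other side or is empty. *)
Definition fockact b A G (w : W) : F :=
  match w with
  | None => (fockvec b G [::] *m A) ord0 ord0
  | Some (b', j, js) =>
      if b' == b then (fockvec b G js *m A) ord0 (lift ord0 j)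
      else (fockvec b G (j :: js) *m A) ord0 ord0
  end.

Lemma fockact_out b A G js :
  fockact b A G (mkword (~~ b) js) = (fockvec b G js *m A) ord0 ord0.
Proof. by case: js => //= j js; case: b. Qed.

Lemma fockvec_act b A G js : fockvec b (fockact b A G) js = fockvec b G js *m A.
Proof.
apply/rowP => k; rewrite mxE; case: unliftP => [j ->|->].
  by rewrite /= eqxx.
exact: fockact_out.
Qed.

Lemma fockvec_lin b a G H js :
  fockvec b (fun v => a * G v + H v) js = a *: fockvec b G js + fockvec b H js.
Proof. by apply/rowP => k; rewrite !mxE; case: unlift. Qed.

Fact fockact_lin b A a G H : fockact b A (fun v => a * G v + H v) =
  (fun v => a * fockact b A G v + fockact b A H v).
Proof.
apply/funext => -[[[b' j] js]|] /=; first case: eqP => _;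
  by rewrite fockvec_lin mulmxDl -scalemxAl !mxE.
Qed.

Definition fockop b A : S := LinEnd (fockact_lin b A).

Lemma fockop1 b : fockop b 1%:M = 1.
Proof.
apply: linend_eq => G [[[b' j] js]|] /=; last by rewrite mulmx1 mxE unlift_none.
case: eqP => [->|/eqP b'b]; first by rewrite mulmx1 mxE liftK.
by rewrite mulmx1 mxE unlift_none /=; congr (G (Some (_, _, _))); case: b b' b'b => -[].
Qed.

Lemma fockopM b A A' : fockop b (A *m A') = fockop b A * fockop b A'.
Proof.
by apply: linend_eq => G [[[b' j] js]|]; rewrite lfunM /= !fockvec_act !mulmxA.
Qed.

Lemma fockop_lin b a A A' :
  fockop b (a *: A + A') = lescale W a * fockop b A + fockop b A'.
Proof.
have sc : lescale W a * fockop b A = fockop b A * lescale W a by exact: lescale_comm.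
rewrite sc; apply: linend_eq => G w; rewrite lfunD lfunM /=.
by case: w => [[[b' j] js]|] /=; first case: eqP => _;
  rewrite mulmxDr -scalemxAr !mxE.
Qed.

Variable eta : 'rV[F]_m.+1.

(** The functional that multiplies the values of eta along a word; at eta
    supported on the distinguished vector it only sees the empty word. *)
Definition fockfun (w : W) : F :=
  if w is Some (_, j, js) then \prod_(k <- j :: js) eta ord0 (lift ord0 k) else 1.

Lemma fockfun_mk b js : fockfun (mkword b js) = \prod_(k <- js) eta ord0 (lift ord0 k).
Proof. by case: js => //=; rewrite big_nil. Qed.

Definition multiplicative_from b H (a : F) : Prop :=
  forall js, H (mkword b js) = a * \prod_(k <- js) eta ord0 (lift ord0 k).

(** If A is centered, acting on the distinguished vector leaves nothing at
    the empty letter, so every word acquires a new letter and the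
    multiplicative functional acquires the factor (eta A)_0. *)
Lemma fockact_centered b A H a : A ord0 ord0 = 0 ->
  multiplicative_from b H a ->
  multiplicative_from (~~ b) (fockact b A H) (a * (eta *m A) ord0 ord0).
Proof.
move=> A0 hH js; rewrite fockact_out !mxE !big_ord_recl /= A0 !mulr0 !add0r.
rewrite mulr_sumr mulr_suml; apply: eq_bigr => j _.
by rewrite mxE liftK (hH (j :: js)) big_cons; ring.
Qed.

End FreeFock.

(** * Existence of the free and conditionally free products *)

(** Evaluation commutes with ring morphisms on values and with renaming the
    indeterminates. The map h need only be a morphism compatible with the
    coefficients, such as the conjugation of block matrices. *)
Lemma nceval_transfer (F : comNzRingType) (p : nat) (K K' : Type)
    (S S' : pzRingType) (rho : {rmorphism 'M[F]_p -> S})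
    (rho' : {rmorphism 'M[F]_p -> S'}) (z : K -> S) (z' : K' -> S')
    (f : K -> K') (h : S -> S') :
  (forall a k, GRing.comm (rho a%:M) (z k)) ->
  (forall a k, GRing.comm (rho' a%:M) (z' k)) ->
  {morph h : u v / u + v} -> {morph h : u v / u * v} ->
  (forall a, h (rho a) = rho' a) -> (forall k, z' (f k) = h (z k)) ->
  forall P : ncpoly F p K,
  nceval rho' z' (nceval (@nccoef F p K') (ncvar \o f) P) = h (nceval rho z P).
Proof.
move=> cz cz' hD hM hrho hf; elim/quotW => t.
rewrite nceval_pi; last by move=> a k; exact: ncscalar_comm.
rewrite nceval_pi//.
elim: t => [a|k|t1 IH1 t2 IH2|t1 IH1 t2 IH2] /=.
- by rewrite nceval_coef.
- by rewrite nceval_var.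
- by rewrite ncevalD// IH1 IH2 hD.
- by rewrite ncevalM// IH1 IH2 hM.
Qed.

Section FreeProductExistence.
Variables (R : realType) (p d : nat).
Hypothesis d_gt0 : (0 < d)%N.
Local Notation C := (Cplx R).
Local Notation N := (blocksize p d).
Variables (m : nat) (L : 'M[C]_d -> 'M[C]_m.+1) (eta : 'rV[C]_m.+1).
Hypotheses (L_lin : linear L) (L1 : L 1%:M = 1%:M).
Hypothesis LM : {morph L : A B / A *m B}.
Hypothesis L_tr : forall A, L A ord0 ord0 = d%:R^-1 * \tr A.
Local Notation S := (linend C (fockword m)).
Local Notation scal := (lescale (fockword m) : C -> S).

(** The two families are told apart by the side on which their matrices act. *)
Definition letter_op (b : bool) (A : 'M[C]_d) : S := fockop b (L A).

Lemma letter_opD b A A' : letter_op b (A + A') = letter_op b A + letter_op b A'.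
Proof.
rewrite /letter_op -[A]scale1r L_lin fockop_lin.
have -> : lescale (fockword m) 1 = 1 :> S by exact: (rmorph1 (lescale (fockword m))).
by rewrite mul1r scale1r.
Qed.

Lemma letter_opM b A A' : letter_op b (A *m A') = letter_op b A * letter_op b A'.
Proof. by rewrite /letter_op LM fockopM. Qed.

Lemma letter_op_scalar b a : letter_op b a%:M = scal a.
Proof.
have L0 : L 0 = 0.
  have := L_lin 1 0 0; rewrite scaler0 addr0 scale1r => /eqP.
  by rewrite -subr_eq0 opprD addrA subrr add0r oppr_eq0 => /eqP.
rewrite /letter_op -scalemx1 -[_ *: _]addr0 L_lin L1 L0 fockop_lin fockop1 mulr1.
rewrite (_ : fockop b 0 = 0) ?addr0//.
have := fockop_lin b (-1) (0 : 'M[C]_m.+1) 0.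
rewrite scaler0 addr0 (_ : lescale _ (-1) = -1); last first.
  by rewrite (rmorphN1 (lescale (fockword m) : {rmorphism C -> S})).
by rewrite mulN1r addNr.
Qed.

(** Coefficients in p x p matrices enter by letting each block act
    separately, which gives p x p matrices of operators. *)
Definition block_op (b : bool) (M : 'M[C]_N) : 'M[S]_p :=
  \matrix_(i, j) letter_op b (block M i j).

Definition scal_mx (a : 'M[C]_p) : 'M[S]_p := map_mx scal a.

Lemma block_opD b : {morph block_op b : M M' / M + M'}.
Proof. by move=> M M'; apply/matrixP => i j; rewrite !mxE blockD letter_opD. Qed.

Lemma letter_op_sum b (I : Type) (r : seq I) (A : I -> 'M[C]_d) :
  letter_op b (\sum_(i <- r) A i) = \sum_(i <- r) letter_op b (A i).
Proof.
elim: r => [|i r IH]; last by rewrite !big_cons letter_opD IH.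
rewrite !big_nil -(raddf0 (@scalar_mx C d)) letter_op_scalar.
exact: (rmorph0 (lescale (fockword m) : {rmorphism C -> S})).
Qed.

Lemma block_opM b : {morph block_op b : M M' / M * M'}.
Proof.
move=> M M'; apply/matrixP => i j; rewrite !mxE block_mul letter_op_sum.
by apply: eq_bigr => k _; rewrite !mxE letter_opM.
Qed.

Lemma block_op_ampl b a : block_op b (ampl d a) = scal_mx a.
Proof. by apply/matrixP => i j; rewrite !mxE block_ampl letter_op_scalar. Qed.

Fact scal_mx_is_zmod_morphism : zmod_morphism scal_mx.
Proof. by move=> a b; apply/matrixP => i j; rewrite !mxE rmorphB. Qed.
Fact scal_mx_is_monoid_morphism : monoid_morphism scal_mx.
Proof.
split; first by apply/matrixP => i j; rewrite !mxE rmorph_nat.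
move=> a b; apply/matrixP => i j; rewrite !mxE rmorph_sum.
by apply: eq_bigr => k _; rewrite !mxE rmorphM.
Qed.
HB.instance Definition _ :=
  GRing.isZmodMorphism.Build 'M[C]_p 'M[S]_p scal_mx scal_mx_is_zmod_morphism.
HB.instance Definition _ :=
  GRing.isMonoidMorphism.Build 'M[C]_p 'M[S]_p scal_mx scal_mx_is_monoid_morphism.

Lemma scal_mx_comm a (X : 'M[S]_p) : GRing.comm (scal_mx a%:M) X.
Proof.
apply/matrixP => i j; rewrite !mxE (bigD1 i)//= big1 => [|k ki]; last first.
  by rewrite !mxE eq_sym (negbTE ki) rmorph0 mul0r.
rewrite (bigD1 j)//= big1 => [|k kj]; last first.
  by rewrite !mxE (negbTE kj) rmorph0 mulr0.
by rewrite !mxE !eqxx !addr0 lescale_comm.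
Qed.

Variables (I J : Type) (x : I -> 'M[C]_N) (y : J -> 'M[C]_N).

Definition joint_family (k : I + J) : 'M[S]_p :=
  match k with inl i => block_op true (x i) | inr j => block_op false (y j) end.

Definition joint_eval : ncpoly C p (I + J) -> 'M[S]_p :=
  nceval scal_mx joint_family.

Lemma joint_comm a k : GRing.comm (scal_mx a%:M) (joint_family k).
Proof. exact: scal_mx_comm. Qed.

Lemma joint_evalM : {morph joint_eval : P P' / P * P'}.
Proof. exact: ncevalM joint_comm. Qed.

Lemma joint_evalD : {morph joint_eval : P P' / P + P'}.
Proof. exact: ncevalD joint_comm. Qed.

Lemma joint_eval_coef a : joint_eval (nccoef a) = scal_mx a.
Proof. exact: nceval_coef joint_comm a. Qed.

Lemma eval_transfer (K : Type) (z : K -> 'M[C]_N) (b : bool) (f : K -> I + J) :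
  (forall k, joint_family (f k) = block_op b (z k)) -> forall P : ncpoly C p K,
  joint_eval (nceval (@nccoef C p (I + J)) (ncvar \o f) P) = block_op b (mateval z P).
Proof.
move=> hf; apply: (nceval_transfer (rho := @ampl R p d) (rho' := scal_mx)) => //.
- by move=> a k; exact: ampl_scalar_comm.
- exact: joint_comm.
- exact: block_opD.
- exact: block_opM.
- exact: block_op_ampl.
Qed.

(** The joint state is read off at the empty word. *)
Definition fockstate (P : ncpoly C p (I + J)) : 'M[C]_p :=
  \matrix_(i, j) lfun (joint_eval P i j) (fockfun eta) None.

(** The state of one factor for the functional eta: [psi] or [phi] according
    to the choice of eta. *)
Definition chi (M : 'M[C]_N) : 'M[C]_p :=
  \matrix_(i, j) (eta *m L (block M i j)) ord0 ord0.

Definition factor_mx (u : ncpoly C p I + ncpoly C p J) : 'M[C]_N :=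
  match u with inl P => mateval x P | inr P => mateval y P end.

Lemma joint_eval_factor u :
  joint_eval (factor_val u) = block_op (factor_side u) (factor_mx u).
Proof. by case: u => P; exact: eval_transfer. Qed.

Hypothesis eta0 : eta ord0 ord0 = 1.

Lemma fockstate_factor u : fockstate (factor_val u) = chi (factor_mx u).
Proof.
apply/matrixP => i j; rewrite [LHS]mxE [RHS]mxE joint_eval_factor mxE.
rewrite /letter_op -[None]/(mkword (~~ (factor_side u)) [::] : fockword m).
rewrite [lfun _ _ _]fockact_out; congr ((_ *m _) _ _).
apply/rowP => k; rewrite mxE; case: unliftP => [l ->|->]; last by rewrite eta0.
by rewrite fockfun_mk big_seq1.
Qed.

(** Each centered factor lengthens every word by one letter on a new side,
    so the functional remains multiplicative and the states of the factors
    multiply. *)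
Lemma alternating_product (s : seq (ncpoly C p I + ncpoly C p J)) b H a :
  sorted (fun u v => factor_side u != factor_side v) s ->
  (if s is u :: _ then factor_side u = b else True) ->
  all (fun u => factor_map (psi_of x) (psi_of y) u == 0) s ->
  multiplicative_from eta b H a ->
  forall i j, lfun (joint_eval (\prod_(u <- s) factor_val u) i j) H None =
    a * (\prod_(u <- s) chi (factor_mx u)) i j.
Proof.
elim: s b H a => [|u s IH] b H a.
  move=> _ _ _ hH i j; rewrite !big_nil.
  have -> : joint_eval 1 = 1.
    rewrite (_ : 1 = nccoef 1) ?joint_eval_coef//.
    exact: (rmorph1 scal_mx).
  have := hH [::]; rewrite big_nil mulr1 /= => H1.
  rewrite !mxE; case: (i == j); rewrite /= ?mulr1 ?mulr0//.
move=> sorts ub /= /andP[/eqP u0 alls] hH i j.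
rewrite !big_cons joint_evalM joint_eval_factor !mxE lfun_sum mulr_sumr.
apply: eq_bigr => k _; rewrite lfunM mxE mulrA; apply: (IH (~~ b)) => //.
- exact: path_sorted sorts.
- case: s sorts {IH alls} => // v s /= /andP[]; rewrite ub.
  by case: b {ub hH}; case: factor_side.
- rewrite mxE /letter_op ub; apply: fockact_centered => //.
  rewrite L_tr; case: u u0 {sorts ub} => P /matrixP /(_ i k); by rewrite !mxE.
Qed.

Lemma fockstate_cfree : is_cfree_product (psi_of x) (psi_of y)
  (fun P => chi (mateval x P)) (fun P => chi (mateval y P)) fockstate.
Proof.
split.
- split=> [P P'|b P b'].
    by apply/matrixP => i j; rewrite !mxE joint_evalD mxE lfunD.
  apply/matrixP => i j; rewrite mxE !joint_evalM !joint_eval_coef.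
  rewrite mxE lfun_sum [RHS]mxE; apply: eq_bigr => l _.
  rewrite lfunM [X in lfun X _ _]mxE /= mulrC; congr (_ * _).
  rewrite mxE lfun_sum mxE; apply: eq_bigr => k _.
  rewrite [scal_mx b i k]mxE [fockstate P k l]mxE [lescale _ _ * _]lescale_comm.
  by rewrite lfunM.
- by move=> P; exact: (fockstate_factor (inl P)).
- by move=> P; exact: (fockstate_factor (inr P)).
- move=> s /and3P[s0 sorts alls].
  case: s s0 sorts alls => // u s _ sorts alls.
  have h : multiplicative_from eta (factor_side u) (fockfun eta) 1.
    by move=> js; rewrite fockfun_mk mul1r.
  apply/matrixP => i j; rewrite mxE (alternating_product sorts erefl alls h) mul1r.
  congr (fun_of_matrix _ i j).
  by apply: eq_bigr => -[P|P] _.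
Qed.

End FreeProductExistence.

Section FreeProductSpec.
Variables (R : realType) (p d : nat).
Hypothesis d_gt0 : (0 < d)%N.
Local Notation C := (Cplx R).
Local Notation N := (blocksize p d).
Variables (I J : Type) (x : I -> 'M[C]_N) (y : J -> 'M[C]_N).

(** The definite description is met because the construction on words
    provides such a map. *)
Lemma cfree_productP : is_cfree_product (psi_of x) (psi_of y) (phi_of x) (phi_of y)
  (cfree_product (psi_of x) (psi_of y) (phi_of x) (phi_of y)).
Proof.
apply: (xgetPex (fun=> 0)).
have dN0 : d%:R != 0 :> C by rewrite pnatr_eq0 -lt0n.
have [m [L [eta [L_lin L1 LM Ltr [eta0 etaL]]]]] :=
  pointed_representation (i0 d_gt0) dN0.
have := fockstate_cfree L_lin L1 LM Ltr x y eta0.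
have chiE M : chi L eta M = phi M :> 'M[C]_p.
  apply/matrixP => i j; rewrite [LHS]mxE [RHS]mxE etaL.
  by rewrite (eps1_proj R d_gt0) tr_delta_mul.
move=> [h1 h2 h3 h4]; exists (fockstate L eta x y); split => //.
- by move=> P; rewrite h2 chiE.
- by move=> P; rewrite h3 chiE.
- move=> s /h4 ->; apply: eq_bigr => -[P|P] _ /=; exact: chiE.
Qed.

(** The case where eta is the distinguished vector: then both functionals
    are the normalized trace, and a centered first factor makes the product
    vanish. *)
Lemma free_productP : is_free_product (psi_of x) (psi_of y)
  (free_product (psi_of x) (psi_of y)).
Proof.
apply: (xgetPex (fun=> 0)).
have dN0 : d%:R != 0 :> C by rewrite pnatr_eq0 -lt0n.
have [m [L [eta [L_lin L1 LM Ltr _]]]] :=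
  pointed_representation (i0 d_gt0) dN0.
have e0 : (delta_mx ord0 ord0 : 'rV[C]_m.+1) ord0 ord0 = 1 by rewrite mxE eqxx.
have chiE M : chi L (delta_mx ord0 ord0) M = psi M :> 'M[C]_p.
  by apply/matrixP => i j; rewrite [LHS]mxE [RHS]mxE -Ltr -rowE mxE.
have [h1 h2 h3 h4] := fockstate_cfree L_lin L1 LM Ltr x y e0.
exists (fockstate L (delta_mx ord0 ord0) x y); split => //.
- by move=> P; rewrite h2 chiE.
- by move=> P; rewrite h3 chiE.
- move=> s hs; rewrite h4//; case/and3P: hs; case: s => // u s _ _ /andP[/eqP u0 _].
  rewrite big_cons (_ : factor_map _ _ u = 0) ?mul0r//.
  by case: u u0 => P /=; rewrite chiE.
Qed.

End FreeProductSpec.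

(** * Reduction to alternating centered products *)

Section CenteringReduction.
Context {R : realType} {dsp : measure_display} {T : measurableType dsp}.
Variable Pr : probability T R.
Local Notation C := (Cplx R).
Variables (p : nat) (K : Type) (d : nat -> nat).
Hypothesis d_gt0 : forall n, (0 < d n)%N.
Local Notation N n := (blocksize p (d n)).
Variables (A B : forall n, K -> 'M[C]_(N n)).
Local Notation BX := (ncpoly C p K).
Local Notation BXY := (ncpoly C p (K + K)).

Lemma ncinlM (P P' : BX) : ncinl K (P * P') = ncinl K P * ncinl K P' :> BXY.
Proof. by apply: ncevalM => a k; exact: ncscalar_comm. Qed.
Lemma ncinrM (P P' : BX) : ncinr K (P * P') = ncinr K P * ncinr K P' :> BXY.
Proof. by apply: ncevalM => a k; exact: ncscalar_comm. Qed.
Lemma ncinlD (P P' : BX) : ncinl K (P + P') = ncinl K P + ncinl K P' :> BXY.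
Proof. by apply: ncevalD => a k; exact: ncscalar_comm. Qed.
Lemma ncinrD (P P' : BX) : ncinr K (P + P') = ncinr K P + ncinr K P' :> BXY.
Proof. by apply: ncevalD => a k; exact: ncscalar_comm. Qed.
Lemma ncinl_coef a : ncinl K (nccoef a) = nccoef a :> BXY.
Proof. by apply: nceval_coef => b k; exact: ncscalar_comm. Qed.
Lemma ncinr_coef a : ncinr K (nccoef a) = nccoef a :> BXY.
Proof. by apply: nceval_coef => b k; exact: ncscalar_comm. Qed.
Lemma ncinl_var k : ncinl K (ncvar k) = ncvar (inl k) :> BXY.
Proof. by apply: nceval_var => b j; exact: ncscalar_comm. Qed.
Lemma ncinr_var k : ncinr K (ncvar k) = ncvar (inr k) :> BXY.
Proof. by apply: nceval_var => b j; exact: ncscalar_comm. Qed.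

Lemma matevalM n (x : K -> 'M[C]_(N n)) P P' :
  mateval x (P * P') = mateval x P * mateval x P'.
Proof. by apply: ncevalM => a k; exact: ampl_scalar_comm. Qed.
Lemma matevalD n (x : K -> 'M[C]_(N n)) P P' :
  mateval x (P + P') = mateval x P + mateval x P'.
Proof. by apply: ncevalD => a k; exact: ampl_scalar_comm. Qed.
Lemma mateval_coef n (x : K -> 'M[C]_(N n)) a : mateval x (nccoef a) = ampl (d n) a.
Proof. by apply: nceval_coef => b k; exact: ampl_scalar_comm. Qed.
Lemma mateval_var n (x : K -> 'M[C]_(N n)) k : mateval x (ncvar k) = x k.
Proof. by apply: nceval_var => b j; exact: ampl_scalar_comm. Qed.

(** The factors of a product depend on n, because centering subtracts the
    trace of a factor, which changes with n. *)
Definition facseq : Type := ((nat -> BX) + (nat -> BX))%type.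
Implicit Types (u v : facseq) (s : seq facseq).

Definition fac_at n u : BX + BX :=
  match u with inl f => inl (f n) | inr f => inr (f n) end.

Definition fac_side u : bool := if u is inl _ then true else false.

Definition fac_mx n u : 'M[C]_(N n) := factor_mx (A n) (B n) (fac_at n u).

Definition fac_bounded u : Prop := exists c : R, forall n, opb (fac_mx n u) c.

Definition fac_centered u : Prop := forall n, psi (fac_mx n u) = 0.

(** A coefficient, viewed as a factor of either side. *)
Definition fac_coef (b : bool) (a : nat -> 'M[C]_p) : facseq :=
  if b then inl (fun n => nccoef (a n)) else inr (fun n => nccoef (a n)).

Definition fac_mul u v : facseq :=
  match u, v with
  | inl f, inl g => inl (fun n => f n * g n)
  | inr f, inr g => inr (fun n => f n * g n)
  | _, _ => u
  end.

Definition fac_center u : facseq :=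
  match u with
  | inl f => inl (fun n => f n + nccoef (- psi (fac_mx n u)))
  | inr f => inr (fun n => f n + nccoef (- psi (fac_mx n u)))
  end.

Lemma side_coef b a : fac_side (fac_coef b a) = b. Proof. by case: b. Qed.
Lemma side_center u : fac_side (fac_center u) = fac_side u. Proof. by case: u. Qed.

Lemma val_coef n b a : factor_val (fac_at n (fac_coef b a)) = nccoef (a n).
Proof. by case: b => /=; rewrite ?ncinl_coef ?ncinr_coef. Qed.
Lemma val_mul n u v : fac_side u = fac_side v ->
  factor_val (fac_at n (fac_mul u v)) = factor_val (fac_at n u) * factor_val (fac_at n v).
Proof. by case: u v => f [] g //= _; rewrite ?ncinlM ?ncinrM. Qed.
Lemma val_center n u : factor_val (fac_at n u) =
  factor_val (fac_at n (fac_center u)) + nccoef (psi (fac_mx n u)).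
Proof.
case: u => f /=; rewrite ?ncinlD ?ncinrD ?ncinl_coef ?ncinr_coef -addrA -raddfD /=;
by rewrite addNr raddf0 addr0.
Qed.

Lemma mx_coef n b a : fac_mx n (fac_coef b a) = ampl (d n) (a n).
Proof. by case: b; exact: mateval_coef. Qed.
Lemma mx_mul n u v : fac_side u = fac_side v ->
  fac_mx n (fac_mul u v) = fac_mx n u *m fac_mx n v.
Proof. by case: u v => f [] g //= _; exact: matevalM. Qed.
Lemma mx_center n u :
  fac_mx n (fac_center u) = fac_mx n u - ampl (d n) (psi (fac_mx n u)).
Proof.
rewrite -raddfN /=; case: u => f; rewrite /fac_mx /= matevalD; congr (_ + _);
exact: mateval_coef.
Qed.

Lemma psi_ampl n (a : 'M[C]_p) : psi (ampl (d n) a) = a.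
Proof.
apply/matrixP => i j; rewrite mxE block_ampl mxtrace_scalar -[a i j *+ _]mulr_natl mulrA.
by rewrite mulVf ?mul1r// pnatr_eq0 -lt0n d_gt0.
Qed.

Lemma psiB n (M M' : 'M[C]_(N n)) : psi (M - M') = psi M - psi M'.
Proof.
apply/matrixP => i j; rewrite !mxE /block submxblockB raddfB /= mulrBr //.
Qed.

Lemma nrm_psi n (M : 'M[C]_(N n)) c i j : opb M c -> nrm (psi M i j) <= c.
Proof.
move=> Mc; have := trace_state_le (d_gt0 n) (opb_block i j Mc).
by rewrite mxE mul_scalar_mx mxtraceZ.
Qed.

Lemma centered_center u : fac_centered (fac_center u).
Proof. by move=> n; rewrite mx_center psiB psi_ampl subrr. Qed.

Lemma bounded_coef b (a : nat -> 'M[C]_p) (c : R) :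
  (forall n i j, nrm (a n i j) <= c) -> fac_bounded (fac_coef b a).
Proof.
move=> h; exists (\sum_(i < p) \sum_(j < p) c) => n; rewrite mx_coef.
exact: opb_ampl.
Qed.

Lemma bounded_mul u v : fac_side u = fac_side v ->
  fac_bounded u -> fac_bounded v -> fac_bounded (fac_mul u v).
Proof.
move=> uv [c hc] [c' hc']; exists (c * c') => n; rewrite mx_mul//.
exact: opb_mul.
Qed.

Lemma bounded_psi u : fac_bounded u ->
  exists c : R, forall n i j, nrm (psi (fac_mx n u) i j) <= c.
Proof. by move=> [c hc]; exists c => n i j; exact: nrm_psi. Qed.

Lemma bounded_center u : fac_bounded u -> fac_bounded (fac_center u).
Proof.
move=> hu; have [c hc] := hu; have [c' hc'] := bounded_psi hu.
exists (c + \sum_(i < p) \sum_(j < p) c') => n; rewrite mx_center.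
by apply: opbD => //; apply: opbN; exact: opb_ampl.
Qed.

Definition facprod n s : BXY := \prod_(u <- s) factor_val (fac_at n u).

Lemma facprod_cat n s1 s2 : facprod n (s1 ++ s2) = facprod n s1 * facprod n s2.
Proof. by rewrite /facprod big_cat. Qed.

Lemma facprod1 n u : facprod n [:: u] = factor_val (fac_at n u).
Proof. by rewrite /facprod big_seq1. Qed.

Lemma facprod_cons n u s : facprod n (u :: s) = factor_val (fac_at n u) * facprod n s.
Proof. by rewrite /facprod big_cons. Qed.

Variable D : nat -> T -> BXY -> 'M[C]_p.
Hypothesis D_add : forall n w P P', D n w (P + P') = D n w P + D n w P'.
Hypothesis D_factor : forall n w (u : BX + BX), D n w (factor_val u) = 0.
Hypothesis D_centered : forall s, s <> [::] -> alt (map fac_side s) ->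
  seqall fac_bounded s -> seqall fac_centered s ->
  forall i j, asnull Pr (fun n w => D n w (facprod n s) i j).

Definition vanishes (X : nat -> BXY) : Prop :=
  forall i j, asnull Pr (fun n w => D n w (X n) i j).

Lemma vanishes_ext X Y : (forall n, X n = Y n) -> vanishes X -> vanishes Y.
Proof. by move=> XY hX i j; apply: asnull_ext (hX i j) => n w; rewrite XY. Qed.

Lemma vanishesD X Y : vanishes X -> vanishes Y -> vanishes (fun n => X n + Y n).
Proof.
move=> hX hY i j; apply: asnull_ext (asnullD (hX i j) (hY i j)) => n w.
by rewrite D_add mxE.
Qed.

Lemma vanishes_factor u : vanishes (fun n => factor_val (fac_at n u)).
Proof.
by move=> i j; apply: asnull_ext (asnull0 Pr) => n w; rewrite D_factor mxE.
Qed.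

Lemma not_alt_split s : ~~ alt (map fac_side s) ->
  exists s1 u v s2, s = s1 ++ u :: v :: s2 /\ fac_side u = fac_side v.
Proof.
elim: s => //= u [|v s] IH //=; rewrite negb_and negbK => /orP[/eqP uv|h].
  by exists [::], u, v, s.
have [s1 [u' [v' [s2 [e h']]]]] := IH h.
by exists (u :: s1), u', v', s2; rewrite e.
Qed.

(** Induction on the number of factors. Neighbours on the same side are
    multiplied together, which shortens the word. In an alternating word
    each factor is replaced by its centered version from left to right; the
    difference is a word in which that factor is a coefficient, which is
    absorbed by a neighbour, so it is shorter as well. *)
Lemma vanishes_word s : seqall fac_bounded s -> vanishes (fun n => facprod n s).
Proof.
have [m] := ubnP (size s); elim: m s => // m IH s sm hs.
have merge s1 u v s2 : ((size s1 + size s2).+1 < m)%N -> fac_side u = fac_side v ->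
    seqall fac_bounded (s1 ++ u :: v :: s2) ->
    vanishes (fun n => facprod n (s1 ++ u :: v :: s2)).
  move=> sz uv /seqall_cat[h1 [hu [hv h2]]].
  apply: vanishes_ext (IH (s1 ++ fac_mul u v :: s2) _ _) => [n||].
  - by rewrite !facprod_cat !facprod_cons val_mul// -[(_ * _) * facprod _ _]mulrA.
  - by rewrite size_cat /= addnS.
  - apply/seqall_cat; exact: (conj h1 (conj (bounded_mul uv hu hv) h2)).
have [alts|/not_alt_split[s1 [u [v [s2 [e uv]]]]]] := boolP (alt (map fac_side s));
  last first.
  rewrite e in hs sm *; apply: merge => //.
  by move: sm; rewrite size_cat /= !addnS ltnS.
(* The factors in s1 are already centered, those in s2 are not yet. *)
suff main s2 s1 : (size (s1 ++ s2) <= m)%N -> alt (map fac_side (s1 ++ s2)) ->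
    seqall fac_bounded (s1 ++ s2) -> seqall fac_centered s1 ->
    vanishes (fun n => facprod n (s1 ++ s2)).
  by apply: (main s [::]).
elim: s2 s1 => [|u s2 IH2] s1 sz alt12 h12 c1.
  rewrite cats0 in sz alt12 h12 *.
  case: s1 sz alt12 h12 c1 => [_ _ _ _|v s1 sz alt12 h12 c1].
    apply: vanishes_ext (vanishes_factor (fac_coef true (fun=> 1))) => n.
    by rewrite val_coef /facprod big_nil; exact: rmorph1.
  exact: D_centered.
have [h1 [hu h2]] := iffLR (seqall_cat _ _ _) h12.
pose a n := psi (fac_mx n u).
have [c ha] := bounded_psi hu.
apply: (@vanishes_ext (fun n => facprod n (rcons s1 (fac_center u) ++ s2) +
  facprod n (s1 ++ fac_coef (fac_side u) a :: s2))).
  move=> n; rewrite cat_rcons !facprod_cat !facprod_cons -mulrDr -mulrDl.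
  by rewrite val_coef -val_center.
apply: vanishesD.
  apply: (IH2 (rcons s1 (fac_center u))); rewrite ?cat_rcons.
  - by move: sz; rewrite !size_cat.
  - by move: alt12; rewrite !map_cat /= side_center.
  - apply/seqall_cat; exact: (conj h1 (conj (bounded_center hu) h2)).
  - rewrite -cats1.
    apply/seqall_cat; exact: (conj c1 (conj (centered_center u) I)).
case: s2 {IH2} sz alt12 h12 h2 => [|v s2] sz alt12 h12 h2.
  case/lastP: s1 sz alt12 h1 h12 c1 => [_ _ _ _ _|s1 v sz alt12 h1 h12 c1].
    by apply: vanishes_ext (vanishes_factor (fac_coef (fac_side u) a)) => n; rewrite facprod1.
  apply: (@vanishes_ext (fun n => facprod n (s1 ++ v :: fac_coef (fac_side v) a :: [::]))).
    by move=> n; rewrite cat_rcons !facprod_cat !facprod_cons !val_coef.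
  apply: merge; first by move: sz; rewrite cats1 !size_rcons addn0.
    by rewrite side_coef.
  apply/seqall_cat; move: h1; rewrite -cats1 => /seqall_cat[h1 [hv _]].
  exact: (conj h1 (conj hv (conj (bounded_coef _ ha) I))).
apply: (@vanishes_ext (fun n => facprod n (s1 ++ fac_coef (fac_side v) a :: v :: s2))).
  by move=> n; rewrite !facprod_cat !facprod_cons !val_coef.
apply: merge.
- by move: sz; rewrite size_cat /= !addnS.
- by rewrite side_coef.
- apply/seqall_cat; exact: (conj h1 (conj (bounded_coef _ ha) h2)).
Qed.

Hypothesis A_bounded : forall k, exists c : R, forall n, opb (A n k) c.
Hypothesis B_bounded : forall k, exists c : R, forall n, opb (B n k) c.

(** The property that makes induction on polynomial expressions work: a
    product of two expressions is handled by absorbing them one after the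
    other into a word on their left. *)
Definition absorbed (X : nat -> BXY) : Prop :=
  forall s, seqall fac_bounded s -> vanishes (fun n => facprod n s * X n).

Lemma absorbed_factor u X : fac_bounded u -> absorbed X ->
  absorbed (fun n => factor_val (fac_at n u) * X n).
Proof.
move=> hu hX s hs; apply: vanishes_ext (hX (rcons s u) _) => [n|].
  by rewrite -cats1 facprod_cat facprod1 mulrA.
by rewrite -cats1; apply/seqall_cat.
Qed.

Lemma absorbed_poly (Q : BXY) X : absorbed X -> absorbed (fun n => Q * X n).
Proof.
elim/quotW: Q => t; elim: t X => [a|[k|k]|t1 IH1 t2 IH2|t1 IH1 t2 IH2] X hX.
- have hb : fac_bounded (fac_coef true (fun=> a)).
    apply: (@bounded_coef _ _ (\sum_i \sum_j nrm (a i j))) => _ i j.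
    rewrite (bigD1 i)//= (bigD1 j)//= -addrA lerDl addr_ge0 ?sumr_ge0// => l _.
      exact: nrm_ge0.
    by rewrite sumr_ge0// => ? _; exact: nrm_ge0.
  have := absorbed_factor hb hX.
  by under [X in absorbed X -> _]eq_fun do rewrite val_coef.
- have hb : fac_bounded (inl (fun=> ncvar k)).
    by have [c hc] := A_bounded k; exists c => n; rewrite /fac_mx /= mateval_var.
  have := absorbed_factor hb hX.
  by under [X in absorbed X -> _]eq_fun do rewrite /= ncinl_var.
- have hb : fac_bounded (inr (fun=> ncvar k)).
    by have [c hc] := B_bounded k; exists c => n; rewrite /fac_mx /= mateval_var.
  have := absorbed_factor hb hX.
  by under [X in absorbed X -> _]eq_fun do rewrite /= ncinr_var.
- move=> s hs; apply: vanishes_ext (vanishesD (IH1 X hX s hs) (IH2 X hX s hs)) => n.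
  by rewrite -mulrDr -mulrDl; congr (_ * (_ * _)); exact: pi_ncadd.
- move=> s hs; apply: vanishes_ext (IH1 _ (IH2 X hX) s hs) => n.
  by rewrite [_ * (_ * X n)]mulrA; congr (_ * (_ * _)); exact: pi_ncmul.
Qed.

(** Every polynomial is built from coefficients and indeterminates, which
    are bounded factors, by sums and products. *)
Theorem vanishes_poly (Q : BXY) : vanishes (fun=> Q).
Proof.
have h1 : absorbed (fun=> 1).
  by move=> s hs; apply: vanishes_ext (vanishes_word hs) => n; rewrite mulr1.
apply: vanishes_ext (absorbed_poly Q h1 (s := [::]) I) => n.
by rewrite /facprod big_nil mul1r mulr1.
Qed.

End CenteringReduction.

Arguments fac_side {R p K} u.
Arguments fac_at {R p K} n u.

(** * Evaluation at a conjugated family *)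

Section ConjugatedEvaluation.
Variables (R : realType) (p d : nat) (K : Type).
Hypothesis d_gt0 : (0 < d)%N.
Local Notation C := (Cplx R).
Local Notation N := (blocksize p d).
Local Notation G := (@unitary_fix_eps1 R d).
Variables (x y : K -> 'M[C]_N) (V : 'M[C]_d).
Hypothesis GV : G V.

Lemma conj_blocksD : {morph conj_blocks V : M M' / (M : 'M[C]_N) + M'}.
Proof. by move=> M M'; rewrite /conj_blocks mulmxDr mulmxDl. Qed.

Lemma conj_blocksM : {morph conj_blocks V : M M' / (M : 'M[C]_N) * M'}.
Proof.
have VV : V^t* *m V = 1%:M by case: GV => /unitarymxP /mulmx1C.
move=> M M'; apply: block_inj => i j.
rewrite block_conj !block_mul mulmx_sumr mulmx_suml; apply: eq_bigr => k _.
rewrite !block_conj !mulmxA -[X in _ = X *m _ *m _]mulmxA VV mulmx1 //.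
Qed.

Lemma conj_blocks_ampl (a : 'M[C]_p) : conj_blocks V (ampl d a) = ampl d a.
Proof.
have VV : V *m V^t* = 1%:M by case: GV => /unitarymxP.
apply: block_inj => i j; rewrite block_conj block_ampl.
by rewrite scalar_mxC -mulmxA VV mulmx1.
Qed.

Lemma psi_conj_blocks M : psi (conj_blocks V M) = psi M :> 'M[C]_p.
Proof.
apply/matrixP => i j; rewrite !mxE block_conj; congr (_ * _).
exact: (tr_lval (true, block M i j) GV).
Qed.

Lemma phi_conj_blocks M : phi (conj_blocks V M) = phi M :> 'M[C]_p.
Proof.
apply/matrixP => i j; rewrite !mxE (eps1_proj R d_gt0) !tr_delta_mul block_conj.
exact: (entry_lval d_gt0 (true, block M i j) GV).
Qed.

(** The joint family, with the second half conjugated. *)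
Definition conj_family : K + K -> 'M[C]_N :=
  pair_family x (fun k => conj_blocks V (y k)).

Lemma mateval_factor u : mateval conj_family (factor_val u) =
  if factor_side u then factor_mx x y u else conj_blocks V (factor_mx x y u).
Proof.
case: u => P /=.
  apply: (nceval_transfer (rho := @ampl R p d) (rho' := @ampl R p d) (h := id)) => //;
    by move=> a k; exact: ampl_scalar_comm.
apply: (nceval_transfer (rho := @ampl R p d) (rho' := @ampl R p d)) => //.
- by move=> a k; exact: ampl_scalar_comm.
- by move=> a k; exact: ampl_scalar_comm.
- exact: conj_blocksD.
- exact: conj_blocksM.
- exact: conj_blocks_ampl.
Qed.

Lemma psi_of_factor u : psi_of conj_family (factor_val u) =
  factor_map (psi_of x) (psi_of y) u.
Proof. by rewrite /psi_of mateval_factor; case: u => P; [|exact: psi_conj_blocks]. Qed.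

Lemma phi_of_factor u : phi_of conj_family (factor_val u) =
  factor_map (phi_of x) (phi_of y) u.
Proof. by rewrite /phi_of mateval_factor; case: u => P; [|exact: phi_conj_blocks]. Qed.

Lemma psiD (M M' : 'M[C]_N) : psi (M + M') = psi M + psi M'.
Proof. by apply/matrixP => i j; rewrite !mxE blockD raddfD /= mulrDr. Qed.

Lemma phiD (M M' : 'M[C]_N) : phi (M + M') = phi M + phi M'.
Proof. by apply/matrixP => i j; rewrite !mxE blockD mulmxDr raddfD. Qed.

End ConjugatedEvaluation.

(** * Conditional freeness *)

Section ConditionalFreeness.
Context {R : realType} {dsp : measure_display} {T : measurableType dsp}.
Variable Pr : probability T R.
Local Notation C := (Cplx R).
Variables (p : nat) (K : Type) (d : nat -> nat).
Hypotheses (d_gt0 : forall n, (0 < d n)%N) (d_inj : injective d) (d_oo : d @ \oo --> \oo).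
Local Notation N n := (blocksize p (d n)).
Variables (A B : forall n, K -> 'M[C]_(N n)).
Hypothesis A_bounded : forall k, exists c : R, forall n, opb (A n k) c.
Hypothesis B_bounded : forall k, exists c : R, forall n, opb (B n k) c.
Variable U : forall n, T -> 'M[C]_(d n).
Hypothesis U_haar : forall n, haar_distributed Pr (@unitary_fix_eps1 R (d n)) (U n).
Local Notation BX := (ncpoly C p K).
Local Notation BXY := (ncpoly C p (K + K)).
Implicit Types (s : seq (facseq (R := R) p K)) (P : BXY).

Local Notation AUBU n w := (conj_family (A n) (B n) (U n w)).

Let GU n w : unitary_fix_eps1 (U n w). Proof. exact: haar_in (U_haar n) w. Qed.

Lemma mateval_pairD n w P P' :
  mateval (AUBU n w) (P + P') = mateval (AUBU n w) P + mateval (AUBU n w) P'.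
Proof. by apply: ncevalD => a k; exact: ampl_scalar_comm. Qed.

Lemma mateval_pairM n w P P' :
  mateval (AUBU n w) (P * P') = mateval (AUBU n w) P *m mateval (AUBU n w) P'.
Proof. by apply: ncevalM => a k; exact: ampl_scalar_comm. Qed.

Lemma mateval_pair1 n w : mateval (AUBU n w) 1 = 1%:M.
Proof.
apply: (etrans (nceval_coef _ 1)); first by move=> a k; exact: ampl_scalar_comm.
exact: rmorph1.
Qed.

(** The word of block matrices of a product of factors. The flag of a letter
    is the negation of the side, since it is the second family that is
    conjugated. *)
Definition letters s : seq (bool * bmxseq (R := R) d p) :=
  [seq (~~ fac_side u, fun n => fac_mx A B n u) | u <- s].

Lemma mateval_facprod n w s :
  mateval (AUBU n w) (facprod n s) = bword U n w (letters s).
Proof.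
elim: s => [|u s IH]; first by rewrite /facprod big_nil mateval_pair1.
rewrite facprod_cons mateval_pairM IH /=; congr (_ *m _).
by rewrite mateval_factor// /bval; case: u.
Qed.

Lemma letters_alt s : alt (map fac_side s) -> alt (map fst (letters s)).
Proof.
rewrite -map_comp /alt !sorted_map; apply: sub_sorted => u v /=.
by case: (fac_side u); case: (fac_side v).
Qed.

Lemma letters_centered s : seqall (fac_bounded A B) s -> seqall (fac_centered A B) s ->
  seqall (@centered_bseq R d p) (letters s).
Proof.
by elim: s => //= u s IH [bu bs] [cu cs]; split; [split|exact: IH].
Qed.

Lemma alternating_fac_at n s : s <> [::] -> alt (map fac_side s) ->
  seqall (fac_centered A B) s ->
  alternating_centered (psi_of (A n)) (psi_of (B n)) (map (fac_at n) s).
Proof.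
move=> s0 salt cs; apply/and3P; split.
- by rewrite size_map; case: s s0 {salt cs}.
- move: salt; rewrite /alt !sorted_map; apply: sub_sorted => u v.
  by case: u; case: v.
- elim: s cs {s0 salt} => //= u s IH [cu cs]; rewrite IH// andbT.
  by apply/eqP; rewrite -(cu n); case: u {cu}.
Qed.

Lemma phiprodE n s : phiprod n (letters s) =
  \prod_(u <- map (fac_at n) s) factor_map (phi_of (A n)) (phi_of (B n)) u.
Proof.
elim: s => [|u s IH] /=; first by rewrite big_nil.
by rewrite big_cons IH; case: u.
Qed.

Lemma facprodE n s : facprod n s = \prod_(u <- map (fac_at n) s) factor_val u.
Proof. by rewrite big_map. Qed.

(** The difference of the two sides is additive, is 0 on single factors, and
    on centered alternating products reduces to the joint state, because the
    free product is 0 there. *)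
Lemma psi_vanishes P : vanishes Pr (fun n w P => psi_of (AUBU n w) P -
  free_product (psi_of (A n)) (psi_of (B n)) P) (fun=> P).
Proof.
apply: (vanishes_poly d_gt0 (A := A) (B := B)) => //.
- move=> n w P1 P2; have [[fD _] _ _ _] := free_productP (d_gt0 n) (A n) (B n).
  by rewrite fD /psi_of mateval_pairD psiD opprD addrACA.
- move=> n w u; rewrite psi_of_factor//.
  have [_ fl fr _] := free_productP (d_gt0 n) (A n) (B n).
  by case: u => P1 /=; rewrite ?fl ?fr subrr.
- move=> s s0 salt bs cs i j.
  apply: asnull_ext (psi_bword_null d_gt0 d_inj d_oo U_haar i j _
    (letters_centered bs cs) (letters_alt salt)) => [n w|]; last first.
    by case: s s0 {salt bs cs}.
  have [_ _ _ fa] := free_productP (d_gt0 n) (A n) (B n).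
  rewrite -mateval_facprod [in RHS]facprodE fa ?subr0 -?facprodE//.
  exact: alternating_fac_at.
Qed.

Lemma phi_vanishes P : vanishes Pr (fun n w P => phi_of (AUBU n w) P -
  cfree_product (psi_of (A n)) (psi_of (B n)) (phi_of (A n)) (phi_of (B n)) P)
  (fun=> P).
Proof.
apply: (vanishes_poly d_gt0 (A := A) (B := B)) => //.
- move=> n w P1 P2; have [[fD _] _ _ _] := cfree_productP (d_gt0 n) (A n) (B n).
  by rewrite fD /phi_of mateval_pairD phiD opprD addrACA.
- move=> n w u; rewrite phi_of_factor//.
  have [_ fl fr _] := cfree_productP (d_gt0 n) (A n) (B n).
  by case: u => P1 /=; rewrite ?fl ?fr subrr.
- move=> s s0 salt bs cs i j.
  apply: asnull_ext (phi_bword_null d_gt0 d_inj d_oo U_haar i j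
    (letters_centered bs cs) (letters_alt salt)) => n w.
  have [_ _ _ fa] := cfree_productP (d_gt0 n) (A n) (B n).
  rewrite -mateval_facprod phiprodE [in RHS]facprodE fa -?facprodE//.
  exact: alternating_fac_at.
Qed.

End ConditionalFreeness.

(** There are finitely many entries, so their exceptional sets together are
    negligible. *)
Lemma ae_matrix_null (R : realType) (dsp : measure_display) (T : measurableType dsp)
    (Pr : probability T R) (p : nat) (F : nat -> T -> 'M[Cplx R]_p) :
  (forall i j, asnull Pr (fun n w => F n w i j)) ->
  {ae Pr, forall w, (fun n => F n w) @ \oo --> (0 : 'M[Cplx R]_p)}.
Proof.
move=> hF.
have : {ae Pr, forall w, forall i j, null (fun n => F n w i j)}.
  apply: (@filter_forall T 'I_p (fun i w => forall j, null (fun n => F n w i j)) _ _).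
  move=> i.
  apply: (@filter_forall T 'I_p (fun j w => null (fun n => F n w i j)) _ _) => j.
  exact: hF.
by apply: filterS => w; exact: null_matrix.
Qed.

Theorem proposition5p3p1 (R : realType) (p : nat) (hp : (1 <= p)%N) (K : Type)
    (d : nat -> nat) (d_gt0 : forall n, (0 < d n)%N)
    (d_inj : injective d) (d_oo : d @ \oo --> \oo)
    (A B : forall n, K -> 'M[Cplx R]_(blocksize p (d n)))
    (A_bounded : forall k, exists c : R, forall n, opnorm (A n k) <= c)
    (B_bounded : forall k, exists c : R, forall n, opnorm (B n k) <= c)
    (dsp : measure_display) (T : measurableType dsp) (Pr : probability T R)
    (U : forall n, T -> 'M[Cplx R]_(d n))
    (U_haar : forall n,
      haar_distributed Pr (@unitary_fix_eps1 R (d n)) (U n))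
    (Q : ncpoly (Cplx R) p (K + K)) :
  let AUBU n w :=
    pair_family (A n) (fun k => conj_blocks (U n w) (B n k)) in
  {ae Pr, forall w : T,
    ((fun n => psi_of (AUBU n w) Q
               - free_product (psi_of (A n)) (psi_of (B n)) Q)
       @ \oo --> (0 : 'M[Cplx R]_p)) /\
    ((fun n => phi_of (AUBU n w) Q
               - cfree_product (psi_of (A n)) (psi_of (B n))
                               (phi_of (A n)) (phi_of (B n)) Q)
       @ \oo --> (0 : 'M[Cplx R]_p))}.
Proof.
have opb_family (X : forall n, K -> 'M[Cplx R]_(blocksize p (d n))) :
    (forall k, exists c : R, forall n, opnorm (X n k) <= c) ->
    forall k, exists c : R, forall n, opb (X n k) c.
  by move=> hX k; have [c hc] := hX k; exists c => n; exact: opnorm_opb.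
have A_opb := opb_family _ A_bounded; have B_opb := opb_family _ B_bounded.
have := ae_matrix_null (psi_vanishes d_gt0 d_inj d_oo A_opb B_opb U_haar Q).
have := ae_matrix_null (phi_vanishes d_gt0 d_inj d_oo A_opb B_opb U_haar Q).
by apply: filterS2 => w hphi hpsi; split.
Qed.
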